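(* Let $\kappa<1$ and an integer $k\ge1$ be fixed. For arbitrary real $D,Q,R\ge2$, for all except at most $O\left(D^2R(\log R)^2/\log D\right)$ primes $p\in[Q,2Q]$, the following holds: for every divisor $m$ of $p-1$ such that $d=(p-1)/m$ is odd and $3\le d\le D$, \[ M_{2k}(p,m)=a(k)+O\left(DR^{-\kappa}+Dp^{-1/2+o(1)}\right)\quad\text{and}\quad M^-_{2k}(p,m)=a(k)+O\left(DR^{-\kappa}+Dp^{-1/2+o(1)}\right), \] where implied constants depend only on $k,\kappa$, and $o(1)$ denotes a quantity tending to $0$ as $p\to\infty$.
   Context: For a prime $p$ and a divisor $m$ of $p-1$, let $d=(p-1)/m$, let $\mathcal G_m\subseteq\mathbb F_p^*$ be the unique multiplicative subgroup of index $m$ (order $d$), and let $\mathcal X_{p,m}$ be the group of multiplicative characters of $\mathbb F_p^*$ trivial on $\mathcal G_m$ (viewed as Dirichlet characters modulo $p$). Let $\mathcal X_{p,m}^-=\{\chi\in\mathcal X_{p,m}:\chi(-1)=-1\}$. Define \[ M_\nu(p,m)=\frac1m\sum_{\substack{\chi\in\mathcal X_{p,m}\\ \chi\ \text{non-principal}}}|L(1,\chi)|^\nu,\qquad M_\nu^-(p,m)=\frac{1}{\#\mathcal X_{p,m}^-}\sum_{\chi\in\mathcal X_{p,m}^-}|L(1,\chi)|^\nu, \] where $L(s,\chi)$ is the Dirichlet $L$-function. Let $\tau_k(n)$ be the number of ordered $k$-tuples of positive integers with product $n$, and $a(k)=\sum_{n\ge1}\tau_k(n)^2/n^2$. *)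

(* Defs.v *)
From Stdlib Require Import Reals Lra Lia ZArith Znumtheory List Classical ClassicalEpsilon.
From Coquelicot Require Import Coquelicot.
Import ListNotations.
Open Scope R_scope.

Definition is_dchar (p : nat) (chi : nat -> C) : Prop :=
  (forall a b : nat, chi (a * b)%nat = Cmult (chi a) (chi b)) /\
  (forall n : nat, chi (n + p)%nat = chi n) /\
  (forall n : nat, chi n = 0%C <-> Nat.modulo n p = 0%nat).

(* G_m = the subgroup of m-th powers in F_p^*, i.e. the unique subgroup of
   index m (m | p-1).  chi is trivial on G_m iff chi(x^m) = 1 for every unit x. *)
Definition trivial_on_Gm (p m : nat) (chi : nat -> C) : Prop :=
  forall x : nat, Nat.modulo x p <> 0%nat -> chi (x ^ m)%nat = 1%C.

Definition in_X (p m : nat) (chi : nat -> C) : Prop :=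
  is_dchar p chi /\ trivial_on_Gm p m chi.

Definition principal (p : nat) (chi : nat -> C) : Prop :=
  forall n : nat, Nat.modulo n p <> 0%nat -> chi n = 1%C.

(* chi(-1) = -1, with -1 represented by the residue p-1 *)
Definition odd_char (p : nat) (chi : nat -> C) : Prop :=
  chi (p - 1)%nat = Copp 1%C.

(* A duplicate-free list enumerating exactly the characters satisfying P
   (chosen by Hilbert's epsilon; such a list exists for the finite sets used). *)
Definition charlist (P : (nat -> C) -> Prop) : list (nat -> C) :=
  epsilon (inhabits nil)
    (fun l : list (nat -> C) => NoDup l /\ forall chi, In chi l <-> P chi).

Definition L1 (chi : nat -> C) : C :=
  (Series (fun n => fst (chi (S n)) / INR (S n)),
   Series (fun n => snd (chi (S n)) / INR (S n))).

Definition sumR (l : list R) : R := fold_right Rplus 0 l.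

Definition Mnu (nu p m : nat) : R :=
  / INR m *
  sumR (map (fun chi => Cmod (L1 chi) ^ nu)
            (charlist (fun chi => in_X p m chi /\ ~ principal p chi))).

Definition Mnu_minus (nu p m : nat) : R :=
  let l := charlist (fun chi => in_X p m chi /\ odd_char p chi) in
  / INR (length l) * sumR (map (fun chi => Cmod (L1 chi) ^ nu) l).

Fixpoint tuples (k n : nat) : list (list nat) :=
  match k with
  | O => [nil]
  | S k' => flat_map (fun i => map (cons i) (tuples k' n)) (seq 1 n)
  end.

(* tau_k(n): number of ordered k-tuples of positive integers with product n
   (for n >= 1 every entry of such a tuple is <= n). *)
Definition tau (k n : nat) : nat :=
  length (filter (fun l => Nat.eqb (fold_right Nat.mul 1%nat l) n) (tuples k n)).

Definition a_const (k : nat) : R :=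
  Series (fun n => (INR (tau k (S n)))^2 / (INR (S n))^2).

(* Main.v *)
Require Import Defs.
From Stdlib Require Import Reals ZArith Znumtheory List.
From Stdlib Require Import Lra Lia Classical ClassicalEpsilon FunctionalExtensionality Permutation.
From Coquelicot Require Import Coquelicot.
From mathcomp Require ssreflect ssrfun ssrbool eqtype ssrnat seq fintype div prime.
From mathcomp Require ssralg poly finalg zmodp cyclic finfield.
Import ListNotations.
Open Scope R_scope.

(** Truncating [L(1, chi)] at [N = p^2] costs [O(1/p)], and the [2k]-th moment of the truncated sums
    opens into a sum of [t(a) t(b) / (a b)] over [a, b <= p^(2k)] with [t(n) <= tau_k(n)].
    Orthogonality keeps the pairs with [a = b], which give [a(k)] up to [O(p^(-1/2))], and pairs
    [a <> b] with [a = u b] mod [p] for one of the [2d] elements [u] of [{1, -1} G_m].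

    Such a pair satisfies [p | a^(2d) - b^(2d)].  The exceptional primes are the primes [p >= d]
    dividing [a^(2d) - b^(2d)] for some [a <> b] with [a b <= R]; each of these integers has at most
    [2 d log R / log d] of them.  For the other [p] all off-diagonal pairs, even after division by
    their gcd, have [a b > R].  For fixed [u] they lie in a lattice of determinant [p], so distinct
    primitive vectors have cross product at least [p], and the dyadic box [2^s <= a < 2^(s+1)],
    [2^t <= b < 2^(t+1)] holds at most [1 + 8 2^(s+t) / p] of them.  Summing over boxes with the
    divisor bound gives [O(R^(-kappa) + p^(-1/2))] for each [u], so [eps = 0] suffices. *)

(** * Primitive roots *)

(** Because [d] is odd, [-1] lies outside [G_m]; hence [m = 2 h] is even and [{1, -1} G_m] is the
    subgroup of order [2 d]. The mean over odd characters is the mean over all characters minus the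
    mean taken with signs [(-1)^j]: the former detects [a / b] in [G_m], the latter [a / b] in
    [-G_m]. One off-diagonal estimate for the group of order [2 d] therefore serves both moments.
    The obstacle is the range: [a] and [b] run up to [p^(2k)], far beyond [p], whereas discarding
    primes only removes pairs with [a b <= R]. In a box with [X = 2^(s+t)] the two terms of the
    count [1 + 8 X / p] are paid for differently: the first by [X >= R / 4], the second by the
    factor [1 / p] it carries. There is room for [eps = 0] because the lattice term is of order
    [p^(4 k delta - 1)] with [delta <= 1 / (8 k)], while the logarithms from the truncation come
    with a factor [1 / p]. The principal character, present in the orthogonality relation but absent
    from [Mnu], costs at most a constant times [d p^(-1/2)]. *)

Module PrimitiveRoot.
Import ssreflect ssrfun ssrbool eqtype ssrnat seq fintype div prime ssralg poly finalg zmodp cyclic finfield.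
Import GRing.Theory.

Lemma modulo_modn a b : b <> 0%N -> Nat.modulo a b = modn a b.
Proof.
move=> b0; apply: esym; apply: (PeanoNat.Nat.mod_unique _ _ (divn a b)).
  by apply/ltP; rewrite ltn_mod lt0n; apply/eqP.
by rewrite {1}(divn_eq a b) mulnC.
Qed.

Lemma pow_expn a n : Nat.pow a n = expn a n.
Proof. by elim: n => //= n ->; rewrite expnS. Qed.

Lemma prime_primeZ p : Znumtheory.prime (Z.of_nat p) -> prime p.
Proof.
case=> gt1 rel.
have lt1 : (1 < p)%N by apply/ltP; lia.
apply/primeP; split=> // d /dvdnP [q Eq].
have [_|/eqP dn1] := eqVneq d 1%N; first by [].
have [_|/eqP dnp] := eqVneq d p; first by [].
have dpos : (0 < d)%N by rewrite lt0n; apply/eqP => d0; move: lt1; rewrite Eq d0 muln0.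
have le : (d <= p)%N by rewrite Eq leq_pmull // lt0n; apply/eqP => q0; move: lt1; rewrite Eq q0.
move/ltP: dpos => dpos; move/leP: le => le.
have [_ _ H] : Zis_gcd (Z.of_nat d) (Z.of_nat p) 1 by apply: rel; lia.
have : Z.divide (Z.of_nat d) 1.
  apply: H; first exact: Z.divide_refl.
  by exists (Z.of_nat q); rewrite Eq -Nat2Z.inj_mul.
by move/Z.divide_1_r_nonneg => H1; exfalso; lia.
Qed.

(** The nonzero elements of [F_p] are [p - 1] distinct roots of [X^(p-1) - 1], which is what
    [has_prim_root] needs to find a primitive root of unity of that order; every unit is then one of
    its powers. *)
Lemma primitive_root_ssr p : prime p -> exists g : nat,
  (forall n, modn n p <> 0%N -> exists i, (i < p.-1)%N /\ modn (expn g i) p = modn n p)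
  /\ modn (expn g p.-1) p = modn 1 p.
Proof.
move=> pp; have p1 := prime_gt1 pp.
have cardF := card_Fp pp.
have fermat (x : 'F_p) : x != 0%R -> (x ^+ p.-1 = 1)%R.
  move=> x0; apply: (mulfI x0); rewrite -exprS mulr1 prednK ?prime_gt0 //.
  by have := expf_card x; rewrite cardF.
have : has p.-1.-primitive_root%R [seq x <- enum 'F_p | x != 0%R].
  apply: has_prim_root.
  - by rewrite -subn1 subn_gt0.
  - by apply/allP => x; rewrite mem_filter => /andP [x0 _]; apply/unity_rootP/fermat.
  - by rewrite filter_uniq // enum_uniq.
  - rewrite -{1}cardF -(cardC1 (0%R : 'F_p)) cardE.
    apply: uniq_leq_size; first exact: enum_uniq.
    by move=> x; rewrite mem_enum mem_filter mem_enum andbT.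
case/hasP => z _ prz; exists (z : nat).
have zi i : ((z : nat) ^ i)%:R%R = (z ^+ i)%R :> 'F_p by rewrite natrX natr_Zp.
split.
  move=> n n0.
  have : (n%:R : 'F_p)%R != 0%R.
    apply/eqP => H; apply: n0.
    by rewrite -(val_Fp_nat pp) H.
  move/fermat => /(prim_rootP prz) [i Ei].
  by exists i; split=> //; rewrite -!(val_Fp_nat pp) zi -Ei.
by rewrite -!(val_Fp_nat pp) zi (prim_expr_order prz).
Qed.

End PrimitiveRoot.

Lemma primitive_root (p : nat) : prime (Z.of_nat p) -> exists g : nat,
  (forall n, Nat.modulo n p <> 0%nat ->
     exists i, (i < p - 1)%nat /\ Nat.modulo (Nat.pow g i) p = Nat.modulo n p)
  /\ Nat.modulo (Nat.pow g (p - 1)) p = 1%nat.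
Proof.
  intros Hp. assert (Hp1 : (1 < p)%nat) by (destruct Hp; lia).
  destruct (PrimitiveRoot.primitive_root_ssr p (PrimitiveRoot.prime_primeZ p Hp)) as [g [H1 H2]].
  assert (E : ssrnat.predn p = (p - 1)%nat) by (simpl; lia).
  rewrite E in *.
  exists g; split.
  - intros n Hn. rewrite PrimitiveRoot.modulo_modn in Hn by lia.
    destruct (H1 n Hn) as [i [Hi Ei]]. exists i; split.
    + apply (ssrbool.elimT ssrnat.ltP Hi).
    + rewrite PrimitiveRoot.pow_expn, !PrimitiveRoot.modulo_modn by lia. exact Ei.
  - rewrite PrimitiveRoot.pow_expn, PrimitiveRoot.modulo_modn, H2 by lia.
    rewrite <- PrimitiveRoot.modulo_modn by lia. apply Nat.mod_small; lia.
Qed.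

(** * Finite sums over lists *)

Definition lsum {A : Type} (l : list A) (f : A -> R) : R := sumR (map f l).

Lemma lsum_cons {A} (x : A) l f : lsum (x :: l) f = f x + lsum l f.
Proof. reflexivity. Qed.

Lemma lsum_app {A} (l1 l2 : list A) f : lsum (l1 ++ l2) f = lsum l1 f + lsum l2 f.
Proof.
  induction l1 as [|x l1 IH]; simpl app.
  - unfold lsum at 2; simpl; ring.
  - rewrite !lsum_cons, IH; ring.
Qed.

Lemma lsum_ext {A} (l : list A) f g :
  (forall x, In x l -> f x = g x) -> lsum l f = lsum l g.
Proof.
  intros H. unfold lsum. f_equal. apply map_ext_in, H.
Qed.

Lemma lsum_le {A} (l : list A) f g :
  (forall x, In x l -> f x <= g x) -> lsum l f <= lsum l g.
Proof.
  induction l as [|x l IH]; intros H.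
  - unfold lsum; simpl; lra.
  - rewrite !lsum_cons. apply Rplus_le_compat.
    + apply H; left; reflexivity.
    + apply IH; intros y Hy; apply H; right; exact Hy.
Qed.

Lemma lsum_zero {A} (l : list A) f : (forall x, In x l -> f x = 0) -> lsum l f = 0.
Proof.
  induction l as [|x l IH]; intros H; [reflexivity|].
  rewrite lsum_cons, (H x (or_introl eq_refl)), IH; [ring|].
  intros y Hy; apply H; right; exact Hy.
Qed.

Lemma lsum_nonneg {A} (l : list A) f : (forall x, In x l -> 0 <= f x) -> 0 <= lsum l f.
Proof.
  intros H. rewrite <- (lsum_zero l (fun _ => 0)) by reflexivity. apply lsum_le, H.
Qed.

Lemma lsum_plus {A} (l : list A) f g :
  lsum l (fun x => f x + g x) = lsum l f + lsum l g.
Proof.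
  induction l as [|x l IH]; [unfold lsum; simpl; ring|].
  rewrite !lsum_cons, IH; ring.
Qed.

Lemma lsum_scal {A} (l : list A) c f : lsum l (fun x => c * f x) = c * lsum l f.
Proof.
  induction l as [|x l IH]; [unfold lsum; simpl; ring|].
  rewrite !lsum_cons, IH; ring.
Qed.

Lemma lsum_minus {A} (l : list A) f g :
  lsum l (fun x => f x - g x) = lsum l f - lsum l g.
Proof.
  induction l as [|x l IH]; [unfold lsum; simpl; ring|].
  rewrite !lsum_cons, IH; ring.
Qed.

Lemma lsum_const {A} (l : list A) c : lsum l (fun _ => c) = INR (length l) * c.
Proof.
  induction l as [|x l IH]; [unfold lsum; simpl; ring|].
  rewrite lsum_cons, IH. simpl length. rewrite S_INR. ring.
Qed.

Lemma lsum_Rabs {A} (l : list A) f : Rabs (lsum l f) <= lsum l (fun x => Rabs (f x)).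
Proof.
  induction l as [|x l IH].
  - unfold lsum; simpl; rewrite Rabs_R0; lra.
  - rewrite !lsum_cons. eapply Rle_trans; [apply Rabs_triang|lra].
Qed.

Lemma lsum_perm {A} (l l' : list A) f : Permutation l l' -> lsum l f = lsum l' f.
Proof.
  induction 1; rewrite ?lsum_cons; try lra; reflexivity.
Qed.

Lemma lsum_map {A B} (h : A -> B) l f : lsum (map h l) f = lsum l (fun x => f (h x)).
Proof. unfold lsum; rewrite map_map; reflexivity. Qed.

Lemma lsum_filter {A} (b : A -> bool) l f :
  lsum (filter b l) f = lsum l (fun x => if b x then f x else 0).
Proof.
  induction l as [|x l IH]; [reflexivity|].
  rewrite lsum_cons, <- IH. simpl. destruct (b x); rewrite ?lsum_cons; ring.
Qed.

Lemma lsum_flat_map {A B} (h : A -> list B) l f :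
  lsum (flat_map h l) f = lsum l (fun x => lsum (h x) f).
Proof.
  induction l as [|x l IH]; [reflexivity|].
  simpl flat_map. rewrite lsum_app, lsum_cons, IH; reflexivity.
Qed.

Lemma lsum_swap {A B} (l1 : list A) (l2 : list B) f :
  lsum l1 (fun x => lsum l2 (fun y => f x y)) = lsum l2 (fun y => lsum l1 (fun x => f x y)).
Proof.
  induction l1 as [|x l1 IH].
  - symmetry; apply lsum_zero; reflexivity.
  - rewrite lsum_cons, IH, <- lsum_plus. apply lsum_ext; intros; reflexivity.
Qed.

Lemma lsum_list_prod {A B} (l1 : list A) (l2 : list B) f :
  lsum (list_prod l1 l2) f = lsum l1 (fun x => lsum l2 (fun y => f (x, y))).
Proof.
  induction l1 as [|x l1 IH]; [reflexivity|].
  simpl list_prod. rewrite lsum_app, lsum_cons, IH, lsum_map; reflexivity.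
Qed.

Lemma lsum_list_prod_mul {A B} (l1 : list A) (l2 : list B) f g :
  lsum (list_prod l1 l2) (fun q => f (fst q) * g (snd q)) = lsum l1 f * lsum l2 g.
Proof.
  rewrite lsum_list_prod. simpl.
  rewrite (lsum_ext _ _ (fun x => lsum l2 g * f x)).
  - rewrite lsum_scal; ring.
  - intros x _. rewrite lsum_scal; ring.
Qed.

Lemma lsum_mul {A B} (l1 : list A) (l2 : list B) f g :
  lsum l1 f * lsum l2 g = lsum l1 (fun x => lsum l2 (fun y => f x * g y)).
Proof.
  rewrite <- lsum_list_prod_mul, lsum_list_prod; reflexivity.
Qed.

Lemma lsum_single {A} (dec : forall x y : A, {x = y} + {x <> y}) (l : list A) a c :
  NoDup l -> In a l -> lsum l (fun x => if dec a x then c else 0) = c.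
Proof.
  induction l as [|x l IH]; intros Hnd Hin; [destruct Hin|].
  inversion Hnd; subst. rewrite lsum_cons. destruct (dec a x) as [->|Hne].
  - rewrite lsum_zero; [ring|]. intros y Hy. destruct (dec x y); [subst; tauto|reflexivity].
  - destruct Hin as [->|Hin]; [congruence|]. rewrite IH by assumption; ring.
Qed.

Lemma lsum_group {A K} (dec : forall x y : K, {x = y} + {x <> y})
  (key : A -> K) (l : list A) (ks : list K) f :
  NoDup ks -> (forall x, In x l -> In (key x) ks) ->
  lsum l f = lsum ks (fun c => lsum (filter (fun x => if dec (key x) c then true else false) l) f).
Proof.
  intros Hnd Hk.
  rewrite (lsum_ext ks _ (fun c => lsum l (fun x => if dec (key x) c then f x else 0))).
  - rewrite lsum_swap. apply lsum_ext; intros x Hx.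
    rewrite lsum_single; auto.
  - intros c _. rewrite lsum_filter. apply lsum_ext; intros x _.
    destruct (dec (key x) c); reflexivity.
Qed.

Lemma NoDup_list_prod {A B} (l1 : list A) (l2 : list B) :
  NoDup l1 -> NoDup l2 -> NoDup (list_prod l1 l2).
Proof.
  intros H1 H2. induction H1 as [|x l1 Hx H1 IH]; [constructor|].
  simpl. apply NoDup_app; auto.
  - apply FinFun.Injective_map_NoDup; auto. intros y z E; congruence.
  - intros [u v] Hu Hv. apply in_map_iff in Hu. destruct Hu as [w [E _]].
    apply in_prod_iff in Hv. inversion E; subst; tauto.
Qed.

(** * The divisor bound *)

Lemma INR_gt0 (n : nat) : (1 <= n)%nat -> 0 < INR n.
Proof. intros; apply lt_0_INR; lia. Qed.

Lemma INR_ge1 (n : nat) : (1 <= n)%nat -> 1 <= INR n.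
Proof. intros H; apply le_INR in H; exact H. Qed.

Lemma Rpower_pos x y : 0 < Rpower x y.
Proof. apply exp_pos. Qed.

Lemma Rpower_ge1 x y : 1 <= x -> 0 <= y -> 1 <= Rpower x y.
Proof.
  intros Hx Hy. rewrite <- (Rpower_O x) by lra. apply Rle_Rpower; lra.
Qed.

Definition ndiv (n : nat) : nat :=
  length (filter (fun i => Nat.eqb (Nat.modulo n i) 0) (seq 1 n)).

Lemma in_divisors (n i : nat) : (1 <= n)%nat ->
  In i (filter (fun i => Nat.eqb (Nat.modulo n i) 0) (seq 1 n)) <-> Nat.divide i n.
Proof.
  intros Hn. rewrite filter_In, in_seq, Nat.eqb_eq. split.
  - intros [H1 H2]. apply Nat.mod_divide in H2; [exact H2|lia].
  - intros H. assert (i <> 0)%nat by (intros ->; apply Nat.divide_0_l in H; lia).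
    split; [apply Nat.divide_pos_le in H; lia|].
    apply Nat.mod_divide; assumption.
Qed.

Lemma NoDup_divisors (n : nat) :
  NoDup (filter (fun i => Nat.eqb (Nat.modulo n i) 0) (seq 1 n)).
Proof. apply NoDup_filter, seq_NoDup. Qed.

Definition nat_prime (q : nat) : Prop :=
  (1 < q)%nat /\ forall i, Nat.divide i q -> i = 1%nat \/ i = q.

Lemma nat_prime_divisor (v : nat) : (2 <= v)%nat -> exists q, nat_prime q /\ Nat.divide q v.
Proof.
  induction v as [v IH] using (well_founded_induction lt_wf). intros Hv.
  destruct (classic (nat_prime v)) as [H|H].
  - exists v; split; [exact H|apply Nat.divide_refl].
  - assert (exists i, Nat.divide i v /\ i <> 1%nat /\ i <> v) as [i [Hd [H1 H2]]].
    { apply NNPP; intros Hno. apply H. split; [lia|]. intros i Hi.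
      apply NNPP; intros Hi'. apply Hno. exists i. tauto. }
    assert (Hi0 : i <> 0%nat) by (intros ->; apply Nat.divide_0_l in Hd; lia).
    pose proof (Nat.divide_pos_le i v ltac:(lia) Hd).
    destruct (IH i ltac:(lia) ltac:(lia)) as [q [Hq Hqd]].
    exists q; split; [exact Hq|]. eapply Nat.divide_trans; eauto.
Qed.

Lemma divisor_of_pow_mul (q e w i : nat) : nat_prime q -> Nat.divide i (q ^ e * w) ->
  exists f i', (f <= e)%nat /\ Nat.divide i' w /\ i = (q ^ f * i')%nat.
Proof.
  intros Hq. revert i. induction e as [|e IH]; intros i Hi.
  - exists 0%nat, i. simpl in *. rewrite Nat.add_0_r in *. auto.
  - destruct (classic (Nat.divide q i)) as [[i1 Hi1]|Hn].
    + assert (Hi' : Nat.divide i1 (q ^ e * w)).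
      { destruct Hi as [c Hc]. exists c. destruct Hq as [Hq _].
        apply (Nat.mul_cancel_l _ _ q); [lia|]. simpl in Hc. subst i. nia. }
      destruct (IH i1 Hi') as [f [i' [H1 [H2 H3]]]].
      exists (S f), i'. split; [lia|]. split; [exact H2|]. subst. simpl. nia.
    + assert (Hg : Nat.gcd i q = 1%nat).
      { destruct (proj2 Hq _ (Nat.gcd_divide_r i q)) as [E|E]; [exact E|].
        exfalso; apply Hn. rewrite <- E at 1. apply Nat.gcd_divide_l. }
      assert (Hi' : Nat.divide i (q ^ e * w)).
      { apply (Nat.gauss _ q); [|exact Hg]. replace (q * (q ^ e * w))%nat with (q ^ S e * w)%nat by (simpl; nia). exact Hi. }
      destruct (IH i Hi') as [f [i' [H1 [H2 H3]]]].
      exists f, i'. split; [lia|auto].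
Qed.

(** Every divisor is some [q^f i'] with [f <= e] and [i'] dividing [w]; these products repeat when
    [q] divides [w], hence an inequality. *)
Lemma ndiv_pow_mul (q e w : nat) : nat_prime q -> (1 <= w)%nat ->
  (ndiv (q ^ e * w) <= (e + 1) * ndiv w)%nat.
Proof.
  intros Hq Hw.
  assert (Hqe : (1 <= q ^ e)%nat) by (pose proof (Nat.pow_nonzero q e); destruct Hq; lia).
  unfold ndiv at 2.
  replace (e + 1)%nat with (length (seq 0 (e + 1))) by apply length_seq.
  rewrite <- length_prod, <- (length_map (fun u => (q ^ fst u * snd u)%nat)).
  apply NoDup_incl_length; [apply NoDup_divisors|].
  intros i Hi. apply in_divisors in Hi; [|nia].
  destruct (divisor_of_pow_mul q e w i Hq Hi) as [f [i' [H1 [H2 H3]]]].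
  apply in_map_iff. exists (f, i'). split; [simpl; congruence|].
  apply in_prod; [apply in_seq; lia|]. apply in_divisors; assumption.
Qed.

Definition rough (P v : nat) : Prop := forall i, (2 <= i <= P)%nat -> ~ Nat.divide i v.

(** Every prime factor [q] of [v] exceeds [P]: removing it at most halves the divisor count, while
    it divides [v^delta] by [q^delta >= 2]. *)
Lemma ndiv_rough (delta : R) (P v : nat) : 0 < delta ->
  2 <= Rpower (INR (P + 1)) delta -> (1 <= v)%nat -> rough P v ->
  INR (ndiv v) <= Rpower (INR v) delta.
Proof.
  intros Hd HP. induction v as [v IH] using (well_founded_induction lt_wf). intros Hv Hr.
  destruct (Nat.eq_dec v 1) as [->|Hv1].
  - unfold ndiv; simpl. unfold Rpower; rewrite ln_1, Rmult_0_r, exp_0. lra.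
  - destruct (nat_prime_divisor v ltac:(lia)) as [q [Hq [w Hw]]].
    assert (Hq1 : (1 < q)%nat) by apply Hq.
    assert (Hw1 : (1 <= w)%nat) by nia.
    assert (HqP : (P + 1 <= q)%nat).
    { destruct (le_lt_dec (P + 1) q); [assumption|]. exfalso.
      apply (Hr q); [lia|]. exists w; exact Hw. }
    assert (Hrw : rough P w).
    { intros i Hi Hiw. apply (Hr i Hi). rewrite Hw. apply Nat.divide_mul_l, Hiw. }
    pose proof (IH w ltac:(nia) Hw1 Hrw) as IHw.
    pose proof (ndiv_pow_mul q 1 w Hq Hw1) as Hm.
    replace (q ^ 1 * w)%nat with v in Hm by (rewrite Nat.pow_1_r; lia).
    apply le_INR in Hm. rewrite mult_INR in Hm. simpl (INR (1 + 1)) in Hm.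
    subst v. rewrite mult_INR, <- Rpower_mult_distr by (apply INR_gt0; lia).
    assert (2 <= Rpower (INR q) delta).
    { eapply Rle_trans; [exact HP|]. apply Rle_Rpower_l; [lra|]. split; [apply INR_gt0; lia|].
      apply le_INR; exact HqP. }
    pose proof (pos_INR (ndiv w)). pose proof (Rpower_pos (INR w) delta). nra.
Qed.

Lemma extract_power (q v : nat) : (2 <= q)%nat -> (1 <= v)%nat ->
  exists e w, v = (q ^ e * w)%nat /\ (1 <= w)%nat /\ ~ Nat.divide q w.
Proof.
  intros Hq. induction v as [v IH] using (well_founded_induction lt_wf). intros Hv.
  destruct (classic (Nat.divide q v)) as [[c Hc]|Hn].
  - destruct (IH c ltac:(nia) ltac:(nia)) as [e [w [E [H1 H2]]]].
    exists (S e), w. split; [subst; simpl; nia|auto].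
  - exists 0%nat, v. simpl. rewrite Nat.add_0_r. auto.
Qed.

(** The price of one small prime, uniform in [q] because [q^e >= 2^e]. It is [exp x >= 1 + x] at
    [x = delta e ln 2], together with [delta ln 2 <= 1]. *)
Lemma linear_le_Rpower (delta : R) (q e : nat) : 0 < delta <= 1 -> (2 <= q)%nat ->
  INR (e + 1) <= / (delta * ln 2) * Rpower (INR (q ^ e)) delta.
Proof.
  intros Hd Hq.
  assert (Hl2 : 0 < ln 2 < 1) by (pose proof ln_lt_2; split; [lra|rewrite <- (ln_exp 1); apply ln_increasing; [lra|]; pose proof (exp_ineq1 1); lra]).
  assert (Hdl : 0 < delta * ln 2 <= 1) by nra.
  apply (Rmult_le_reg_l (delta * ln 2)); [lra|].
  rewrite <- Rmult_assoc, Rinv_r, Rmult_1_l by lra.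
  assert (H2 : Rpower (2 ^ e) delta <= Rpower (INR (q ^ e)) delta).
  { apply Rle_Rpower_l; [lra|]. split; [apply pow_lt; lra|]. rewrite pow_INR.
    apply pow_incr. split; [lra|]. apply le_INR in Hq. exact Hq. }
  eapply Rle_trans; [|exact H2]. unfold Rpower. rewrite ln_pow by lra.
  pose proof (exp_ineq1_le (delta * (INR e * ln 2))) as He.
  rewrite plus_INR. simpl (INR 1). pose proof (pos_INR e). nra.
Qed.

(** The primes up to [P] are moved from [v] into [u] one at a time, each step multiplying the
    constant by [K]. The number of steps is [P], so the constant depends on [delta] and [P] only. *)
Lemma ndiv_split (delta : R) (P : nat) : 0 < delta <= 1 ->
  exists C1, 0 < C1 /\ forall n, (1 <= n)%nat ->
  exists u v, n = (u * v)%nat /\ (1 <= u)%nat /\ (1 <= v)%nat /\ rough P v /\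
    INR (ndiv n) <= C1 * Rpower (INR u) delta * INR (ndiv v).
Proof.
  intros Hd.
  assert (Hl2 : 0 < delta * ln 2 <= 1).
  { pose proof ln_lt_2. assert (ln 2 < 1) by (rewrite <- (ln_exp 1); apply ln_increasing; [lra|]; pose proof (exp_ineq1 1); lra). nra. }
  assert (HK : 1 <= / (delta * ln 2)) by (rewrite <- Rinv_1; apply Rinv_le_contravar; lra).
  set (K := / (delta * ln 2)) in *.
  induction P as [|P IH].
  - exists 1; split; [lra|]. intros n Hn. exists 1%nat, n. repeat split; try lia.
    + intros i Hi; lia.
    + simpl INR. unfold Rpower. rewrite ln_1, Rmult_0_r, exp_0. lra.
  - destruct IH as [C1 [HC1 IH]].
    exists (C1 * K). split; [nra|]. intros n Hn.
    destruct (IH n Hn) as [u [v [E [Hu [Hv [Hr Hb]]]]]].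
    pose proof (Rpower_pos (INR u) delta) as Hpu. pose proof (pos_INR (ndiv v)) as Hnv.
    destruct (classic ((2 <= S P)%nat /\ Nat.divide (S P) v)) as [[H2 Hdv]|Hn2].
    (* A divisor [P + 1] of a number without divisors in [[2, P]] is automatically prime. *)
    + assert (Hq : nat_prime (S P)).
      { split; [lia|]. intros i Hi. assert (i <> 0)%nat by (intros ->; apply Nat.divide_0_l in Hi; lia).
        pose proof (Nat.divide_pos_le i (S P) ltac:(lia) Hi).
        destruct (le_lt_dec i 1); [left; lia|]. destruct (le_lt_dec i P); [|right; lia].
        exfalso. apply (Hr i); [lia|]. eapply Nat.divide_trans; eauto. }
      destruct (extract_power (S P) v H2 Hv) as [e [w [Ev [Hw Hnd]]]].
      assert (Hqe : (1 <= S P ^ e)%nat) by (pose proof (Nat.pow_nonzero (S P) e); lia).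
      exists (u * S P ^ e)%nat, w. split; [subst; lia|]. split; [nia|]. split; [exact Hw|]. split.
      * intros i Hi Hiw. destruct (Nat.eq_dec i (S P)) as [->|Hne]; [tauto|].
        apply (Hr i); [lia|]. rewrite Ev. apply Nat.divide_mul_r, Hiw.
      * pose proof (ndiv_pow_mul (S P) e w Hq Hw) as Hm. rewrite <- Ev in Hm.
        apply le_INR in Hm. rewrite mult_INR in Hm.
        pose proof (linear_le_Rpower delta (S P) e Hd H2) as Hlin. fold K in Hlin.
        rewrite mult_INR, <- Rpower_mult_distr by (apply INR_gt0; assumption).
        pose proof (pos_INR (ndiv w)) as Hnw. pose proof (pos_INR (e + 1)).
        eapply Rle_trans; [exact Hb|].
        assert (Hv2 : INR (ndiv v) <= K * Rpower (INR (S P ^ e)) delta * INR (ndiv w)).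
        { eapply Rle_trans; [exact Hm|]. apply Rmult_le_compat_r; assumption. }
        replace (C1 * K * (Rpower (INR u) delta * Rpower (INR (S P ^ e)) delta) * INR (ndiv w))
          with (C1 * Rpower (INR u) delta * (K * Rpower (INR (S P ^ e)) delta * INR (ndiv w))) by ring.
        apply Rmult_le_compat_l; [nra|exact Hv2].
    + exists u, v. repeat split; try assumption.
      * intros i Hi Hiv. destruct (Nat.eq_dec i (S P)) as [->|Hne]; [apply Hn2; split; [lia|assumption]|].
        apply (Hr i); [lia|assumption].
      * eapply Rle_trans; [exact Hb|]. apply Rmult_le_compat_r; [assumption|].
        apply Rmult_le_compat_r; [lra|]. nra.
Qed.

Lemma ndiv_bound (delta : R) : 0 < delta <= 1 ->
  exists C1, 0 < C1 /\ forall n, (1 <= n)%nat -> INR (ndiv n) <= C1 * Rpower (INR n) delta.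
Proof.
  intros Hd.
  (* Any [P > 2^(1/delta)] separates the small primes, handled by [ndiv_split], from those that
     [ndiv_rough] absorbs at no cost. *)
  assert (exists P : nat, 2 <= Rpower (INR (P + 1)) delta) as [P HP].
  { destruct (INR_unbounded (Rpower 2 (/ delta))) as [P HP]. exists P.
    rewrite <- (Rpower_1 2) at 1 by lra. rewrite <- (Rinv_l delta) by lra.
    rewrite <- Rpower_mult. apply Rle_Rpower_l; [lra|]. split; [apply Rpower_pos|].
    rewrite plus_INR; simpl; lra. }
  destruct (ndiv_split delta P Hd) as [C1 [HC1 H]]. exists C1; split; [exact HC1|].
  intros n Hn. destruct (H n Hn) as [u [v [E [Hu [Hv [Hr Hb]]]]]].
  eapply Rle_trans; [exact Hb|]. subst n.
  rewrite mult_INR, <- Rpower_mult_distr, <- Rmult_assoc by (apply INR_gt0; assumption).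
  apply Rmult_le_compat_l.
  - pose proof (Rpower_pos (INR u) delta). nra.
  - apply (ndiv_rough _ P); auto. lra.
Qed.

(** * Tuples with a prescribed product *)

Definition lprod (l : list nat) : nat := fold_right Nat.mul 1%nat l.

(** The coefficient of [chi(n) / n] in the [k]-th power of the sum of [chi(i) / i] over [i <= N];
    this is the [t(n)] of the overview. *)
Definition tcount (k N n : nat) : nat :=
  length (filter (fun l => Nat.eqb (lprod l) n) (tuples k N)).

Lemma INR_length_filter {A} (b : A -> bool) l :
  INR (length (filter b l)) = lsum l (fun x => if b x then 1 else 0).
Proof. rewrite <- lsum_filter, lsum_const; ring. Qed.

Lemma tcount_S (k N n : nat) :
  INR (tcount (S k) N n) =
  lsum (seq 1 N) (fun i => lsum (tuples k N) (fun l => if Nat.eqb (i * lprod l) n then 1 else 0)).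
Proof.
  unfold tcount. rewrite INR_length_filter. simpl tuples. rewrite lsum_flat_map.
  apply lsum_ext; intros i _. rewrite lsum_map. reflexivity.
Qed.

(** The first entry is one of the divisors of [n], and the remaining entries are counted by
    induction; each of the two factors receives half of [delta]. Uniformity in [N] matters, since
    [N] will be [p^2]. *)
Lemma tcount_bound (k : nat) : forall delta : R, 0 < delta <= 1 ->
  exists C1, 0 < C1 /\ forall N n, (1 <= n)%nat -> INR (tcount k N n) <= C1 * Rpower (INR n) delta.
Proof.
  induction k as [|k IH]; intros delta Hd.
  - exists 1; split; [lra|]. intros N n Hn.
    assert (Hp : 1 <= Rpower (INR n) delta) by (apply Rpower_ge1; [apply INR_ge1; lia|lra]).
    unfold tcount; simpl. destruct n as [|[|n]]; simpl in *; lra.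
  - destruct (IH (delta / 2) ltac:(lra)) as [C1 [HC1 H1]].
    destruct (ndiv_bound (delta / 2) ltac:(lra)) as [C2 [HC2 H2]].
    exists (C1 * C2); split; [nra|]. intros N n Hn.
    rewrite tcount_S.
    apply Rle_trans with (lsum (seq 1 N) (fun i => if Nat.eqb (n mod i) 0 then C1 * Rpower (INR n) (delta / 2) else 0)).
    + apply lsum_le. intros i Hi. apply in_seq in Hi.
      destruct (Nat.eqb (n mod i) 0) eqn:E.
      * apply Nat.eqb_eq, Nat.mod_divide in E; [|lia]. destruct E as [c Hc].
        apply Rle_trans with (INR (tcount k N c)).
        { unfold tcount. rewrite INR_length_filter. apply lsum_le; intros l _.
          destruct (Nat.eqb_spec (i * lprod l) n) as [E1|E1]; destruct (Nat.eqb_spec (lprod l) c) as [E2|E2]; try lra.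
          exfalso; apply E2. apply (Nat.mul_cancel_l _ _ i); lia. }
        eapply Rle_trans; [apply H1; nia|]. apply Rmult_le_compat_l; [lra|].
        apply Rle_Rpower_l; [lra|]. split; [apply INR_gt0; nia|apply le_INR; nia].
      * rewrite lsum_zero; [lra|]. intros l _. destruct (Nat.eqb_spec (i * lprod l) n) as [E1|E1]; [|reflexivity].
        exfalso. apply Nat.eqb_neq in E. apply E. rewrite <- E1, Nat.mul_comm. apply Nat.Div0.mod_mul.
    + rewrite <- (lsum_filter (fun i => Nat.eqb (n mod i) 0)), lsum_const.
      assert (Hle : (length (filter (fun i => Nat.eqb (n mod i) 0) (seq 1 N)) <= ndiv n)%nat).
      { apply NoDup_incl_length; [apply NoDup_filter, seq_NoDup|].
        intros i Hi. apply filter_In in Hi. destruct Hi as [Hi E]. apply in_seq in Hi.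
        apply in_divisors; [exact Hn|]. apply Nat.mod_divide; [lia|]. apply Nat.eqb_eq, E. }
      apply le_INR in Hle. pose proof (H2 n Hn).
      pose proof (Rpower_pos (INR n) (delta / 2)) as Hr.
      replace (Rpower (INR n) delta) with (Rpower (INR n) (delta / 2) * Rpower (INR n) (delta / 2))
        by (rewrite <- Rpower_plus; f_equal; lra).
      apply Rle_trans with (C2 * Rpower (INR n) (delta / 2) * (C1 * Rpower (INR n) (delta / 2))); [|right; ring].
      apply Rmult_le_compat_r; [nra|lra].
Qed.

Lemma in_tuples (k N : nat) (l : list nat) :
  In l (tuples k N) <-> length l = k /\ forall i, In i l -> (1 <= i <= N)%nat.
Proof.
  revert l. induction k as [|k IH]; intros l; simpl.
  - split.
    + intros [<-|[]]. split; [reflexivity|intros i []].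
    + intros [H _]. left. symmetry. apply length_zero_iff_nil, H.
  - rewrite in_flat_map. split.
    + intros [i [Hi H]]. apply in_map_iff in H. destruct H as [l' [<- Hl']].
      apply IH in Hl'. apply in_seq in Hi. destruct Hl' as [H1 H2]. split; [simpl; lia|].
      intros j [<-|Hj]; [lia|auto].
    + intros [H1 H2]. destruct l as [|i l]; [discriminate|]. exists i. split.
      * apply in_seq. specialize (H2 i (or_introl eq_refl)). lia.
      * apply in_map, IH. split; [simpl in H1; lia|]. intros j Hj. apply H2. right; exact Hj.
Qed.

Lemma NoDup_tuples (k N : nat) : NoDup (tuples k N).
Proof.
  induction k as [|k IH]; simpl; [repeat constructor; intros []|].
  generalize (seq_NoDup N 1). generalize (seq 1 N). induction l as [|i l IHl]; intros Hl; [constructor|].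
  inversion Hl; subst. simpl. apply NoDup_app; [|auto|].
  - apply FinFun.Injective_map_NoDup; auto. intros y z E; congruence.
  - intros x Hx Hx'. apply in_map_iff in Hx. destruct Hx as [y [<- _]].
    apply in_flat_map in Hx'. destruct Hx' as [j [Hj Hx']]. apply in_map_iff in Hx'.
    destruct Hx' as [z [E _]]. congruence.
Qed.

Lemma divide_lprod (l : list nat) i : In i l -> Nat.divide i (lprod l).
Proof.
  induction l as [|j l IH]; intros H; [destruct H|]. simpl. destruct H as [->|H].
  - apply Nat.divide_factor_l.
  - apply Nat.divide_mul_r, IH, H.
Qed.

(** The entries of a tuple divide its product, so neither cut-off excludes anything. *)
Lemma tcount_tau (k N n : nat) : (1 <= n <= N)%nat -> tcount k N n = tau k n.
Proof.
  intros Hn. unfold tcount, tau. apply Permutation_length, NoDup_Permutation.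
  - apply NoDup_filter, NoDup_tuples.
  - apply NoDup_filter, NoDup_tuples.
  - intros l. rewrite !filter_In, !in_tuples. split.
    + intros [[H1 H2] E]. split; [|exact E]. split; [exact H1|]. intros i Hi.
      specialize (H2 i Hi). apply Nat.eqb_eq in E. split; [lia|].
      apply Nat.divide_pos_le; [lia|]. rewrite <- E. apply divide_lprod, Hi.
    + intros [[H1 H2] E]. split; [|exact E]. split; [exact H1|]. intros i Hi.
      specialize (H2 i Hi). lia.
Qed.

Lemma lprod_range (k N : nat) (l : list nat) : In l (tuples k N) -> (1 <= lprod l <= N ^ k)%nat.
Proof.
  intros H. apply in_tuples in H. destruct H as [<- H]. induction l as [|i l IH]; simpl; [lia|].
  assert (1 <= i <= N)%nat by (apply H; left; reflexivity).
  assert (1 <= lprod l <= N ^ length l)%nat by (apply IH; intros j Hj; apply H; right; exact Hj).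
  nia.
Qed.

Lemma lsum_tuples (k N : nat) (f : nat -> R) :
  lsum (tuples k N) (fun l => f (lprod l)) = lsum (seq 1 (N ^ k)) (fun n => INR (tcount k N n) * f n).
Proof.
  rewrite (lsum_group Nat.eq_dec lprod _ (seq 1 (N ^ k))).
  - apply lsum_ext. intros n _. rewrite (lsum_ext _ _ (fun _ => f n)).
    + rewrite lsum_const. unfold tcount. do 3 f_equal.
      apply filter_ext. intros l. destruct (Nat.eq_dec (lprod l) n), (Nat.eqb_spec (lprod l) n); congruence.
    + intros l Hl. apply filter_In in Hl. destruct Hl as [_ Hl].
      destruct (Nat.eq_dec (lprod l) n); [congruence|discriminate].
  - apply seq_NoDup.
  - intros l Hl. apply lprod_range in Hl. apply in_seq. lia.
Qed.

(** * Lattice points *)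

Lemma Zdivide_of_mod_eq (p x y : nat) : (x mod p = y mod p)%nat ->
  Z.divide (Z.of_nat p) (Z.of_nat x - Z.of_nat y).
Proof.
  intros H. exists (Z.of_nat (x / p) - Z.of_nat (y / p))%Z.
  pose proof (Nat.div_mod_eq x p). pose proof (Nat.div_mod_eq y p). nia.
Qed.

Lemma mod_eq_of_Zdivide (p x y : nat) : p <> 0%nat ->
  Z.divide (Z.of_nat p) (Z.of_nat x - Z.of_nat y) -> (x mod p = y mod p)%nat.
Proof.
  intros Hp [c Hc]. apply Nat2Z.inj. rewrite !Nat2Z.inj_mod.
  replace (Z.of_nat x) with (Z.of_nat y + c * Z.of_nat p)%Z by lia.
  apply Z_mod_plus_full.
Qed.

Lemma Zdivide_mod0 (p n : nat) : p <> 0%nat ->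
  Z.divide (Z.of_nat p) (Z.of_nat n) <-> (n mod p = 0)%nat.
Proof.
  intros Hp. split.
  - intros H. rewrite <- (Nat.Div0.mod_0_l p). apply mod_eq_of_Zdivide; [exact Hp|].
    simpl. rewrite Z.sub_0_r. exact H.
  - intros H. rewrite <- (Nat.Div0.mod_0_l p) in H. apply Zdivide_of_mod_eq in H.
    simpl in H. rewrite Z.sub_0_r in H. exact H.
Qed.

Lemma coprime_cross_eq (a1 b1 a2 b2 : nat) : Nat.gcd a1 b1 = 1%nat -> Nat.gcd a2 b2 = 1%nat ->
  (a1 * b2 = a2 * b1)%nat -> a1 = a2 /\ b1 = b2.
Proof.
  intros H1 H2 E. split; apply Nat.divide_antisym.
  - apply (Nat.gauss _ b1); [|exact H1]. exists b2. lia.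
  - apply (Nat.gauss _ b2); [|exact H2]. exists b1. lia.
  - apply (Nat.gauss _ a1); [|rewrite Nat.gcd_comm; exact H1]. exists a2. lia.
  - apply (Nat.gauss _ a2); [|rewrite Nat.gcd_comm; exact H2]. exists a1. lia.
Qed.

(* The cross product of the two vectors is a multiple of [p], so distinct slopes differ by at
   least [p / (a1 a2) > p / X] and cannot share the integer part [q]. *)
Lemma slope_separation (p X q a1 b1 a2 b2 : nat) :
  Nat.gcd a1 b1 = 1%nat -> Nat.gcd a2 b2 = 1%nat ->
  (1 <= a1)%nat -> (1 <= a2)%nat -> (1 <= p)%nat -> (a1 * a2 < X)%nat ->
  Z.divide (Z.of_nat p) (Z.of_nat (a1 * b2) - Z.of_nat (a2 * b1)) ->
  ((b1 * X) / (a1 * p) = q)%nat -> ((b2 * X) / (a2 * p) = q)%nat ->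
  a1 = a2 /\ b1 = b2.
Proof.
  intros G1 G2 A1 A2 Hp HX [c Hc] Q1 Q2.
  apply coprime_cross_eq; [assumption|assumption|].
  pose proof (Nat.div_mod_eq (b1 * X) (a1 * p)) as D1.
  pose proof (Nat.mod_upper_bound (b1 * X) (a1 * p) ltac:(nia)) as U1.
  pose proof (Nat.div_mod_eq (b2 * X) (a2 * p)) as D2.
  pose proof (Nat.mod_upper_bound (b2 * X) (a2 * p) ltac:(nia)) as U2.
  rewrite Q1 in D1. rewrite Q2 in D2.
  set (r1 := ((b1 * X) mod (a1 * p))%nat) in *. set (r2 := ((b2 * X) mod (a2 * p))%nat) in *.
  assert (E1 : (b1 * a2 * X = a1 * a2 * p * q + a2 * r1)%nat) by nia.
  assert (E2 : (b2 * a1 * X = a1 * a2 * p * q + a1 * r2)%nat) by nia.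
  assert (F1 : (a2 * r1 < a1 * a2 * p)%nat) by nia.
  assert (F2 : (a1 * r2 < a1 * a2 * p)%nat) by nia.
  assert (F3 : (a1 * a2 * p <= X * p)%nat) by nia.
  assert (L1 : (b1 * a2 < b2 * a1 + p)%nat) by nia.
  assert (L2 : (b2 * a1 < b1 * a2 + p)%nat) by nia.
  assert (c = 0)%Z by nia. nia.
Qed.

(** Dividing by the gcd makes the vector primitive, as [slope_separation] requires; the two
    logarithms then place it in a dyadic box, where the weights are comparable. *)
Definition box_key (u : nat * nat) : nat * (nat * nat) :=
  let j := Nat.gcd (fst u) (snd u) in (j, (Nat.log2 (fst u / j), Nat.log2 (snd u / j))).

Lemma reduced_pair (a b : nat) : (1 <= a)%nat -> (1 <= b)%nat ->
  let j := Nat.gcd a b in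
  (1 <= j)%nat /\ a = (j * (a / j))%nat /\ b = (j * (b / j))%nat /\
  (1 <= a / j)%nat /\ (1 <= b / j)%nat /\ Nat.gcd (a / j) (b / j) = 1%nat.
Proof.
  intros Ha Hb j.
  assert (Hj : j <> 0%nat) by (intros E; apply Nat.gcd_eq_0 in E; lia).
  assert (Ea : a = (j * (a / j))%nat) by (apply Nat.div_exact; try assumption; apply Nat.mod_divide; [assumption|apply Nat.gcd_divide_l]).
  assert (Eb : b = (j * (b / j))%nat) by (apply Nat.div_exact; try assumption; apply Nat.mod_divide; [assumption|apply Nat.gcd_divide_r]).
  repeat split; try assumption; try nia.
  apply Nat.gcd_div_gcd; [assumption|reflexivity].
Qed.

(** Slopes are cut into intervals of length [p / X]. By [slope_separation] each interval contains at
    most one vector, and since a reduced vector has slope below [2 * 2^t / 2^s], the interval index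
    [f u] is at most [8 * 2^(s+t) / p]. *)
Lemma box_count (p j s t : nat) (l : list (nat * nat)) :
  prime (Z.of_nat p) -> NoDup l ->
  (forall u, In u l -> (1 <= fst u)%nat /\ (1 <= snd u)%nat /\ (fst u mod p <> 0)%nat) ->
  (forall u, In u l -> box_key u = (j, (s, t))) ->
  (forall u v, In u l -> In v l -> ((fst u * snd v) mod p = (fst v * snd u) mod p)%nat) ->
  (length l <= 1 + (8 * 2 ^ (s + t)) / p)%nat.
Proof.
  intros Hp Hnd Hpos Hkey Hcross.
  assert (Hp1 : (1 < p)%nat) by (destruct Hp; lia).
  (* Both first coordinates are below [2 * 2^s], so their product is below [X]. *)
  set (X := (4 ^ (s + 1))%nat).
  set (f := fun u : nat * nat => ((snd u / j * X) / (fst u / j * p))%nat).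
  rewrite <- (length_map f), <- (length_seq (1 + (8 * 2 ^ (s + t)) / p) 0).
  assert (Hu : forall u, In u l -> (1 <= j)%nat /\ fst u = (j * (fst u / j))%nat /\ snd u = (j * (snd u / j))%nat /\
     (1 <= fst u / j)%nat /\ (1 <= snd u / j)%nat /\ Nat.gcd (fst u / j) (snd u / j) = 1%nat /\
     (2 ^ s <= fst u / j < 2 * 2 ^ s)%nat /\ (2 ^ t <= snd u / j < 2 * 2 ^ t)%nat).
  { intros u H. destruct (Hpos u H) as [H1 [H2 _]]. pose proof (reduced_pair _ _ H1 H2) as HR.
    pose proof (Hkey u H) as K. unfold box_key in K. injection K as K1 K2 K3.
    rewrite K1 in *. destruct HR as [R1 [R2 [R3 [R4 [R5 R6]]]]].
    pose proof (Nat.log2_spec (fst u / j) ltac:(lia)) as S1.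
    pose proof (Nat.log2_spec (snd u / j) ltac:(lia)) as S2.
    rewrite K2 in S1. rewrite K3 in S2. rewrite Nat.pow_succ_r' in S1, S2.
    repeat split; try assumption; lia. }
  assert (EX : X = (4 * (2 ^ s * 2 ^ s))%nat).
  { unfold X. rewrite Nat.add_1_r, Nat.pow_succ_r', <- Nat.pow_mul_l. reflexivity. }
  apply NoDup_incl_length.
  - apply FinFun.Injective_map_NoDup_in; [|exact Hnd]. intros u v Iu Iv E.
    destruct (Hu u Iu) as [J1 [Ea [Eb [A1 [B1 [G1 [S1 T1]]]]]]].
    destruct (Hu v Iv) as [_ [Ea' [Eb' [A2 [B2 [G2 [S2 T2]]]]]]].
    destruct (slope_separation p X (f u) (fst u / j) (snd u / j) (fst v / j) (snd v / j)) as [F1 F2];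
      try assumption; try lia; try reflexivity.
    + rewrite EX. nia.
    + pose proof (Zdivide_of_mod_eq _ _ _ (Hcross u v Iu Iv)) as Hd.
      rewrite Ea, Eb, Ea', Eb' in Hd.
      replace (Z.of_nat (j * (fst u / j) * (j * (snd v / j))) - Z.of_nat (j * (fst v / j) * (j * (snd u / j))))%Z
        with (Z.of_nat j * (Z.of_nat j * (Z.of_nat (fst u / j * (snd v / j)) - Z.of_nat (fst v / j * (snd u / j)))))%Z in Hd by nia.
      (* As [p] does not divide [fst u], it does not divide [j], and the factor [j^2] can be
         cancelled from the cross product. *)
      assert (Hj : ~ Z.divide (Z.of_nat p) (Z.of_nat j)).
      { intros Hj. apply (proj2 (proj2 (Hpos u Iu))). apply Zdivide_mod0; [lia|].
        rewrite Ea, Nat2Z.inj_mul. apply Z.divide_mul_l, Hj. }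
      apply prime_mult in Hd; [|exact Hp]. destruct Hd as [Hd|Hd]; [tauto|].
      apply prime_mult in Hd; [|exact Hp]. destruct Hd as [Hd|Hd]; [tauto|exact Hd].
    + symmetry; exact E.
    + destruct u as [a b], v as [a' b']; simpl in *. f_equal; congruence.
  - intros y Hy. apply in_map_iff in Hy. destruct Hy as [u [<- Iu]].
    destruct (Hu u Iu) as [J1 [Ea [Eb [A1 [B1 [G1 [S1 T1]]]]]]].
    apply in_seq. split; [lia|]. simpl. apply Nat.lt_succ_r. unfold f.
    apply Nat.div_le_lower_bound; [lia|].
    apply Nat.le_trans with ((p * ((snd u / j * X))) / (fst u / j * p))%nat.
    { apply Nat.Div0.div_mul_le. }
    rewrite (Nat.mul_comm p), Nat.Div0.div_mul_cancel_r by lia.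
    apply Nat.Div0.div_le_upper_bound. rewrite EX, Nat.pow_add_r.
    set (P := (2 ^ s)%nat) in *. set (T := (2 ^ t)%nat) in *.
    assert (P * (8 * (P * T)) <= fst u / j * (8 * (P * T)))%nat by (apply Nat.mul_le_mono_r; lia).
    assert (snd u / j * (4 * (P * P)) <= 2 * T * (4 * (P * P)))%nat by (apply Nat.mul_le_mono_r; lia).
    nia.
Qed.

(** * Sums over gcds and over dyadic boxes *)

Lemma lsum_seq_S (a n : nat) f : lsum (seq a (S n)) f = lsum (seq a n) f + f (a + n)%nat.
Proof. rewrite seq_S, lsum_app, lsum_cons. f_equal. apply Rplus_0_r. Qed.

Lemma Rpower_anti (c a b : R) : c <= 0 -> 0 < a -> a <= b -> Rpower b c <= Rpower a c.
Proof.
  intros Hc Ha Hab. replace c with (- - c) by ring. rewrite !(Rpower_Ropp _ (- c)).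
  apply Rinv_le_contravar; [apply Rpower_pos|]. apply Rle_Rpower_l; lra.
Qed.

Lemma Rpower_pow_base (x y : R) (n : nat) : 0 < x -> Rpower (x ^ n) y = Rpower x y ^ n.
Proof.
  intros Hx. rewrite <- Rpower_pow, Rpower_mult, Rmult_comm, <- Rpower_mult, Rpower_pow by (assumption || apply Rpower_pos).
  reflexivity.
Qed.

(** With [x = sqrt n] and [y = sqrt (n + 1)], one has [1 = (y - x)(y + x) <= 2 y (y - x)]; dividing
    by [x y^2 <= y^3] gives the claim. *)
Lemma three_halves_telescope (n : nat) : (1 <= n)%nat ->
  Rpower (INR (S n)) (- (3 / 2)) <= 2 * (Rpower (INR n) (- / 2) - Rpower (INR (S n)) (- / 2)).
Proof.
  intros Hn. pose proof (INR_gt0 n Hn) as Hn0. assert (Hm0 : 0 < INR (S n)) by (apply INR_gt0; lia).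
  replace (- (3 / 2)) with (- / 2 + - (1)) by lra. rewrite Rpower_plus, !Rpower_Ropp, Rpower_1, !Rpower_sqrt by assumption.
  pose proof (sqrt_lt_R0 _ Hn0) as Hx. pose proof (sqrt_lt_R0 _ Hm0) as Hy.
  pose proof (sqrt_sqrt (INR n) ltac:(lra)) as Ex. pose proof (sqrt_sqrt (INR (S n)) ltac:(lra)) as Ey.
  rewrite S_INR in *. set (x := sqrt (INR n)) in *. set (y := sqrt (INR n + 1)) in *.
  rewrite <- Ey. assert (Hxy : x < y) by nra.
  assert (Hd : 1 <= 2 * y * (y - x)) by nra.
  apply (Rmult_le_reg_r (x * y * y * y)); [apply Rmult_lt_0_compat; [nra|lra]|].
  replace (/ y * / (y * y) * (x * y * y * y)) with x by (field; lra).
  replace (2 * (/ x - / y) * (x * y * y * y)) with (2 * y * (y - x) * y) by (field; lra).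
  nra.
Qed.

Lemma three_halves_sum_tail (a n : nat) : (1 <= a)%nat ->
  lsum (seq (S a) n) (fun j => Rpower (INR j) (- (3 / 2))) <=
  2 * (Rpower (INR a) (- / 2) - Rpower (INR (a + n)) (- / 2)).
Proof.
  intros Ha. induction n as [|n IH].
  - rewrite Nat.add_0_r. unfold lsum; simpl; lra.
  - rewrite lsum_seq_S. pose proof (three_halves_telescope (a + n) ltac:(lia)) as H.
    replace (S a + n)%nat with (S (a + n)) by lia. replace (a + S n)%nat with (S (a + n)) by lia. lra.
Qed.

Lemma three_halves_sum (n : nat) : lsum (seq 1 n) (fun j => Rpower (INR j) (- (3 / 2))) <= 3.
Proof.
  destruct n as [|n]; [unfold lsum; simpl; lra|]. simpl seq. rewrite lsum_cons.
  pose proof (three_halves_sum_tail 1 n ltac:(lia)) as H. pose proof (Rpower_pos (INR (1 + n)) (- / 2)).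
  assert (E : forall y, Rpower (INR 1) y = 1) by (intros y; unfold Rpower; simpl; rewrite ln_1, Rmult_0_r, exp_0; reflexivity).
  rewrite E in *. lra.
Qed.

Lemma geometric_sum_lt1 (q : R) (n : nat) : 0 < q < 1 -> lsum (seq 0 n) (fun s => q ^ s) <= / (1 - q).
Proof.
  intros Hq.
  assert (H : (1 - q) * lsum (seq 0 n) (fun s => q ^ s) = 1 - q ^ n).
  { induction n as [|n IH]; [unfold lsum; simpl; ring|].
    rewrite lsum_seq_S, Rmult_plus_distr_l, IH. simpl. ring. }
  apply (Rmult_le_reg_l (1 - q)); [lra|]. rewrite H, Rinv_r by lra.
  pose proof (pow_lt q n ltac:(lra)). lra.
Qed.

Lemma geometric_sum_gt1 (r : R) (n : nat) : 1 < r ->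
  lsum (seq 0 (S n)) (fun s => r ^ s) <= r / (r - 1) * r ^ n.
Proof.
  intros Hr.
  assert (H : forall n, (r - 1) * lsum (seq 0 n) (fun s => r ^ s) = r ^ n - 1).
  { clear n. induction n as [|n IH]; [unfold lsum; simpl; ring|].
    rewrite lsum_seq_S, Rmult_plus_distr_l, IH. simpl. ring. }
  apply (Rmult_le_reg_l (r - 1)); [lra|]. rewrite H.
  replace ((r - 1) * (r / (r - 1) * r ^ n)) with (r ^ S n) by (simpl; field; lra). lra.
Qed.

Definition key_dec : forall x y : nat * (nat * (nat * nat)), {x = y} + {x <> y}.
Proof. repeat decide equality. Defined.

(** The count of [box_count] times the largest weight in the box. The gcd contributes
    [j^(2 delta - 2) <= j^(-3/2)], which is where [delta <= 1/4] enters. The two summands come from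
    the [1] and from the [8 X / p] of the count; they are kept as products over [s] and [t] so that
    the sums over boxes factor. *)
Lemma box_weight (delta Rr : R) (p j s t : nat) (l : list (nat * nat)) :
  0 < delta <= / 4 -> 1 <= Rr -> prime (Z.of_nat p) -> NoDup l -> (1 <= j)%nat ->
  (forall u, In u l -> (1 <= fst u)%nat /\ (1 <= snd u)%nat /\ (fst u mod p <> 0)%nat /\
     Rr < INR (fst u / Nat.gcd (fst u) (snd u) * (snd u / Nat.gcd (fst u) (snd u)))) ->
  (forall u, In u l -> box_key u = (j, (s, t))) ->
  (forall u v, In u l -> In v l -> ((fst u * snd v) mod p = (fst v * snd u) mod p)%nat) ->
  lsum l (fun u => Rpower (INR (fst u * snd u)) (-1 + delta)) <=
  Rpower (INR j) (- (3 / 2)) *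
  (4 * Rpower Rr (-1 + 2 * delta) * (Rpower 2 (- delta) ^ s * Rpower 2 (- delta) ^ t) +
   8 / INR p * (Rpower 2 delta ^ s * Rpower 2 delta ^ t)).
Proof.
  intros Hd HR Hp Hnd Hj Hpos Hkey Hcross.
  assert (Hp0 : 0 < INR p) by (apply INR_gt0; destruct Hp; lia).
  pose proof (pow_lt _ s (Rpower_pos 2 (- delta))). pose proof (pow_lt _ t (Rpower_pos 2 (- delta))).
  pose proof (pow_lt _ s (Rpower_pos 2 delta)). pose proof (pow_lt _ t (Rpower_pos 2 delta)).
  pose proof (Rpower_pos (INR j) (- (3 / 2))) as Hj32. pose proof (Rpower_pos Rr (-1 + 2 * delta)) as HRp.
  assert (0 < / INR p) by (apply Rinv_0_lt_compat; assumption).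
  (* The bound [Rr <= 4 X] needs a point in the box, so the empty box is treated separately. *)
  destruct l as [|u0 l0].
  { unfold lsum; simpl. apply Rmult_le_pos; [lra|]. unfold Rdiv.
    apply Rplus_le_le_0_compat; repeat apply Rmult_le_pos; lra. }
  set (l := u0 :: l0) in *.
  set (X := 2 ^ (s + t)). assert (HX : 0 < X) by (apply pow_lt; lra).
  assert (HXn : INR (2 ^ (s + t)) = X) by (rewrite pow_INR; reflexivity).
  assert (Hcount : INR (length l) <= 1 + 8 * X / INR p).
  { pose proof (box_count p j s t l Hp Hnd (fun u Hu => conj (proj1 (Hpos u Hu)) (conj (proj1 (proj2 (Hpos u Hu))) (proj1 (proj2 (proj2 (Hpos u Hu)))))) Hkey Hcross) as Hc.
    apply le_INR in Hc. rewrite plus_INR in Hc. simpl (INR 1) in Hc.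
    eapply Rle_trans; [exact Hc|]. apply Rplus_le_compat_l.
    apply (Rmult_le_reg_r (INR p)); [assumption|]. unfold Rdiv. rewrite Rmult_assoc, Rinv_l, Rmult_1_r by lra.
    rewrite <- HXn. rewrite <- mult_INR. replace 8 with (INR 8) by (simpl; ring). rewrite <- mult_INR.
    apply le_INR. rewrite Nat.mul_comm. apply Nat.Div0.mul_div_le. }
  assert (Hred : forall u, In u l -> let a' := (fst u / j)%nat in let b' := (snd u / j)%nat in
      fst u = (j * a')%nat /\ snd u = (j * b')%nat /\ (2 ^ s <= a' < 2 * 2 ^ s)%nat /\ (2 ^ t <= b' < 2 * 2 ^ t)%nat /\
      Rr < INR (a' * b')).
  { intros u Hu a' b'. destruct (Hpos u Hu) as [H1' [H2' [_ H4]]].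
    pose proof (reduced_pair _ _ H1' H2') as HRd. pose proof (Hkey u Hu) as K. unfold box_key in K. injection K as K1 K2 K3.
    rewrite K1 in *. destruct HRd as [R1 [R2 [R3 [R4 [R5 R6]]]]].
    pose proof (Nat.log2_spec (fst u / j) ltac:(lia)) as S1.
    pose proof (Nat.log2_spec (snd u / j) ltac:(lia)) as S2.
    rewrite K2 in S1. rewrite K3 in S2. rewrite Nat.pow_succ_r' in S1, S2.
    repeat split; try assumption; unfold a', b'; lia. }
  (* Each reduced coordinate is less than twice the lower end of its dyadic range, hence the 4. *)
  assert (HRX : Rr <= 4 * X).
  { destruct (Hred u0 (or_introl eq_refl)) as [_ [_ [Ha [Hb Hr]]]].
    left. eapply Rlt_le_trans; [exact Hr|]. rewrite <- HXn. replace 4 with (INR 4) by (simpl; ring).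
    rewrite <- mult_INR. apply le_INR. rewrite Nat.pow_add_r. nia. }
  assert (Hw : forall u, In u l -> Rpower (INR (fst u * snd u)) (-1 + delta) <= Rpower (INR j) (- (3 / 2)) * Rpower X (-1 + delta)).
  { intros u Hu. destruct (Hred u Hu) as [Ea [Eb [Ha [Hb _]]]].
    apply Rle_trans with (Rpower (INR j * INR j * X) (-1 + delta)).
    - apply Rpower_anti; [lra| |].
      + apply Rmult_lt_0_compat; [|assumption]. apply Rmult_lt_0_compat; apply INR_gt0; assumption.
      + rewrite <- HXn, <- !mult_INR. apply le_INR. rewrite Ea, Eb, Nat.pow_add_r.
        set (a' := (fst u / j)%nat) in *. set (b' := (snd u / j)%nat) in *.
        replace (j * a' * (j * b'))%nat with (j * j * (a' * b'))%nat by ring.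
        apply Nat.mul_le_mono_l, Nat.mul_le_mono; lia.
    - pose proof (INR_gt0 j Hj). rewrite <- Rpower_mult_distr; [|nra|assumption].
      apply Rmult_le_compat_r; [left; apply Rpower_pos|].
      rewrite <- Rpower_mult_distr, <- Rpower_plus by assumption.
      apply Rle_Rpower; [apply INR_ge1; assumption|lra]. }
  apply Rle_trans with (INR (length l) * (Rpower (INR j) (- (3 / 2)) * Rpower X (-1 + delta))).
  { rewrite <- lsum_const. apply lsum_le, Hw. }
  pose proof (Rpower_pos X (-1 + delta)) as HXd.
  apply Rle_trans with ((1 + 8 * X / INR p) * (Rpower (INR j) (- (3 / 2)) * Rpower X (-1 + delta))).
  { apply Rmult_le_compat_r; [nra|assumption]. }
  replace ((1 + 8 * X / INR p) * (Rpower (INR j) (- (3 / 2)) * Rpower X (-1 + delta)))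
    with (Rpower (INR j) (- (3 / 2)) * (Rpower X (-1 + delta) + 8 / INR p * (X * Rpower X (-1 + delta)))) by (field; lra).
  apply Rmult_le_compat_l; [lra|]. rewrite <- !pow_add. fold X.
  rewrite <- !Rpower_pow_base by lra. fold X. apply Rplus_le_compat.
  - (* Rankin: a factor [X^(-delta)] is kept for the convergence of the sum over boxes *)
    replace (-1 + delta) with ((-1 + 2 * delta) + - delta) by ring. rewrite Rpower_plus.
    apply Rmult_le_compat_r; [left; apply Rpower_pos|].
    apply Rle_trans with (4 * Rpower (4 * X) (-1 + 2 * delta)).
    + rewrite <- Rpower_mult_distr by lra. rewrite <- Rmult_assoc.
      rewrite <- (Rmult_1_l (Rpower X (-1 + 2 * delta))) at 1.
      apply Rmult_le_compat_r; [left; apply Rpower_pos|].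
      rewrite <- (Rpower_1 4) at 1 by lra. rewrite <- Rpower_plus. apply Rpower_ge1; lra.
    + apply Rmult_le_compat_l; [lra|]. apply Rpower_anti; lra.
  - right. f_equal. rewrite <- (Rpower_1 X) at 1 by assumption. rewrite <- Rpower_plus. f_equal. ring.
Qed.

(** [cls] labels the ratio modulo [p], so each class lies in one lattice. The sums over the gcd and
    over the decreasing powers of [q] converge; the increasing powers of [r] stop at [T = log2 W],
    and the sums over [s] and over [t] cost [W^delta] each. *)
Lemma lattice_sum (delta : R) : 0 < delta <= / 4 -> exists C1, 0 < C1 /\
  forall (p W nc : nat) (Rr : R) (S0 : list (nat * nat)) (cls : nat * nat -> nat),
  prime (Z.of_nat p) -> 1 <= Rr -> (1 <= W)%nat -> NoDup S0 ->
  (forall u, In u S0 -> (1 <= fst u <= W)%nat /\ (1 <= snd u <= W)%nat /\ (fst u mod p <> 0)%nat /\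
     (cls u < nc)%nat /\
     Rr < INR (fst u / Nat.gcd (fst u) (snd u) * (snd u / Nat.gcd (fst u) (snd u)))) ->
  (forall u v, In u S0 -> In v S0 -> cls u = cls v ->
     ((fst u * snd v) mod p = (fst v * snd u) mod p)%nat) ->
  lsum S0 (fun u => Rpower (INR (fst u * snd u)) (-1 + delta)) <=
  C1 * INR nc * (Rpower Rr (-1 + 2 * delta) + Rpower (INR W) (2 * delta) / INR p).
Proof.
  intros Hd. set (q := Rpower 2 (- delta)). set (r := Rpower 2 delta).
  assert (Hr : 1 < r) by (unfold r; rewrite <- (Rpower_O 2) by lra; apply Rpower_lt; lra).
  assert (Hq : 0 < q < 1).
  { split; [apply Rpower_pos|]. unfold q; rewrite <- (Rpower_O 2) by lra; apply Rpower_lt; lra. }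
  set (A := / (1 - q)). set (B := r / (r - 1)).
  assert (HA : 0 < A) by (apply Rinv_0_lt_compat; lra).
  assert (HB : 0 < B) by (apply Rdiv_lt_0_compat; lra).
  exists (3 * (4 * (A * A) + 8 * (B * B))). split; [nra|].
  intros p W nc Rr S0 cls Hp HR HW Hnd Hpos Hcross.
  assert (Hp0 : 0 < INR p) by (apply INR_gt0; destruct Hp; lia).
  set (T := Nat.log2 W).
  set (ks := list_prod (seq 0 nc) (list_prod (seq 1 W) (list_prod (seq 0 (S T)) (seq 0 (S T))))).
  rewrite (lsum_group key_dec (fun u => (cls u, box_key u)) S0 ks).
  2: { repeat apply NoDup_list_prod; apply seq_NoDup. }
  2: { intros u Hu. destruct (Hpos u Hu) as [H1 [H2 _]].
       destruct (reduced_pair (fst u) (snd u)) as [R1 [R2 [R3 [R4 [R5 R6]]]]]; try lia.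
       unfold ks, box_key. repeat apply in_prod; apply in_seq.
       - destruct (Hpos u Hu) as [_ [_ [_ [H4 _]]]]; lia.
       - nia.
       - split; [lia|]. simpl. apply Nat.lt_succ_r, Nat.log2_le_mono. nia.
       - split; [lia|]. simpl. apply Nat.lt_succ_r, Nat.log2_le_mono. nia. }
  set (Ra := Rpower Rr (-1 + 2 * delta)).
  set (F := fun st : nat * nat => 4 * Ra * (q ^ fst st * q ^ snd st) + 8 / INR p * (r ^ fst st * r ^ snd st)).
  apply Rle_trans with (lsum ks (fun c => 1 * (Rpower (INR (fst (snd c))) (- (3 / 2)) * F (snd (snd c))))).
  { apply lsum_le. intros [c [j [s t]]] Hc. simpl fst; simpl snd.
    unfold ks in Hc. apply in_prod_iff in Hc. destruct Hc as [_ Hc]. apply in_prod_iff in Hc. destruct Hc as [Hj _].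
    apply in_seq in Hj. rewrite Rmult_1_l.
    assert (Hin : forall u, In u (filter (fun x => if key_dec (cls x, box_key x) (c, (j, (s, t))) then true else false) S0) ->
        In u S0 /\ cls u = c /\ box_key u = (j, (s, t))).
    { intros u Hu. apply filter_In in Hu. destruct Hu as [Hu E].
      destruct (key_dec (cls u, box_key u) (c, (j, (s, t)))) as [E'|]; [|discriminate].
      exact (conj Hu (conj (f_equal fst E') (f_equal snd E'))). }
    apply (box_weight delta Rr p j s t); try assumption; try lia.
    - apply NoDup_filter, Hnd.
    - intros u Hu. destruct (Hin u Hu) as [Hu' _]. destruct (Hpos u Hu') as [H1 [H2 [H3 [H4 H5]]]].
      repeat split; try assumption; lia.
    - intros u Hu. apply (Hin u Hu).
    - intros u v Hu Hv. destruct (Hin u Hu) as [Hu' [Cu _]]. destruct (Hin v Hv) as [Hv' [Cv _]].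
      apply Hcross; congruence. }
  unfold ks. rewrite (lsum_list_prod_mul (seq 0 nc) _ (fun _ => 1) (fun c => Rpower (INR (fst c)) (- (3 / 2)) * F (snd c))).
  rewrite (lsum_list_prod_mul (seq 1 W) _ (fun j => Rpower (INR j) (- (3 / 2))) F).
  rewrite lsum_const, length_seq, Rmult_1_r.
  assert (HF : lsum (list_prod (seq 0 (S T)) (seq 0 (S T))) F <=
     (4 * (A * A) + 8 * (B * B)) * (Ra + Rpower (INR W) (2 * delta) / INR p)).
  { unfold F. rewrite lsum_plus, !lsum_scal.
    rewrite (lsum_list_prod_mul (seq 0 (S T)) (seq 0 (S T)) (fun s => q ^ s) (fun s => q ^ s)).
    rewrite (lsum_list_prod_mul (seq 0 (S T)) (seq 0 (S T)) (fun s => r ^ s) (fun s => r ^ s)).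
    pose proof (geometric_sum_lt1 q (S T) Hq) as G1. fold A in G1.
    pose proof (geometric_sum_gt1 r T Hr) as G2. fold B in G2.
    assert (HrT : r ^ T <= Rpower (INR W) delta).
    { unfold r. rewrite <- Rpower_pow_base by lra. apply Rle_Rpower_l; [lra|]. split; [apply pow_lt; lra|].
      replace 2 with (INR 2) by reflexivity. rewrite <- pow_INR. apply le_INR. apply Nat.log2_spec. lia. }
    assert (G3 : lsum (seq 0 (S T)) (fun s => r ^ s) <= B * Rpower (INR W) delta).
    { eapply Rle_trans; [exact G2|]. apply Rmult_le_compat_l; lra. }
    assert (N1 : 0 <= lsum (seq 0 (S T)) (fun s => q ^ s)) by (apply lsum_nonneg; intros; apply pow_le; lra).
    assert (N2 : 0 <= lsum (seq 0 (S T)) (fun s => r ^ s)) by (apply lsum_nonneg; intros; apply pow_le; lra).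
    pose proof (Rmult_le_compat _ _ _ _ N1 N1 G1 G1) as P1.
    pose proof (Rmult_le_compat _ _ _ _ N2 N2 G3 G3) as P2.
    replace (2 * delta) with (delta + delta) by ring. rewrite Rpower_plus.
    set (w := Rpower (INR W) delta) in *. assert (0 < w) by apply Rpower_pos.
    assert (0 < Ra) by apply Rpower_pos. assert (0 < / INR p) by (apply Rinv_0_lt_compat; assumption).
    set (x := lsum (seq 0 (S T)) (fun s => q ^ s)) in *. set (y := lsum (seq 0 (S T)) (fun s => r ^ s)) in *.
    unfold Rdiv. set (ip := / INR p) in *.
    assert (4 * Ra * (x * x) <= 4 * Ra * (A * A)) by (apply Rmult_le_compat_l; lra).
    assert (8 * ip * (y * y) <= 8 * ip * (B * w * (B * w))) by (apply Rmult_le_compat_l; lra).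
    assert (0 <= A * A) by nra. assert (0 <= B * B) by nra. assert (0 <= w * w * ip) by (apply Rmult_le_pos; nra).
    assert (0 <= (A * A) * (w * w * ip)) by (apply Rmult_le_pos; assumption).
    assert (0 <= (B * B) * Ra) by (apply Rmult_le_pos; lra).
    nra. }
  pose proof (three_halves_sum W) as HW3. pose proof (pos_INR nc) as Hnc.
  assert (0 <= Ra + Rpower (INR W) (2 * delta) / INR p).
  { pose proof (Rpower_pos Rr (-1 + 2 * delta)). pose proof (Rdiv_lt_0_compat _ _ (Rpower_pos (INR W) (2 * delta)) Hp0). unfold Ra; lra. }
  assert (HF0 : 0 <= lsum (seq 1 W) (fun j => Rpower (INR j) (- (3 / 2)))) by (apply lsum_nonneg; intros; left; apply Rpower_pos).
  rewrite (Rmult_comm (3 * _) (INR nc)), Rmult_assoc. apply Rmult_le_compat_l; [assumption|].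
  set (Y := lsum (list_prod (seq 0 (S T)) (seq 0 (S T))) F) in *.
  set (Z := (4 * (A * A) + 8 * (B * B)) * (Ra + Rpower (INR W) (2 * delta) / INR p)) in *.
  assert (0 <= Z) by (unfold Z; apply Rmult_le_pos; nra).
  apply Rle_trans with (lsum (seq 1 W) (fun j => Rpower (INR j) (- (3 / 2))) * Z).
  - apply Rmult_le_compat_l; assumption.
  - rewrite Rmult_assoc. fold Z. apply Rmult_le_compat_r; assumption.
Qed.

(** * Exceptional primes *)

Lemma ln_le_sub1 (x : R) : 0 < x -> ln x <= x - 1.
Proof. intros Hx. pose proof (exp_ineq1_le (ln x)) as H. rewrite exp_ln in H by exact Hx. lra. Qed.

Lemma harmonic_le (n : nat) : (1 <= n)%nat -> lsum (seq 1 n) (fun i => / INR i) <= 1 + ln (INR n).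
Proof.
  induction n as [|n IH]; intros Hn; [lia|]. destruct (Nat.eq_dec n 0) as [->|Hn0].
  - unfold lsum; simpl. rewrite ln_1. lra.
  - rewrite lsum_seq_S. change (1 + n)%nat with (S n). specialize (IH ltac:(lia)).
    pose proof (INR_gt0 n ltac:(lia)) as H0. assert (H1 : 0 < INR (S n)) by (apply INR_gt0; lia).
    pose proof (ln_le_sub1 (INR n / INR (S n)) ltac:(apply Rdiv_lt_0_compat; assumption)) as H2.
    rewrite ln_div in H2 by assumption.
    replace (INR n / INR (S n) - 1) with (- / INR (S n)) in H2 by (rewrite S_INR in *; field; lra). lra.
Qed.

Lemma INR_length_flat_map {A B} (f : A -> list B) l :
  INR (length (flat_map f l)) = lsum l (fun x => INR (length (f x))).
Proof.
  rewrite <- (Rmult_1_r (INR _)), <- lsum_const, lsum_flat_map.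
  apply lsum_ext; intros x _. rewrite lsum_const; ring.
Qed.

(** After [M] is divided by one prime of the list, the other primes, being different, still divide
    the quotient; each division lowers [M] by a factor of at least [d]. *)
Lemma pow_le_of_prime_divisors (d : nat) (l : list nat) : NoDup l -> forall M, (1 <= M)%nat ->
  (forall q, In q l -> prime (Z.of_nat q) /\ Nat.divide q M /\ (d <= q)%nat) ->
  (d ^ length l <= M)%nat.
Proof.
  induction 1 as [|q l Hq Hnd IH]; intros M HM H; [simpl; lia|].
  destruct (H q (or_introl eq_refl)) as [Pq [[c Hc] Hdq]].
  assert (Hc1 : (1 <= c)%nat) by nia.
  assert (HI : (d ^ length l <= c)%nat).
  { apply IH; [exact Hc1|]. intros q' Hq'. destruct (H q' (or_intror Hq')) as [Pq' [Hd' Hdq']].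
    split; [exact Pq'|]. split; [|exact Hdq'].
    assert (Hz : Z.divide (Z.of_nat q') (Z.of_nat c * Z.of_nat q)).
    { rewrite <- Nat2Z.inj_mul, <- Hc. destruct Hd' as [e He]. exists (Z.of_nat e). lia. }
    apply prime_mult in Hz; [|exact Pq']. destruct Hz as [[e He]|Hz].
    - assert (1 < Z.of_nat q')%Z by apply Pq'. exists (Z.to_nat e). nia.
    - apply prime_div_prime in Hz; [|assumption|assumption]. apply Nat2Z.inj in Hz. congruence. }
  simpl. nia.
Qed.

Definition big_prime_divisors (d M : nat) : list nat :=
  filter (fun q => if prime_dec (Z.of_nat q) then andb (Nat.leb d q) (Nat.eqb (M mod q) 0) else false)
    (seq 1 M).

Lemma in_big_prime_divisors (d M q : nat) : (1 <= M)%nat ->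
  In q (big_prime_divisors d M) <-> prime (Z.of_nat q) /\ Nat.divide q M /\ (d <= q)%nat.
Proof.
  intros HM. unfold big_prime_divisors. rewrite filter_In, in_seq.
  destruct (prime_dec (Z.of_nat q)) as [P|P].
  - rewrite Bool.andb_true_iff, Nat.leb_le, Nat.eqb_eq.
    assert (Hq : q <> 0%nat) by (intros ->; destruct P; simpl in *; lia).
    rewrite (Nat.mod_divide M q Hq). split; [tauto|]. intros [_ [H1 H2]].
    split; [|tauto]. apply Nat.divide_pos_le in H1; lia.
  - split; [intros [_ H]; discriminate|tauto].
Qed.

Lemma big_prime_divisors_length (d M : nat) (B : R) : (2 <= d)%nat -> (1 <= M)%nat -> INR M <= B ->
  INR (length (big_prime_divisors d M)) <= ln B / ln (INR d).
Proof.
  intros Hd HM HB.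
  assert (Hln : 0 < ln (INR d)) by (rewrite <- ln_1; apply ln_increasing; [lra|]; apply lt_1_INR; lia).
  apply (Rmult_le_reg_r (ln (INR d))); [exact Hln|].
  unfold Rdiv. rewrite Rmult_assoc, Rinv_l, Rmult_1_r by lra.
  rewrite <- ln_pow by (apply INR_gt0; lia). rewrite <- pow_INR. apply ln_le.
  - apply INR_gt0. pose proof (Nat.pow_nonzero d (length (big_prime_divisors d M))). lia.
  - eapply Rle_trans; [|exact HB]. apply le_INR. apply pow_le_of_prime_divisors; [|exact HM|].
    + apply NoDup_filter, seq_NoDup.
    + intros q. apply in_big_prime_divisors, HM.
Qed.

Definition absdiff (x y : nat) : nat := (x - y + (y - x))%nat.

Definition bounded_pairs (n : nat) : list (nat * nat) :=
  flat_map (fun a => map (pair a) (seq 1 (n / a))) (seq 1 n).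

Lemma in_bounded_pairs (n a b : nat) :
  In (a, b) (bounded_pairs n) <-> (1 <= a)%nat /\ (1 <= b)%nat /\ (a * b <= n)%nat.
Proof.
  unfold bounded_pairs. rewrite in_flat_map. split.
  - intros [a' [Ha H]]. apply in_map_iff in H. destruct H as [b' [E Hb]]. injection E as -> ->.
    apply in_seq in Ha. apply in_seq in Hb. split; [lia|]. split; [lia|].
    pose proof (Nat.Div0.mul_div_le n a). nia.
  - intros [H1 [H2 H3]]. exists a. split; [apply in_seq; nia|]. apply in_map, in_seq.
    split; [lia|]. pose proof (Nat.div_le_lower_bound n a b ltac:(lia) H3). lia.
Qed.

Lemma bounded_pairs_length (n : nat) : (1 <= n)%nat ->
  INR (length (bounded_pairs n)) <= INR n * (1 + ln (INR n)).
Proof.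
  intros Hn. unfold bounded_pairs. rewrite INR_length_flat_map.
  apply Rle_trans with (lsum (seq 1 n) (fun a => INR n * / INR a)).
  - apply lsum_le. intros a Ha. apply in_seq in Ha. rewrite length_map, length_seq.
    pose proof (INR_gt0 a ltac:(lia)) as Ha0.
    apply (Rmult_le_reg_r (INR a)); [exact Ha0|]. rewrite Rmult_assoc, Rinv_l, Rmult_1_r by lra.
    rewrite <- mult_INR. apply le_INR. rewrite Nat.mul_comm. apply Nat.Div0.mul_div_le.
  - rewrite lsum_scal. apply Rmult_le_compat_l; [apply pos_INR|]. apply harmonic_le, Hn.
Qed.

(** The function increases from [e] on: [x (ln y - ln x) <= y - x], and [ln x >= 1]. It lets the
    bounds for the separate [d] be replaced by the value at [D], which keeps the saving [ln D]. *)
Lemma div_ln_monotone (x y : R) : 3 <= x -> x <= y -> x / ln x <= y / ln y.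
Proof.
  intros Hx Hy.
  assert (H1 : 1 <= ln x).
  { rewrite <- (ln_exp 1). apply ln_le; [apply exp_pos|]. pose proof exp_le_3; lra. }
  assert (H2 : ln x <= ln y) by (apply ln_le; lra).
  pose proof (ln_le_sub1 (y / x) ltac:(apply Rdiv_lt_0_compat; lra)) as H3.
  rewrite ln_div in H3 by lra.
  apply (Rmult_le_reg_r (ln x * ln y)); [nra|].
  replace (x / ln x * (ln x * ln y)) with (x * ln y) by (field; lra).
  replace (y / ln y * (ln x * ln y)) with (y * ln x) by (field; lra).
  assert (H4 : x * (ln y - ln x) <= y - x).
  { apply Rle_trans with (x * (y / x - 1)); [apply Rmult_le_compat_l; lra|]. right; field; lra. }
  nra.
Qed.

(** The bound is a product: at most [D] exponents, at most [Rr (1 + ln Rr)] pairs, and at most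
    [2 ln Rr * (D / ln D)] primes for each. The constant comes from
    [1 + ln Rr <= (1 + 1 / ln 2) ln Rr], valid for [Rr >= 2]. *)
Lemma exceptional_set : exists C1, 0 < C1 /\ forall D Rr : R, 2 <= D -> 2 <= Rr ->
  exists E : list nat,
    INR (length E) <= C1 * (D ^ 2 * Rr * (ln Rr) ^ 2 / ln D) /\
    forall p d a b : nat, prime (Z.of_nat p) -> ~ In p E -> (3 <= d)%nat -> (d <= p)%nat -> INR d <= D ->
      (1 <= a)%nat -> (1 <= b)%nat -> a <> b -> INR (a * b) <= Rr ->
      ((a ^ (2 * d)) mod p <> (b ^ (2 * d)) mod p)%nat.
Proof.
  pose proof ln_lt_2 as Hl2.
  exists (2 * (1 + / ln 2)). assert (Hi2 : 0 < / ln 2) by (apply Rinv_0_lt_compat; lra). split; [lra|].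
  intros D Rr HD HR.
  destruct (nfloor_ex D ltac:(lra)) as [nD [HD1 HD2]].
  destruct (nfloor_ex Rr ltac:(lra)) as [n [Hn1 Hn2]].
  assert (Hn : (1 <= n)%nat) by (destruct n; [simpl in Hn2; lra|lia]).
  set (Ed := fun d => flat_map (fun u => if Nat.eq_dec (fst u) (snd u) then []
     else big_prime_divisors d (absdiff (fst u ^ (2 * d)) (snd u ^ (2 * d)))) (bounded_pairs n)).
  assert (HlD : ln 2 <= ln D) by (apply ln_le; lra).
  assert (HlR : ln 2 <= ln Rr) by (apply ln_le; lra).
  assert (Hab : forall d a b, (3 <= d)%nat -> a <> b -> (1 <= absdiff (a ^ (2 * d)) (b ^ (2 * d)))%nat).
  { intros d a b Hd Hne. unfold absdiff.
    destruct (Nat.lt_trichotomy a b) as [H|[H|H]]; [|tauto|].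
    - pose proof (Nat.pow_lt_mono_l a b (2 * d) ltac:(lia) H). lia.
    - pose proof (Nat.pow_lt_mono_l b a (2 * d) ltac:(lia) H). lia. }
  (* The exponents are [3, ..., nD]; for [nD = 2] the list is empty. *)
  exists (flat_map Ed (seq 3 (nD - 2))). split.
  - rewrite INR_length_flat_map.
    apply Rle_trans with (lsum (seq 3 (nD - 2)) (fun _ => Rr * (1 + ln Rr) * (2 * ln Rr * (D / ln D)))).
    + apply lsum_le. intros d Hd. apply in_seq in Hd. unfold Ed. rewrite INR_length_flat_map.
      assert (Hd3 : 3 <= INR d) by (change 3 with (IZR (Z.of_nat 3)); rewrite <- INR_IZR_INZ; apply le_INR; lia).
      assert (HdD : INR d <= D) by (eapply Rle_trans; [apply le_INR|exact HD1]; lia).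
      assert (Hln : 1 <= ln (INR d)).
      { rewrite <- (ln_exp 1). apply ln_le; [apply exp_pos|]. pose proof exp_le_3; lra. }
      apply Rle_trans with (lsum (bounded_pairs n) (fun _ => 2 * ln Rr * (D / ln D))).
      * apply lsum_le. intros [a b] Hin. simpl fst; simpl snd. apply in_bounded_pairs in Hin.
        assert (HDl : 0 < D / ln D) by (apply Rdiv_lt_0_compat; lra).
        destruct (Nat.eq_dec a b) as [E|E]; [simpl; apply Rmult_le_pos; lra|].
        eapply Rle_trans; [apply (big_prime_divisors_length d _ (Rr ^ (2 * d))); [lia|apply Hab; [lia|exact E]|]|].
        -- apply Rle_trans with (INR (n ^ (2 * d))).
           ++ apply le_INR. unfold absdiff.
              pose proof (Nat.pow_le_mono_l a n (2 * d) ltac:(nia)). pose proof (Nat.pow_le_mono_l b n (2 * d) ltac:(nia)). lia.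
           ++ rewrite pow_INR. apply pow_incr. split; [apply pos_INR|lra].
        -- rewrite ln_pow by lra. rewrite mult_INR. simpl (INR 2).
           pose proof (div_ln_monotone (INR d) D Hd3 HdD) as Hm.
           replace ((1 + 1) * INR d * ln Rr / ln (INR d)) with (2 * ln Rr * (INR d / ln (INR d))) by (field; lra).
           apply Rmult_le_compat_l; lra.
      * rewrite lsum_const. apply Rmult_le_compat_r.
        { apply Rmult_le_pos; [lra|]. left; apply Rdiv_lt_0_compat; lra. }
        eapply Rle_trans; [apply bounded_pairs_length, Hn|].
        pose proof (INR_ge1 n Hn).
        assert (0 <= ln (INR n)) by (rewrite <- ln_1; apply ln_le; lra).
        assert (ln (INR n) <= ln Rr) by (apply ln_le; lra).
        apply Rmult_le_compat; lra.
    + rewrite lsum_const, length_seq.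
      assert (HnD : INR (nD - 2) <= D) by (eapply Rle_trans; [apply le_INR|exact HD1]; lia).
      pose proof (pos_INR (nD - 2)).
      assert (H1l : 1 + ln Rr <= (1 + / ln 2) * ln Rr).
      { assert (1 <= / ln 2 * ln Rr); [|lra]. rewrite <- (Rinv_l (ln 2)) by lra. apply Rmult_le_compat_l; lra. }
      assert (HDl : 0 < D / ln D) by (apply Rdiv_lt_0_compat; lra).
      replace (2 * (1 + / ln 2) * (D ^ 2 * Rr * ln Rr ^ 2 / ln D))
        with (D * (Rr * ((1 + / ln 2) * ln Rr) * (2 * ln Rr * (D / ln D)))) by (field; lra).
      apply Rmult_le_compat; [assumption| |assumption|].
      * apply Rmult_le_pos; [nra|]. apply Rmult_le_pos; lra.
      * apply Rmult_le_compat_r; [apply Rmult_le_pos; lra|]. apply Rmult_le_compat_l; lra.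
  - intros p d a b Hp HE Hd Hdp HdD Ha Hb Hne Hle Hmod. apply HE.
    apply in_flat_map. exists d. split.
    { apply in_seq. assert (d < S nD)%nat; [|lia]. apply INR_lt. rewrite S_INR. lra. }
    apply in_flat_map. exists (a, b). split.
    { apply in_bounded_pairs. repeat split; try assumption. assert (a * b < S n)%nat; [|lia]. apply INR_lt. rewrite S_INR. lra. }
    simpl fst; simpl snd. destruct (Nat.eq_dec a b) as [|_]; [tauto|].
    apply in_big_prime_divisors; [apply Hab; assumption|]. split; [exact Hp|]. split; [|exact Hdp].
    assert (Hp1 : (1 < p)%nat) by (destruct Hp; lia).
    apply Nat.mod_divide; [lia|]. apply Zdivide_mod0; [lia|].
    pose proof (Zdivide_of_mod_eq _ _ _ Hmod) as Hz. unfold absdiff.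
    set (x := (a ^ (2 * d))%nat) in *. set (y := (b ^ (2 * d))%nat) in *.
    destruct (le_lt_dec x y).
    + replace (Z.of_nat (x - y + (y - x))) with (- (Z.of_nat x - Z.of_nat y))%Z by lia. apply Z.divide_opp_r, Hz.
    + replace (Z.of_nat (x - y + (y - x))) with (Z.of_nat x - Z.of_nat y)%Z by lia. exact Hz.
Qed.

(** * Dirichlet characters *)

Lemma mod_mul_eq (p a a' b b' : nat) : (a mod p = a' mod p)%nat -> (b mod p = b' mod p)%nat ->
  ((a * b) mod p = (a' * b') mod p)%nat.
Proof.
  intros H1 H2. rewrite (Nat.Div0.mul_mod a b), (Nat.Div0.mul_mod a' b'), H1, H2. reflexivity.
Qed.

Lemma mod_pow_eq (p a a' n : nat) : (a mod p = a' mod p)%nat -> ((a ^ n) mod p = (a' ^ n) mod p)%nat.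
Proof.
  intros H. induction n as [|n IH]; [reflexivity|]. simpl. apply mod_mul_eq; assumption.
Qed.

Lemma mod_mul_nonzero (p a b : nat) : prime (Z.of_nat p) ->
  (a mod p <> 0)%nat -> (b mod p <> 0)%nat -> ((a * b) mod p <> 0)%nat.
Proof.
  intros Hp Ha Hb H. assert (p <> 0)%nat by (intros ->; destruct Hp; simpl in *; lia).
  rewrite <- Zdivide_mod0 in * by assumption. rewrite Nat2Z.inj_mul in H.
  apply prime_mult in H; tauto.
Qed.

Lemma mod_mul_zero (p a b : nat) : (a mod p = 0)%nat \/ (b mod p = 0)%nat -> ((a * b) mod p = 0)%nat.
Proof.
  intros [H|H]; rewrite Nat.Div0.mul_mod, H, ?Nat.mul_0_r; apply Nat.Div0.mod_0_l.
Qed.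

Lemma mod_pow_nonzero (p a n : nat) : prime (Z.of_nat p) -> (a mod p <> 0)%nat -> ((a ^ n) mod p <> 0)%nat.
Proof.
  intros Hp Ha. assert (1 < p)%nat by (destruct Hp; lia). induction n as [|n IH]; simpl.
  - rewrite Nat.mod_small by lia. lia.
  - apply mod_mul_nonzero; assumption.
Qed.

Lemma mod_mul_cancel_l (p c a b : nat) : prime (Z.of_nat p) -> (c mod p <> 0)%nat ->
  ((c * a) mod p = (c * b) mod p)%nat -> (a mod p = b mod p)%nat.
Proof.
  intros Hp Hc H. assert (p <> 0)%nat by (intros ->; destruct Hp; simpl in *; lia).
  apply Zdivide_of_mod_eq in H.
  replace (Z.of_nat (c * a) - Z.of_nat (c * b))%Z with (Z.of_nat c * (Z.of_nat a - Z.of_nat b))%Z in H by lia.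
  apply prime_mult in H; [|exact Hp]. rewrite <- Zdivide_mod0 in Hc by assumption.
  apply mod_eq_of_Zdivide; tauto.
Qed.

(** Only surjectivity onto the units and [g^(p-1) = 1] are recorded; injectivity of the exponents
    below [p - 1] follows by counting, in [primitive_root_perm]. *)
Definition is_primitive_root (p g : nat) : Prop :=
  (forall n, (n mod p <> 0)%nat -> exists i, (i < p - 1)%nat /\ ((g ^ i) mod p = n mod p)%nat)
  /\ ((g ^ (p - 1)) mod p = 1)%nat.

Lemma primitive_root_perm (p g : nat) : prime (Z.of_nat p) -> is_primitive_root p g ->
  Permutation (seq 1 (p - 1)) (map (fun i => (g ^ i) mod p)%nat (seq 0 (p - 1))).
Proof.
  intros Hp [H1 _]. apply NoDup_Permutation_bis; [apply seq_NoDup|rewrite length_map, !length_seq; lia|].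
  intros n Hn. apply in_seq in Hn. destruct (H1 n) as [i [Hi E]]; [rewrite Nat.mod_small; lia|].
  apply in_map_iff. exists i. split; [rewrite E; apply Nat.mod_small; lia|apply in_seq; lia].
Qed.

Lemma primitive_root_inj (p g i j : nat) : prime (Z.of_nat p) -> is_primitive_root p g ->
  (i < p - 1)%nat -> (j < p - 1)%nat -> ((g ^ i) mod p = (g ^ j) mod p)%nat -> i = j.
Proof.
  intros Hp Hg Hi Hj E. pose proof (primitive_root_perm p g Hp Hg) as HP.
  assert (Hnd : NoDup (map (fun i => (g ^ i) mod p)%nat (seq 0 (p - 1)))) by (apply (Permutation_NoDup HP), seq_NoDup).
  assert (Hlen : length (map (fun i => (g ^ i) mod p)%nat (seq 0 (p - 1))) = (p - 1)%nat) by (rewrite length_map, length_seq; reflexivity).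
  apply (proj1 (NoDup_nth _ 0%nat) Hnd); [lia|lia|].
  rewrite !(nth_indep _ 0%nat ((g ^ 0) mod p)%nat) by lia.
  rewrite !(map_nth (fun i => (g ^ i) mod p)%nat), !seq_nth by assumption. exact E.
Qed.

Lemma primitive_root_unit (p g : nat) : prime (Z.of_nat p) -> is_primitive_root p g -> (g mod p <> 0)%nat.
Proof.
  intros Hp [_ H] E. assert (1 < p)%nat by (destruct Hp; lia).
  destruct (p - 1)%nat as [|q] eqn:Eq; [lia|]. simpl in H. rewrite mod_mul_zero in H by (left; exact E). lia.
Qed.

Lemma primitive_root_pow_mod (p g x : nat) : is_primitive_root p g -> (1 < p)%nat ->
  ((g ^ x) mod p = (g ^ (x mod (p - 1))) mod p)%nat.
Proof.
  intros [_ H] Hp. rewrite (Nat.div_mod_eq x (p - 1)) at 1. rewrite Nat.pow_add_r, Nat.pow_mul_r.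
  assert (E : (((g ^ (p - 1)) ^ (x / (p - 1))) mod p = (1 ^ (x / (p - 1))) mod p)%nat).
  { apply mod_pow_eq. rewrite H. rewrite Nat.mod_small; lia. }
  rewrite Nat.pow_1_l in E.
  rewrite (mod_mul_eq p _ 1 _ (g ^ (x mod (p - 1))) E eq_refl). f_equal. lia.
Qed.

Lemma primitive_root_pow_eq (p g x y : nat) : prime (Z.of_nat p) -> is_primitive_root p g ->
  ((g ^ x) mod p = (g ^ y) mod p)%nat <-> (x mod (p - 1) = y mod (p - 1))%nat.
Proof.
  intros Hp Hg. assert (H1 : (1 < p)%nat) by (destruct Hp; lia).
  rewrite (primitive_root_pow_mod p g x), (primitive_root_pow_mod p g y) by assumption. split.
  - intros E. apply (primitive_root_inj p g); try assumption; apply Nat.mod_upper_bound; lia.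
  - intros ->. reflexivity.
Qed.

(** The value is meaningful for units only; at multiples of [p] it is an arbitrary default, which
    [dchar] never consults. *)
Definition dlog (p g n : nat) : nat :=
  epsilon (inhabits 0%nat) (fun i => (i < p - 1)%nat /\ ((g ^ i) mod p = n mod p)%nat).

Lemma dlog_spec (p g n : nat) : is_primitive_root p g -> (n mod p <> 0)%nat ->
  (dlog p g n < p - 1)%nat /\ ((g ^ dlog p g n) mod p = n mod p)%nat.
Proof.
  intros [H _] Hn. unfold dlog. apply epsilon_spec. apply H, Hn.
Qed.

Lemma dlog_congr (p g n x : nat) : prime (Z.of_nat p) -> is_primitive_root p g ->
  ((g ^ x) mod p = n mod p)%nat -> (dlog p g n mod (p - 1) = x mod (p - 1))%nat.
Proof.
  intros Hp Hg E. apply (primitive_root_pow_eq p g); [assumption|assumption|]. rewrite E.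
  apply dlog_spec; [assumption|]. rewrite <- E. apply mod_pow_nonzero; [assumption|].
  apply primitive_root_unit; assumption.
Qed.

Lemma mod_eq_divisor (m n x y : nat) : Nat.divide m n -> (x mod n = y mod n)%nat -> (x mod m = y mod m)%nat.
Proof.
  intros [c ->] H. destruct (Nat.eq_dec m 0) as [->|Hm]; [rewrite Nat.mul_0_r in H; exact H|].
  apply mod_eq_of_Zdivide; [exact Hm|]. apply Zdivide_of_mod_eq in H.
  eapply Z.divide_trans; [|exact H]. exists (Z.of_nat c). lia.
Qed.

(** * Complex roots of unity *)

Definition cis (t : R) : C := (cos t, sin t).

Lemma cis_plus (s t : R) : cis (s + t) = (cis s * cis t)%C.
Proof.
  unfold cis, Cmult. simpl. rewrite cos_plus, sin_plus. f_equal; ring.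
Qed.

Lemma cis_period (t : R) (k : nat) : cis (t + 2 * INR k * PI) = cis t.
Proof. unfold cis. rewrite cos_period, sin_period. reflexivity. Qed.

Lemma cis_0 : cis 0 = 1%C.
Proof. unfold cis. rewrite cos_0, sin_0. reflexivity. Qed.

Lemma cis_nonzero (t : R) : cis t <> 0%C.
Proof.
  unfold cis. intros E. injection E as E1 E2. apply (cos_sin_0 t). tauto.
Qed.

Lemma cis_pow (t : R) (n : nat) : (cis t ^ n)%C = cis (INR n * t).
Proof.
  induction n as [|n IH]; [rewrite Rmult_0_l, cis_0; reflexivity|].
  rewrite Cpow_S, IH, <- cis_plus, S_INR. f_equal. ring.
Qed.

Lemma cos_eq_1 (t : R) : cos t = 1 -> exists k : Z, t = 2 * IZR k * PI.
Proof.
  intros H. replace t with (2 * (t / 2)) in H by field. rewrite cos_2a_sin in H.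
  assert (Hs : sin (t / 2) = 0) by nra.
  destruct (sin_eq_0_0 _ Hs) as [k Hk]. exists k. lra.
Qed.

Lemma unit_circle_cis (z : C) : Cmod z = 1 -> exists t, 0 <= t < 2 * PI /\ z = cis t.
Proof.
  intros H. destruct z as [x y]. unfold Cmod in H. simpl in H. rewrite !Rmult_1_r in H.
  assert (Hxy : x * x + y * y = 1).
  { rewrite <- (sqrt_sqrt (x * x + y * y)) by nra. rewrite H. ring. }
  assert (Hx : -1 <= x <= 1) by nra. pose proof (acos_bound x) as Hb. pose proof PI_RGT_0 as Hpi.
  assert (Hs : sin (acos x) = Rabs y).
  { rewrite sin_acos by exact Hx. rewrite <- sqrt_Rsqr_abs. f_equal. unfold Rsqr; lra. }
  destruct (Rle_lt_dec 0 y) as [Hy|Hy].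
  - exists (acos x). split; [lra|]. unfold cis. rewrite cos_acos, Hs, Rabs_pos_eq by assumption. reflexivity.
  - exists (2 * PI - acos x). rewrite Rabs_left in Hs by assumption. split.
    + split; [lra|]. destruct (Req_dec (acos x) 0) as [E|E]; [|lra]. rewrite E, sin_0 in Hs. lra.
    + unfold cis. replace (2 * PI - acos x) with (- acos x + 2 * INR 1 * PI) by (simpl; ring).
      rewrite cos_period, sin_period, cos_neg, sin_neg, cos_acos, Hs by assumption. f_equal; ring.
Qed.

Definition phase (m j x : nat) : R := 2 * PI * INR j * INR x / INR m.

Lemma phase_mod (m j x y : nat) : (1 <= m)%nat -> (x mod m = y mod m)%nat ->
  cis (phase m j x) = cis (phase m j y).
Proof.
  intros Hm H. pose proof (INR_gt0 m Hm) as Hm0.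
  assert (E : forall x, cis (phase m j x) = cis (phase m j (x mod m))).
  { clear x y H. intros x. rewrite <- (cis_period (phase m j (x mod m)) (j * (x / m))). f_equal.
    unfold phase. rewrite (Nat.div_mod_eq x m) at 1. rewrite plus_INR, !mult_INR. field. lra. }
  rewrite (E x), (E y), H. reflexivity.
Qed.

Lemma phase_plus (m j x y : nat) : cis (phase m j (x + y)) = (cis (phase m j x) * cis (phase m j y))%C.
Proof.
  rewrite <- cis_plus. f_equal. unfold phase. rewrite plus_INR. unfold Rdiv. ring.
Qed.

Lemma roots_of_unity (m : nat) (z : C) : (1 <= m)%nat -> (z ^ m)%C = 1%C ->
  exists j, (j < m)%nat /\ z = cis (phase m j 1).
Proof.
  intros Hm Hz. pose proof (INR_gt0 m Hm) as Hm0. pose proof PI_RGT_0 as Hpi.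
  assert (Hmod : Cmod z = 1).
  { apply (f_equal Cmod) in Hz. rewrite Cmod_pow, Cmod_1 in Hz. pose proof (Cmod_ge_0 z) as H0.
    destruct (Rtotal_order (Cmod z) 1) as [H|[H|H]]; [|exact H|]; exfalso.
    - pose proof (pow_lt_1_compat (Cmod z) m (conj H0 H) ltac:(lia)). lra.
    - pose proof (Rlt_pow_R1 (Cmod z) m H ltac:(lia)). lra. }
  destruct (unit_circle_cis z Hmod) as [t [Ht ->]]. rewrite cis_pow in Hz.
  assert (Hc : cos (INR m * t) = 1) by (apply (f_equal fst) in Hz; exact Hz).
  destruct (cos_eq_1 _ Hc) as [k Hk].
  assert (Hk0 : (0 <= k)%Z) by (apply le_IZR; apply (Rmult_le_reg_l (2 * PI)); nra).
  assert (Hkm : (k < Z.of_nat m)%Z).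
  { apply lt_IZR. rewrite <- INR_IZR_INZ. apply (Rmult_lt_reg_l (2 * PI)); nra. }
  exists (Z.to_nat k). split; [lia|]. f_equal. unfold phase.
  rewrite (INR_IZR_INZ (Z.to_nat k)), Z2Nat.id by exact Hk0. simpl (INR 1).
  apply (Rmult_eq_reg_l (INR m)); [|lra]. rewrite Hk. field. lra.
Qed.

Lemma phase_inj (m i j : nat) : (i < m)%nat -> (j < m)%nat -> cis (phase m i 1) = cis (phase m j 1) -> i = j.
Proof.
  intros Hi Hj E. pose proof (INR_gt0 m ltac:(lia)) as Hm0. pose proof PI_RGT_0 as Hpi.
  unfold cis in E. injection E as E1 E2.
  assert (Hc : cos (phase m i 1 - phase m j 1) = 1).
  { rewrite cos_minus, E1, E2. pose proof (sin2_cos2 (phase m j 1)) as H. unfold Rsqr in H. lra. }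
  destruct (cos_eq_1 _ Hc) as [k Hk].
  assert (Hz : IZR (Z.of_nat i - Z.of_nat j) = IZR (k * Z.of_nat m)).
  { rewrite minus_IZR, mult_IZR, <- !INR_IZR_INZ. unfold phase in Hk. simpl (INR 1) in Hk.
    apply (Rmult_eq_reg_l (2 * PI / INR m)).
    - transitivity (2 * PI * INR i * 1 / INR m - 2 * PI * INR j * 1 / INR m); [field; lra|]. rewrite Hk. field; lra.
    - apply Rgt_not_eq, Rdiv_lt_0_compat; lra. }
  apply eq_IZR in Hz. assert (k = 0)%Z by nia. nia.
Qed.

(* [dchar p g m j] sends the primitive root [g] to [exp(2 pi i j / m)]. *)
Definition dchar (p g m j n : nat) : C :=
  if Nat.eq_dec (n mod p) 0 then 0%C else cis (phase m j (dlog p g n)).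

Lemma dchar_pow (p g m j n x : nat) : prime (Z.of_nat p) -> is_primitive_root p g ->
  (1 <= m)%nat -> Nat.divide m (p - 1) -> ((g ^ x) mod p = n mod p)%nat ->
  dchar p g m j n = cis (phase m j x).
Proof.
  intros Hp Hg Hm Hd E. unfold dchar. destruct (Nat.eq_dec (n mod p) 0) as [E0|E0].
  - exfalso. rewrite <- E in E0. revert E0. apply mod_pow_nonzero; [assumption|].
    apply primitive_root_unit; assumption.
  - apply phase_mod; [exact Hm|]. apply (mod_eq_divisor m (p - 1)); [exact Hd|]. apply dlog_congr; assumption.
Qed.

Lemma dchar_zero (p g m j n : nat) : (n mod p = 0)%nat -> dchar p g m j n = 0%C.
Proof. intros H. unfold dchar. destruct (Nat.eq_dec (n mod p) 0); tauto. Qed.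

Lemma dchar_mul (p g m j a b : nat) : prime (Z.of_nat p) -> is_primitive_root p g ->
  (1 <= m)%nat -> Nat.divide m (p - 1) ->
  dchar p g m j (a * b) = (dchar p g m j a * dchar p g m j b)%C.
Proof.
  intros Hp Hg Hm Hd.
  destruct (Nat.eq_dec (a mod p) 0) as [Ha|Ha].
  { rewrite (dchar_zero _ _ _ _ a Ha), dchar_zero by (apply mod_mul_zero; tauto). ring. }
  destruct (Nat.eq_dec (b mod p) 0) as [Hb|Hb].
  { rewrite (dchar_zero _ _ _ _ b Hb), dchar_zero by (apply mod_mul_zero; tauto). ring. }
  destruct (dlog_spec p g a Hg Ha) as [_ Ea]. destruct (dlog_spec p g b Hg Hb) as [_ Eb].
  rewrite (dchar_pow p g m j a _ Hp Hg Hm Hd Ea), (dchar_pow p g m j b _ Hp Hg Hm Hd Eb).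
  rewrite (dchar_pow p g m j (a * b) (dlog p g a + dlog p g b)); try assumption.
  - apply phase_plus.
  - rewrite Nat.pow_add_r. apply mod_mul_eq; assumption.
Qed.

Lemma dchar_mod_eq (p g m j a b : nat) : prime (Z.of_nat p) -> is_primitive_root p g ->
  (1 <= m)%nat -> Nat.divide m (p - 1) -> (a mod p = b mod p)%nat -> dchar p g m j a = dchar p g m j b.
Proof.
  intros Hp Hg Hm Hd E. destruct (Nat.eq_dec (a mod p) 0) as [Ha|Ha].
  - rewrite !dchar_zero by congruence. reflexivity.
  - destruct (dlog_spec p g a Hg Ha) as [_ Ea].
    rewrite (dchar_pow p g m j a _ Hp Hg Hm Hd Ea). symmetry. apply dchar_pow; try assumption. congruence.
Qed.

Lemma dchar_in_X (p g m j : nat) : prime (Z.of_nat p) -> is_primitive_root p g ->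
  (1 <= m)%nat -> Nat.divide m (p - 1) -> in_X p m (dchar p g m j).
Proof.
  intros Hp Hg Hm Hd. split; [split; [|split]|].
  - intros a b. apply dchar_mul; assumption.
  - intros n. apply dchar_mod_eq; try assumption. rewrite <- (Nat.mul_1_l p) at 1. apply Nat.Div0.mod_add.
  - intros n. split; [|apply dchar_zero]. unfold dchar. destruct (Nat.eq_dec (n mod p) 0) as [E|E]; [tauto|].
    intros H. exfalso. revert H. apply cis_nonzero.
  - intros x Hx. destruct (dlog_spec p g x Hg Hx) as [_ Ex].
    rewrite (dchar_pow p g m j (x ^ m) (dlog p g x * m)); try assumption.
    + rewrite (phase_mod m j _ 0); [|exact Hm|rewrite Nat.Div0.mod_mul, Nat.Div0.mod_0_l; reflexivity].
      unfold phase. simpl (INR 0). rewrite Rmult_0_r. unfold Rdiv. rewrite Rmult_0_l. apply cis_0.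
    + rewrite Nat.pow_mul_r. apply mod_pow_eq, Ex.
Qed.

Lemma char_periodic (p : nat) (chi : nat -> C) (a b : nat) :
  (forall n, chi (n + p)%nat = chi n) -> (a mod p = b mod p)%nat -> chi a = chi b.
Proof.
  intros H E.
  assert (K : forall q r, chi (p * q + r)%nat = chi r).
  { intros q r. induction q as [|q IH]; [f_equal; lia|]. replace (p * S q + r)%nat with (p * q + r + p)%nat by lia. rewrite H. exact IH. }
  rewrite (Nat.div_mod_eq a p), (Nat.div_mod_eq b p), !K, E. reflexivity.
Qed.

(** A character is determined by its value at [g], and triviality on [m]-th powers gives
    [chi(g)^m = chi(g^m) = 1], so that value is one of the [m] roots of unity. *)
Lemma in_X_dchar (p g m : nat) (chi : nat -> C) : prime (Z.of_nat p) -> is_primitive_root p g ->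
  (1 <= m)%nat -> Nat.divide m (p - 1) -> in_X p m chi -> exists j, (j < m)%nat /\ chi = dchar p g m j.
Proof.
  intros Hp Hg Hm Hd [[Hmul [Hper Hz]] Htriv].
  assert (Hp1 : (1 < p)%nat) by (destruct Hp; lia).
  assert (H1 : chi 1%nat = 1%C).
  { rewrite <- (Nat.pow_1_l m). apply Htriv. rewrite Nat.mod_small; lia. }
  assert (Hpow : forall i, chi (g ^ i)%nat = (chi g ^ i)%C).
  { induction i as [|i IH]; [exact H1|]. rewrite Nat.pow_succ_r', Hmul, IH. reflexivity. }
  destruct (roots_of_unity m (chi g) Hm) as [j [Hj Ej]].
  { rewrite <- Hpow. apply Htriv, primitive_root_unit; assumption. }
  exists j. split; [exact Hj|]. apply functional_extensionality. intros n.
  destruct (Nat.eq_dec (n mod p) 0) as [E|E].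
  - rewrite dchar_zero by exact E. apply Hz, E.
  - destruct (dlog_spec p g n Hg E) as [_ En].
    rewrite (dchar_pow p g m j n _ Hp Hg Hm Hd En).
    rewrite <- (char_periodic p chi _ _ Hper En), Hpow, Ej, cis_pow. f_equal.
    unfold phase. simpl (INR 1). unfold Rdiv. ring.
Qed.

Lemma dchar_g (p g m j : nat) : prime (Z.of_nat p) -> is_primitive_root p g ->
  (1 <= m)%nat -> Nat.divide m (p - 1) -> dchar p g m j g = cis (phase m j 1).
Proof.
  intros Hp Hg Hm Hd. apply dchar_pow; try assumption. rewrite Nat.pow_1_r. reflexivity.
Qed.

Lemma dchar_inj (p g m i j : nat) : prime (Z.of_nat p) -> is_primitive_root p g ->
  (1 <= m)%nat -> Nat.divide m (p - 1) -> (i < m)%nat -> (j < m)%nat ->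
  dchar p g m i = dchar p g m j -> i = j.
Proof.
  intros Hp Hg Hm Hd Hi Hj E. apply (phase_inj m); try assumption.
  rewrite <- !(dchar_g p g) by assumption. rewrite E. reflexivity.
Qed.

Lemma dchar_principal (p g m j : nat) : prime (Z.of_nat p) -> is_primitive_root p g ->
  (1 <= m)%nat -> Nat.divide m (p - 1) -> (j < m)%nat ->
  principal p (dchar p g m j) <-> j = 0%nat.
Proof.
  intros Hp Hg Hm Hd Hj.
  assert (H0 : forall x, cis (phase m 0 x) = 1%C).
  { intros x. unfold phase. simpl (INR 0). rewrite Rmult_0_r, Rmult_0_l. unfold Rdiv. rewrite Rmult_0_l. apply cis_0. }
  split.
  - intros H. apply (phase_inj m); [exact Hj|lia|]. rewrite H0, <- (dchar_g p g) by assumption.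
    apply H, primitive_root_unit; assumption.
  - intros -> n Hn. unfold dchar. destruct (Nat.eq_dec (n mod p) 0); [tauto|]. apply H0.
Qed.

(** The index [h] of [-1] satisfies [0 < h < p - 1], and [p - 1] divides [2 h]. *)
Lemma dlog_minus_one (p g : nat) : prime (Z.of_nat p) -> is_primitive_root p g -> (3 <= p)%nat ->
  (2 * dlog p g (p - 1) = p - 1)%nat.
Proof.
  intros Hp Hg H3.
  assert (Hu : ((p - 1) mod p <> 0)%nat) by (rewrite Nat.mod_small; lia).
  destruct (dlog_spec p g _ Hg Hu) as [Hlt E]. set (h := dlog p g (p - 1)) in *.
  assert (Hsq : ((g ^ (h + h)) mod p = (g ^ 0) mod p)%nat).
  { rewrite Nat.pow_add_r. rewrite (mod_mul_eq p _ _ _ _ E E). simpl.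
    (* [(p - 1)^2 - 1 = p (p - 2)]. *)
    apply mod_eq_of_Zdivide; [lia|]. exists (Z.of_nat p - 2)%Z. nia. }
  apply (primitive_root_pow_eq p g) in Hsq; [|assumption|assumption].
  rewrite Nat.Div0.mod_0_l in Hsq. apply Nat.Lcm0.mod_divide in Hsq. destruct Hsq as [c Hc].
  assert (h <> 0)%nat.
  { intros Hh. rewrite Hh in E. simpl in E. rewrite !Nat.mod_small in E by lia. lia. }
  assert (c = 1)%nat by nia. nia.
Qed.

Lemma cis_half_turns (n : nat) : cis (PI * INR n) = if Nat.odd n then Copp 1%C else 1%C.
Proof.
  induction n as [|n IH].
  - simpl. rewrite Rmult_0_r. apply cis_0.
  - rewrite S_INR, Rmult_plus_distr_l, Rmult_1_r, cis_plus, IH, Nat.odd_succ, <- Nat.negb_odd.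
    assert (E : cis PI = Copp 1%C) by (unfold cis, Copp; rewrite cos_PI, sin_PI; simpl; f_equal; ring).
    rewrite E. destruct (Nat.odd n); simpl; ring.
Qed.

(** The index of [-1] is [m d / 2], so the value at [-1] is [exp(pi i j d) = (-1)^(j d)], which is
    [(-1)^j] for odd [d]. *)
Lemma dchar_odd (p g m d j : nat) : prime (Z.of_nat p) -> is_primitive_root p g -> (3 <= p)%nat ->
  (p - 1 = m * d)%nat -> Nat.Odd d -> odd_char p (dchar p g m j) <-> Nat.odd j = true.
Proof.
  intros Hp Hg H3 Hmd Hodd.
  assert (Hm : (1 <= m)%nat) by nia.
  assert (Hd : Nat.divide m (p - 1)) by (exists d; lia).
  assert (Hu : ((p - 1) mod p <> 0)%nat) by (rewrite Nat.mod_small; lia).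
  unfold odd_char. destruct (dlog_spec p g _ Hg Hu) as [Hlt E].
  rewrite (dchar_pow p g m j _ _ Hp Hg Hm Hd E).
  pose proof (dlog_minus_one p g Hp Hg H3) as Hh.
  assert (Ep : phase m j (dlog p g (p - 1)) = PI * INR (j * d)).
  { unfold phase. pose proof (INR_gt0 m Hm). assert (Hr : 2 * INR (dlog p g (p - 1)) = INR m * INR d).
    { rewrite <- mult_INR. replace (m * d)%nat with (2 * dlog p g (p - 1))%nat by lia.
      rewrite mult_INR. reflexivity. }
    rewrite mult_INR. replace (2 * PI * INR j * INR (dlog p g (p - 1)) / INR m)
      with (PI * INR j * (2 * INR (dlog p g (p - 1))) / INR m) by (field; lra).
    rewrite Hr. field. lra. }
  rewrite Ep, cis_half_turns, Nat.odd_mul.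
  apply Nat.odd_spec in Hodd. rewrite Hodd, Bool.andb_true_r.
  destruct (Nat.odd j); [tauto|]. split; [|discriminate].
  intros H. exfalso. apply (f_equal fst) in H. unfold Copp in H. simpl in H. lra.
Qed.

(** The list chosen by [epsilon] is known only up to order, which is enough for sums and lengths. An
    explicit enumeration is also what shows that such a list exists. *)
Lemma charlist_perm (P : (nat -> C) -> Prop) (l : list (nat -> C)) :
  NoDup l -> (forall chi, In chi l <-> P chi) -> Permutation (charlist P) l.
Proof.
  intros Hnd Hl.
  assert (H : NoDup (charlist P) /\ forall chi, In chi (charlist P) <-> P chi).
  { unfold charlist. apply epsilon_spec. exists l. split; assumption. }
  apply NoDup_Permutation; [apply H|exact Hnd|]. intros chi. rewrite Hl. apply H.
Qed.

Lemma charlist_nonprincipal (p g m : nat) : prime (Z.of_nat p) -> is_primitive_root p g ->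
  (1 <= m)%nat -> Nat.divide m (p - 1) ->
  Permutation (charlist (fun chi => in_X p m chi /\ ~ principal p chi)) (map (dchar p g m) (seq 1 (m - 1))).
Proof.
  intros Hp Hg Hm Hd. apply charlist_perm.
  - apply FinFun.Injective_map_NoDup_in; [|apply seq_NoDup].
    intros i j Hi Hj. apply in_seq in Hi. apply in_seq in Hj. apply dchar_inj; try assumption; lia.
  - intros chi. rewrite in_map_iff. split.
    + intros [j [<- Hj]]. apply in_seq in Hj. split; [apply dchar_in_X; assumption|].
      rewrite dchar_principal; try assumption; lia.
    + intros [HX Hnp]. destruct (in_X_dchar p g m chi Hp Hg Hm Hd HX) as [j [Hj ->]].
      exists j. split; [reflexivity|]. rewrite dchar_principal in Hnp by assumption. apply in_seq. lia.
Qed.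

Lemma charlist_odd (p g m d : nat) : prime (Z.of_nat p) -> is_primitive_root p g -> (3 <= p)%nat ->
  (p - 1 = m * d)%nat -> Nat.Odd d ->
  Permutation (charlist (fun chi => in_X p m chi /\ odd_char p chi))
    (map (dchar p g m) (filter Nat.odd (seq 0 m))).
Proof.
  intros Hp Hg H3 Hmd Hodd.
  assert (Hm : (1 <= m)%nat) by nia.
  assert (Hd : Nat.divide m (p - 1)) by (exists d; lia).
  apply charlist_perm.
  - apply FinFun.Injective_map_NoDup_in; [|apply NoDup_filter, seq_NoDup].
    intros i j Hi Hj. apply filter_In in Hi. apply filter_In in Hj.
    rewrite in_seq in Hi, Hj. apply dchar_inj; try assumption; lia.
  - intros chi. rewrite in_map_iff. split.
    + intros [j [<- Hj]]. apply filter_In in Hj. split; [apply dchar_in_X; assumption|].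
      apply (dchar_odd p g m d); tauto.
    + intros [HX Ho]. destruct (in_X_dchar p g m chi Hp Hg Hm Hd HX) as [j [Hj ->]].
      exists j. split; [reflexivity|]. apply filter_In. split; [apply in_seq; lia|].
      apply (dchar_odd p g m d) in Ho; assumption.
Qed.

(** * Orthogonality and truncation *)

(** Multiplication by [2 sin (phi / 2)] turns the [i]-th term into [sin (i phi + phi / 2) - sin (i
    phi - phi / 2)], and the sum telescopes. *)
Lemma cos_sum_closed (phi : R) (n : nat) :
  2 * sin (phi / 2) * lsum (seq 0 n) (fun i => cos (INR i * phi)) =
  sin (INR n * phi - phi / 2) + sin (phi / 2).
Proof.
  induction n as [|n IH].
  - unfold lsum; simpl. replace (0 * phi - phi / 2) with (- (phi / 2)) by ring. rewrite sin_neg. ring.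
  - rewrite lsum_seq_S, Rmult_plus_distr_l, IH. simpl (0 + n)%nat.
    replace (INR (S n) * phi - phi / 2) with (INR n * phi + phi / 2) by (rewrite S_INR; field).
    rewrite sin_minus, sin_plus. ring.
Qed.

Lemma sin_sum_closed (phi : R) (n : nat) :
  2 * sin (phi / 2) * lsum (seq 0 n) (fun i => sin (INR i * phi)) =
  cos (phi / 2) - cos (INR n * phi - phi / 2).
Proof.
  induction n as [|n IH].
  - unfold lsum; simpl. replace (0 * phi - phi / 2) with (- (phi / 2)) by ring. rewrite cos_neg. ring.
  - rewrite lsum_seq_S, Rmult_plus_distr_l, IH. simpl (0 + n)%nat.
    replace (INR (S n) * phi - phi / 2) with (INR n * phi + phi / 2) by (rewrite S_INR; field).
    rewrite cos_minus, cos_plus. ring.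
Qed.

Lemma trig_sums_zero (phi : R) (n x : nat) : INR n * phi = 2 * INR x * PI -> sin (phi / 2) <> 0 ->
  lsum (seq 0 n) (fun i => cos (INR i * phi)) = 0 /\ lsum (seq 0 n) (fun i => sin (INR i * phi)) = 0.
Proof.
  intros E Hs. pose proof (cos_sum_closed phi n) as Hc. pose proof (sin_sum_closed phi n) as Hn.
  replace (INR n * phi - phi / 2) with (- (phi / 2) + 2 * INR x * PI) in * by lra.
  rewrite sin_period, sin_neg in Hc. rewrite cos_period, cos_neg in Hn.
  split; apply (Rmult_eq_reg_l (2 * sin (phi / 2))); lra.
Qed.

Lemma sin_rational_nonzero (m x : nat) : (1 <= m)%nat -> (x mod m <> 0)%nat ->
  sin (2 * PI * INR x / INR m / 2) <> 0.
Proof.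
  intros Hm Hx Hs. pose proof (INR_gt0 m Hm) as Hm0. pose proof PI_RGT_0 as Hpi.
  destruct (sin_eq_0_0 _ Hs) as [k Hk].
  assert (E : IZR (Z.of_nat x) = IZR (k * Z.of_nat m)).
  { rewrite mult_IZR, <- !INR_IZR_INZ. apply (Rmult_eq_reg_l (PI / INR m)).
    - transitivity (2 * PI * INR x / INR m / 2); [field; lra|]. rewrite Hk. field; lra.
    - apply Rgt_not_eq, Rdiv_lt_0_compat; lra. }
  apply eq_IZR in E. apply Hx. apply Zdivide_mod0; [lia|]. exists k. exact E.
Qed.

Lemma phase_cos_sum (m x : nat) : (1 <= m)%nat ->
  lsum (seq 0 m) (fun j => cos (phase m j x)) = if Nat.eq_dec (x mod m) 0 then INR m else 0.
Proof.
  intros Hm. pose proof (INR_gt0 m Hm) as Hm0. destruct (Nat.eq_dec (x mod m) 0) as [E|E].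
  - rewrite (lsum_ext _ _ (fun _ => 1)); [rewrite lsum_const, length_seq; ring|].
    intros j _. rewrite <- cos_0. change (fst (cis (phase m j x)) = fst (cis 0)). f_equal.
    rewrite (phase_mod m j x 0); [|exact Hm|rewrite Nat.Div0.mod_0_l; exact E].
    f_equal. unfold phase. simpl (INR 0). rewrite Rmult_0_r. unfold Rdiv. ring.
  - rewrite (lsum_ext _ _ (fun j => cos (INR j * (2 * PI * INR x / INR m)))).
    + apply (trig_sums_zero _ m x); [field; lra|]. apply sin_rational_nonzero; assumption.
    + intros j _. f_equal. unfold phase. field. lra.
Qed.

(** The real part of [chi(a)] times the conjugate of [chi(b)]; only real parts survive when a
    squared modulus is expanded. *)
Definition Kform (chi : nat -> C) (a b : nat) : R :=
  fst (chi a) * fst (chi b) + snd (chi a) * snd (chi b).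

(** The index of [a / b] modulo [p - 1]; the added [p - 1] keeps the truncated subtraction exact. *)
Definition dlog_diff (p g a b : nat) : nat := (dlog p g a + (p - 1 - dlog p g b))%nat.

Lemma Kform_dchar (p g m j a b : nat) : prime (Z.of_nat p) -> is_primitive_root p g ->
  (1 <= m)%nat -> Nat.divide m (p - 1) -> (a mod p <> 0)%nat -> (b mod p <> 0)%nat ->
  Kform (dchar p g m j) a b = cos (phase m j (dlog_diff p g a b)).
Proof.
  intros Hp Hg Hm Hd Ha Hb. pose proof (INR_gt0 m Hm) as Hm0.
  unfold Kform, dchar. destruct (Nat.eq_dec (a mod p) 0); [tauto|]. destruct (Nat.eq_dec (b mod p) 0); [tauto|].
  simpl. rewrite <- cos_minus. destruct Hd as [c Hc].
  destruct (dlog_spec p g b Hg Hb) as [Hlt _].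
  rewrite <- (cos_period (_ - _) (j * c)). f_equal. unfold phase, dlog_diff.
  rewrite plus_INR, minus_INR, Hc, !mult_INR by lia. field. lra.
Qed.

Lemma Kform_zero (p g m j a b : nat) : (a mod p = 0)%nat \/ (b mod p = 0)%nat ->
  Kform (dchar p g m j) a b = 0.
Proof.
  intros [H|H]; unfold Kform; rewrite (dchar_zero _ _ _ _ _ H); simpl; ring.
Qed.

Definition is_unit (p a : nat) : bool := negb (Nat.eqb (a mod p) 0).

(** The condition on the index says that [a / b] is an [m]-th power, that is, lies in [G_m]. *)
Lemma orthogonality (p g m a b : nat) : prime (Z.of_nat p) -> is_primitive_root p g ->
  (1 <= m)%nat -> Nat.divide m (p - 1) ->
  lsum (seq 0 m) (fun j => Kform (dchar p g m j) a b) =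
  if (is_unit p a && is_unit p b && Nat.eqb (dlog_diff p g a b mod m) 0)%bool then INR m else 0.
Proof.
  intros Hp Hg Hm Hd. unfold is_unit.
  destruct (Nat.eqb_spec (a mod p) 0) as [Ha|Ha]; [simpl; apply lsum_zero; intros; apply Kform_zero; tauto|].
  destruct (Nat.eqb_spec (b mod p) 0) as [Hb|Hb]; [simpl; apply lsum_zero; intros; apply Kform_zero; tauto|].
  simpl. rewrite (lsum_ext _ _ (fun j => cos (phase m j (dlog_diff p g a b)))).
  - rewrite phase_cos_sum by exact Hm.
    destruct (Nat.eq_dec (dlog_diff p g a b mod m) 0), (Nat.eqb_spec (dlog_diff p g a b mod m) 0); tauto.
  - intros j _. apply Kform_dchar; assumption.
Qed.

(** The sign [(-1)^j] equals [cis (phase m j h)] for [m = 2 h], so it merely shifts the index by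
    [h]. When [(p - 1) / m] is odd, the coset selected is [-G_m]. *)
Lemma orthogonality_alternating (p g m h a b : nat) : prime (Z.of_nat p) -> is_primitive_root p g ->
  m = (2 * h)%nat -> (1 <= m)%nat -> Nat.divide m (p - 1) ->
  lsum (seq 0 m) (fun j => (if Nat.odd j then -1 else 1) * Kform (dchar p g m j) a b) =
  if (is_unit p a && is_unit p b && Nat.eqb ((dlog_diff p g a b + h) mod m) 0)%bool then INR m else 0.
Proof.
  intros Hp Hg Hmh Hm Hd. unfold is_unit.
  destruct (Nat.eqb_spec (a mod p) 0) as [Ha|Ha]; [simpl; apply lsum_zero; intros; rewrite Kform_zero by tauto; ring|].
  destruct (Nat.eqb_spec (b mod p) 0) as [Hb|Hb]; [simpl; apply lsum_zero; intros; rewrite Kform_zero by tauto; ring|].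
  simpl. rewrite (lsum_ext _ _ (fun j => cos (phase m j (dlog_diff p g a b + h)))).
  - rewrite phase_cos_sum by exact Hm.
    destruct (Nat.eq_dec ((dlog_diff p g a b + h) mod m) 0), (Nat.eqb_spec ((dlog_diff p g a b + h) mod m) 0); tauto.
  - intros j _. rewrite Kform_dchar by assumption.
    change (cos (phase m j (dlog_diff p g a b + h))) with (fst (cis (phase m j (dlog_diff p g a b + h)))).
    rewrite phase_plus.
    assert (E : phase m j h = PI * INR j).
    { unfold phase. subst m. rewrite mult_INR. simpl (INR 2). field. apply Rgt_not_eq, INR_gt0. lia. }
    rewrite E, cis_half_turns. destruct (Nat.odd j); unfold cis, Cmult, Copp; simpl; ring.
Qed.

(** * Truncation of [L(1, chi)] by partial summation *)

Lemma periodic_sum_bound (f : nat -> R) (p : nat) : (1 <= p)%nat ->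
  (forall n, f (n + p)%nat = f n) -> (forall n, Rabs (f n) <= 1) -> lsum (seq 0 p) f = 0 ->
  forall M, Rabs (lsum (seq 0 M) f) <= INR p.
Proof.
  intros Hp Hper Hb H0 M. induction M as [M IH] using (well_founded_induction lt_wf).
  destruct (le_lt_dec p M) as [H|H].
  - replace M with (p + (M - p))%nat by lia. rewrite seq_app, lsum_app, H0, Rplus_0_l.
    assert (E : lsum (seq (0 + p) (M - p)) f = lsum (seq 0 (M - p)) f).
    { replace (0 + p)%nat with (p + 0)%nat by lia. generalize 0%nat as s. generalize (M - p)%nat as n.
      induction n as [|n IHn]; intros s; [reflexivity|]. simpl seq. rewrite !lsum_cons.
      rewrite (Nat.add_comm p s), Hper. rewrite <- (IHn (S s)). do 3 f_equal. lia. }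
    rewrite E. apply IH. lia.
  - eapply Rle_trans; [apply lsum_Rabs|]. apply Rle_trans with (lsum (seq 0 M) (fun _ => 1)).
    + apply lsum_le. intros n _. apply Hb.
    + rewrite lsum_const, length_seq, Rmult_1_r. apply le_INR. lia.
Qed.

Lemma dchar_period_sum (p g m j : nat) : prime (Z.of_nat p) -> is_primitive_root p g ->
  (1 <= m)%nat -> Nat.divide m (p - 1) -> (0 < j < m)%nat ->
  lsum (seq 0 p) (fun n => fst (dchar p g m j (S n))) = 0 /\
  lsum (seq 0 p) (fun n => snd (dchar p g m j (S n))) = 0.
Proof.
  intros Hp Hg Hm Hd Hj. assert (Hp1 : (1 < p)%nat) by (destruct Hp; lia).
  pose proof (INR_gt0 m Hm) as Hm0.
  assert (Hz : dchar p g m j p = 0%C) by (apply dchar_zero, Nat.Div0.mod_same).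
  (* The last term of the period, at [n = p], vanishes; listing the others as powers of [g] turns
     the sum into one over equally spaced angles. *)
  assert (Hred : forall F : C -> R, F 0%C = 0 ->
     lsum (seq 0 p) (fun n => F (dchar p g m j (S n))) = lsum (seq 0 (p - 1)) (fun i => F (cis (phase m j i)))).
  { intros F HF. rewrite <- (lsum_map S (seq 0 p) (fun n => F (dchar p g m j n))), seq_shift.
    replace p with (S (p - 1)) at 1 by lia. rewrite lsum_seq_S.
    replace (1 + (p - 1))%nat with p by lia. rewrite Hz, HF, Rplus_0_r.
    rewrite (lsum_perm _ _ _ (primitive_root_perm p g Hp Hg)), lsum_map. apply lsum_ext. intros i _. f_equal.
    apply dchar_pow; try assumption. symmetry. apply Nat.Div0.mod_mod. }
  destruct Hd as [c Hc].
  assert (Hphi : forall i, phase m j i = INR i * (2 * PI * INR j / INR m)) by (intros; unfold phase; field; lra).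
  destruct (trig_sums_zero (2 * PI * INR j / INR m) (p - 1) (c * j)) as [T1 T2].
  - rewrite Hc, !mult_INR. field. lra.
  - apply sin_rational_nonzero; [exact Hm|]. rewrite Nat.mod_small; lia.
  - split.
    + rewrite (Hred fst eq_refl), <- T1. apply lsum_ext. intros i _. simpl. rewrite Hphi. reflexivity.
    + rewrite (Hred snd eq_refl), <- T2. apply lsum_ext. intros i _. simpl. rewrite Hphi. reflexivity.
Qed.

(** Abel summation: the inner part contributes [B (1/(N+1) - 1/(M+1))] and the boundary terms
    [B/(M+1) + B/(N+1)], which add up to [2 B / (N+1)]. *)
Lemma abel_bound (f : nat -> R) (B : R) : (forall M, Rabs (lsum (seq 0 M) f) <= B) ->
  forall N M, (N <= M)%nat ->
  Rabs (lsum (seq 0 M) (fun n => f n / INR (S n)) - lsum (seq 0 N) (fun n => f n / INR (S n)))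
    <= 2 * B / INR (S N).
Proof.
  intros HB N M HNM.
  set (F := fun M => lsum (seq 0 M) f). set (G := fun M => lsum (seq 0 M) (fun n => f n / INR (S n))).
  assert (HP : forall n, 0 < INR (S n)) by (intros; apply INR_gt0; lia).
  (* Without its boundary term the sum grows by [F (M+1) (1/(M+1) - 1/(M+2))] at each step, with a
     nonnegative telescoping coefficient. *)
  assert (Hind : Rabs ((G M - F M / INR (S M)) - (G N - F N / INR (S N))) <= B * (/ INR (S N) - / INR (S M))).
  { induction HNM as [|M HNM IH].
    - replace (_ - _) with 0 by ring. rewrite Rabs_R0. right; ring.
    - replace (G (S M) - F (S M) / INR (S (S M)) - (G N - F N / INR (S N))) with
        ((G M - F M / INR (S M) - (G N - F N / INR (S N))) + F (S M) * (/ INR (S M) - / INR (S (S M)))).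
      + eapply Rle_trans; [apply Rabs_triang|].
        assert (Hd : 0 <= / INR (S M) - / INR (S (S M))).
        { pose proof (Rinv_le_contravar (INR (S M)) (INR (S (S M))) (HP M) ltac:(apply le_INR; lia)). lra. }
        rewrite Rabs_mult, (Rabs_pos_eq _ Hd). pose proof (HB (S M)) as HBS. fold (F (S M)) in HBS.
        pose proof (Rmult_le_compat_r _ _ _ Hd HBS). lra.
      + unfold G, F. rewrite !lsum_seq_S. simpl (0 + M)%nat. pose proof (HP M). pose proof (HP (S M)). pose proof (HP N).
        unfold Rdiv. ring. }
  pose proof (HB N) as BN. pose proof (HB M) as BM. fold (F N) in BN. fold (F M) in BM.
  fold (G M) (G N).
  assert (B1 : Rabs (F M / INR (S M)) <= B * / INR (S M)).
  { unfold Rdiv. rewrite Rabs_mult, Rabs_inv, (Rabs_pos_eq (INR (S M))) by (left; apply HP).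
    apply Rmult_le_compat_r; [left; apply Rinv_0_lt_compat, HP|exact BM]. }
  assert (B2 : Rabs (F N / INR (S N)) <= B * / INR (S N)).
  { unfold Rdiv. rewrite Rabs_mult, Rabs_inv, (Rabs_pos_eq (INR (S N))) by (left; apply HP).
    apply Rmult_le_compat_r; [left; apply Rinv_0_lt_compat, HP|exact BN]. }
  unfold Rdiv. rewrite Rmult_assoc. apply Rabs_le_between in Hind.
  apply Rabs_le_between in B1. apply Rabs_le_between in B2. apply Rabs_le_between.
  lra.
Qed.

Lemma sum_n_lsum (a : nat -> R) (n : nat) : sum_n a n = lsum (seq 0 (S n)) a.
Proof.
  induction n as [|n IH].
  - rewrite sum_O. unfold lsum; simpl. ring.
  - rewrite sum_Sn, IH, (lsum_seq_S 0 (S n)). reflexivity.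
Qed.

Lemma Series_tail_bound (f : nat -> R) (B : R) (N : nat) : (forall M, Rabs (lsum (seq 0 M) f) <= B) ->
  Rabs (Series (fun n => f n / INR (S n)) - lsum (seq 0 N) (fun n => f n / INR (S n))) <= 2 * B / INR (S N).
Proof.
  intros HB. set (a := fun n => f n / INR (S n)).
  pose proof (abel_bound f B HB) as HA. fold a in HA.
  assert (HB0 : 0 <= B) by (eapply Rle_trans; [apply Rabs_pos|apply (HB 0%nat)]).
  assert (Hex : ex_finite_lim_seq (sum_n a)).
  { apply ex_lim_seq_cauchy_corr. intros eps.
    destruct (INR_unbounded (4 * B / eps)) as [N0 HN0]. exists N0.
    assert (Hs : forall n, (N0 <= n)%nat -> Rabs (lsum (seq 0 (S n)) a - lsum (seq 0 N0) a) < eps / 2).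
    { intros n Hn. eapply Rle_lt_trans; [apply HA; lia|].
      assert (HS : 0 < INR (S N0)) by (apply INR_gt0; lia). pose proof (cond_pos eps) as He.
      apply (Rmult_lt_reg_r (INR (S N0))); [exact HS|].
      replace (2 * B / INR (S N0) * INR (S N0)) with (2 * B) by (field; apply Rgt_not_eq, HS).
      assert (4 * B < INR (S N0) * eps).
      { rewrite S_INR. apply (Rmult_lt_reg_r (/ eps)); [apply Rinv_0_lt_compat, He|].
        replace ((INR N0 + 1) * eps * / eps) with (INR N0 + 1) by (field; lra). unfold Rdiv in HN0; lra. }
      lra. }
    intros n n' Hn Hn'. rewrite !sum_n_lsum. pose proof (Hs n Hn) as H1. pose proof (Hs n' Hn') as H2.
    apply Rabs_def2 in H1. apply Rabs_def2 in H2. apply Rabs_def1; lra. }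
  destruct Hex as [l Hl]. unfold Series. rewrite (is_lim_seq_unique _ _ Hl). simpl real.
  apply (is_lim_seq_le_loc (fun n => Rabs (sum_n a n - lsum (seq 0 N) a)) (fun _ => 2 * B / INR (S N))
    (Rabs (l - lsum (seq 0 N) a)) (2 * B / INR (S N))).
  - exists N. intros n Hn. rewrite sum_n_lsum. apply HA. lia.
  - apply (is_lim_seq_abs _ (Finite (l - lsum (seq 0 N) a))).
    apply (is_lim_seq_minus' _ _ l (lsum (seq 0 N) a)); [exact Hl|apply is_lim_seq_const].
  - apply is_lim_seq_const.
Qed.

(** Taken componentwise to match the shape of [L1]. *)
Definition csum {A : Type} (l : list A) (f : A -> C) : C := (lsum l (fun x => fst (f x)), lsum l (fun x => snd (f x))).

Definition twist (chi : nat -> C) (n : nat) : C := (fst (chi n) / INR n, snd (chi n) / INR n).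

Lemma twist_mul (chi : nat -> C) (a b : nat) : chi (a * b)%nat = (chi a * chi b)%C ->
  twist chi (a * b) = (twist chi a * twist chi b)%C.
Proof.
  intros H. unfold twist. rewrite H, mult_INR. unfold Cmult, Rdiv. simpl. rewrite Rinv_mult. f_equal; ring.
Qed.

Lemma lsum_seq_shift (n : nat) (f : nat -> R) : lsum (seq 0 n) (fun i => f (S i)) = lsum (seq 1 n) f.
Proof. rewrite <- seq_shift, lsum_map. reflexivity. Qed.

Lemma dchar_le1 (p g m j n : nat) : Rabs (fst (dchar p g m j n)) <= 1 /\ Rabs (snd (dchar p g m j n)) <= 1.
Proof.
  unfold dchar. destruct (Nat.eq_dec (n mod p) 0); simpl; [rewrite Rabs_R0; lra|].
  split; apply Rabs_le; [apply COS_bound|apply SIN_bound].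
Qed.

Lemma Cmod_le_abs (z : C) : Cmod z <= Rabs (fst z) + Rabs (snd z).
Proof.
  destruct z as [x y]. simpl. unfold Cmod. simpl. rewrite !Rmult_1_r.
  pose proof (Rabs_pos x). pose proof (Rabs_pos y).
  rewrite <- (sqrt_Rsqr (Rabs x + Rabs y)) by lra. apply sqrt_le_1_alt. unfold Rsqr.
  assert (x * x = Rabs x * Rabs x) by (rewrite <- Rabs_mult, Rabs_pos_eq; nra).
  assert (y * y = Rabs y * Rabs y) by (rewrite <- Rabs_mult, Rabs_pos_eq; nra). nra.
Qed.

(** The trivial bound [p] for character sums suffices at the length [p^2]: each component has a tail
    of at most [2 p / (p^2 + 1)]. *)
Lemma L1_truncation (p g m j : nat) : prime (Z.of_nat p) -> is_primitive_root p g ->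
  (1 <= m)%nat -> Nat.divide m (p - 1) -> (0 < j < m)%nat ->
  Cmod (L1 (dchar p g m j) - csum (seq 1 (p ^ 2)) (twist (dchar p g m j))) <= 4 / INR p.
Proof.
  intros Hp Hg Hm Hd Hj. assert (Hp1 : (1 < p)%nat) by (destruct Hp; lia).
  pose proof (INR_gt0 p ltac:(lia)) as Hp0.
  destruct (dchar_period_sum p g m j Hp Hg Hm Hd Hj) as [Z1 Z2].
  assert (Hper : forall n, dchar p g m j (S (n + p)) = dchar p g m j (S n)).
  { intros n. apply dchar_mod_eq; try assumption. change (S (n + p)) with (S n + p)%nat.
    rewrite <- (Nat.mul_1_l p) at 1. apply Nat.Div0.mod_add. }
  assert (Hb : 2 * INR p / INR (S (p ^ 2)) <= 2 / INR p).
  { assert (HS : 0 < INR (S (p ^ 2))) by (apply INR_gt0; lia).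
    apply (Rmult_le_reg_r (INR (S (p ^ 2)) * INR p)); [nra|].
    replace (2 * INR p / INR (S (p ^ 2)) * (INR (S (p ^ 2)) * INR p)) with (2 * (INR p * INR p)) by (field; lra).
    replace (2 / INR p * (INR (S (p ^ 2)) * INR p)) with (2 * INR (S (p ^ 2))) by (field; lra).
    rewrite S_INR, pow_INR. simpl. nra. }
  pose proof (Series_tail_bound (fun n => fst (dchar p g m j (S n))) (INR p) (p ^ 2)
    (periodic_sum_bound _ p ltac:(lia) (fun n => f_equal fst (Hper n)) (fun n => proj1 (dchar_le1 p g m j (S n))) Z1)) as B1.
  pose proof (Series_tail_bound (fun n => snd (dchar p g m j (S n))) (INR p) (p ^ 2)
    (periodic_sum_bound _ p ltac:(lia) (fun n => f_equal snd (Hper n)) (fun n => proj2 (dchar_le1 p g m j (S n))) Z2)) as B2.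
  eapply Rle_trans; [apply Cmod_le_abs|].
  cbv beta in B1, B2.
  rewrite (lsum_seq_shift (p ^ 2) (fun n => fst (dchar p g m j n) / INR n)) in B1.
  rewrite (lsum_seq_shift (p ^ 2) (fun n => snd (dchar p g m j n) / INR n)) in B2.
  replace (4 / INR p) with (2 / INR p + 2 / INR p) by (field; lra).
  exact (Rplus_le_compat _ _ _ _ (Rle_trans _ _ _ B1 Hb) (Rle_trans _ _ _ B2 Hb)).
Qed.

(** * Expansion of the powers of the truncated sums *)

Lemma csum_tuples (c : nat -> C) (k N : nat) :
  c 1%nat = 1%C -> (forall a b, c (a * b)%nat = (c a * c b)%C) ->
  (csum (seq 1 N) c ^ k)%C = csum (tuples k N) (fun l => c (lprod l)).
Proof.
  intros H1 Hmul. induction k as [|k IH].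
  - unfold csum, lsum. simpl. rewrite H1. simpl. unfold RtoC. f_equal; ring.
  - rewrite Cpow_S, IH. simpl tuples. unfold csum, Cmult. simpl. f_equal.
    + rewrite !lsum_mul, <- lsum_minus, lsum_flat_map. apply lsum_ext. intros i _.
      rewrite lsum_map, <- lsum_minus. apply lsum_ext. intros l _. simpl. rewrite Hmul. reflexivity.
    + rewrite !lsum_mul, <- lsum_plus, lsum_flat_map. apply lsum_ext. intros i _.
      rewrite lsum_map, <- lsum_plus. apply lsum_ext. intros l _. simpl. rewrite Hmul. simpl. ring.
Qed.

Lemma Cmod_sqr_eq (z : C) : Cmod z ^ 2 = fst z * fst z + snd z * snd z.
Proof.
  unfold Cmod. rewrite <- Rsqr_pow2, Rsqr_sqrt; simpl; nra.
Qed.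

Lemma Cmod_csum_expansion (chi : nat -> C) (k N : nat) :
  chi 1%nat = 1%C -> (forall a b, chi (a * b)%nat = (chi a * chi b)%C) ->
  Cmod (csum (seq 1 N) (twist chi)) ^ (2 * k) =
  lsum (seq 1 (N ^ k)) (fun a => lsum (seq 1 (N ^ k)) (fun b =>
    INR (tcount k N a) * INR (tcount k N b) / (INR a * INR b) * Kform chi a b)).
Proof.
  intros H1 Hmul. rewrite Nat.mul_comm, pow_mult, <- Cmod_pow, csum_tuples.
  - rewrite Cmod_sqr_eq. unfold csum. simpl fst; simpl snd.
    rewrite (lsum_tuples k N (fun n => fst (chi n) / INR n)), (lsum_tuples k N (fun n => snd (chi n) / INR n)).
    rewrite !lsum_mul, <- lsum_plus. apply lsum_ext. intros a _. rewrite <- lsum_plus. apply lsum_ext. intros b _.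
    unfold Kform, Rdiv. rewrite Rinv_mult. ring.
  - unfold twist. rewrite H1. simpl. unfold RtoC, Rdiv. simpl. f_equal; field.
  - intros a b. apply twist_mul, Hmul.
Qed.

(** * Moments *)

Lemma Series_between (f : nat -> R) (n0 : nat) (B : R) : (forall n, 0 <= f n) ->
  (forall M, (n0 <= M)%nat -> lsum (seq 0 M) f <= B) ->
  lsum (seq 0 n0) f <= Series f <= B.
Proof.
  intros Hf HB.
  assert (Hincr : forall n M, (n <= M)%nat -> lsum (seq 0 n) f <= lsum (seq 0 M) f).
  { intros n M H. induction H as [|M H IH]; [lra|]. rewrite lsum_seq_S. pose proof (Hf (0 + M)%nat). lra. }
  assert (Hub : forall n, sum_n f n <= B).
  { intros n. rewrite sum_n_lsum. eapply Rle_trans; [apply (Hincr (S n) (n0 + S n)%nat); lia|]. apply HB. lia. }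
  assert (Hex : ex_finite_lim_seq (sum_n f)).
  { apply (ex_finite_lim_seq_incr _ B); [|exact Hub]. intros n. rewrite !sum_n_lsum. apply Hincr. lia. }
  destruct Hex as [l Hl]. unfold Series. rewrite (is_lim_seq_unique _ _ Hl). simpl real. split.
  - apply (is_lim_seq_le_loc (fun _ => lsum (seq 0 n0) f) (sum_n f) (lsum (seq 0 n0) f) l); [|apply is_lim_seq_const|exact Hl].
    exists n0. intros n Hn. rewrite sum_n_lsum. apply Hincr. lia.
  - apply (is_lim_seq_le (sum_n f) (fun _ => B) l B); [exact Hub|exact Hl|apply is_lim_seq_const].
Qed.

(** For [p - 1 = 2 h d], divisibility of the index by [h] says that [a / b] lies in the subgroup of
    order [2 d], which is [{1, -1} G_m] for [m = 2 h] and [d] odd. *)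
Definition off_diag (p g h : nat) (u : nat * nat) : bool :=
  (negb (Nat.eqb (fst u) (snd u)) && is_unit p (fst u) && is_unit p (snd u) &&
   Nat.eqb (dlog_diff p g (fst u) (snd u) mod h) 0)%bool.

Lemma is_unit_spec (p a : nat) : is_unit p a = true <-> (a mod p <> 0)%nat.
Proof. unfold is_unit. destruct (Nat.eqb_spec (a mod p) 0); simpl; intuition discriminate. Qed.

Lemma off_diag_spec (p g h a b : nat) : off_diag p g h (a, b) = true <->
  a <> b /\ (a mod p <> 0)%nat /\ (b mod p <> 0)%nat /\ (dlog_diff p g a b mod h = 0)%nat.
Proof.
  unfold off_diag. simpl fst; simpl snd.
  rewrite !Bool.andb_true_iff, !is_unit_spec, Bool.negb_true_iff, Nat.eqb_neq, Nat.eqb_eq. tauto.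
Qed.

Lemma off_diag_power (p g h d a b : nat) : prime (Z.of_nat p) -> is_primitive_root p g ->
  (p - 1 = 2 * h * d)%nat -> (1 <= h)%nat -> off_diag p g h (a, b) = true ->
  ((a ^ (2 * d)) mod p = (b ^ (2 * d)) mod p)%nat.
Proof.
  intros Hp Hg Hd Hh H. apply off_diag_spec in H. destruct H as [_ [Ha [Hb Hx]]].
  assert (Hp1 : (1 < p)%nat) by (destruct Hp; lia).
  destruct (dlog_spec p g a Hg Ha) as [La Ea]. destruct (dlog_spec p g b Hg Hb) as [Lb Eb].
  unfold dlog_diff in Hx. set (A := dlog p g a) in *. set (B := dlog p g b) in *.
  transitivity ((g ^ (A * (2 * d))) mod p)%nat.
  { rewrite (Nat.pow_mul_r g A). apply mod_pow_eq. symmetry. exact Ea. }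
  transitivity ((g ^ (B * (2 * d))) mod p)%nat.
  2: { rewrite (Nat.pow_mul_r g B). apply mod_pow_eq. exact Eb. }
  apply primitive_root_pow_eq; [assumption|assumption|].
  apply Nat.Lcm0.mod_divide in Hx. destruct Hx as [c Hc].
  (* From [A + (p - 1) - B = c h] and [p - 1 = 2 h d] one gets [A - B = h (c - 2 d)]; multiplying by
     [2 d] produces the factor [p - 1]. *)
  apply mod_eq_of_Zdivide; [lia|]. exists (Z.of_nat c - 2 * Z.of_nat d)%Z.
  assert (E : (Z.of_nat A - Z.of_nat B = Z.of_nat h * (Z.of_nat c - 2 * Z.of_nat d))%Z) by nia.
  rewrite !Nat2Z.inj_mul. replace (Z.of_nat (p - 1)) with (2 * Z.of_nat h * Z.of_nat d)%Z by nia.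
  transitivity ((Z.of_nat A - Z.of_nat B) * (2 * Z.of_nat d))%Z; [lia|]. rewrite E. ring.
Qed.

(** The gcd is a unit modulo [p], so its power cancels. The lower bound available for
    non-exceptional primes thus applies to the primitive pair, where [lattice_sum] asks for it. *)
Lemma off_diag_reduced (p g h d a b : nat) : prime (Z.of_nat p) -> is_primitive_root p g ->
  (p - 1 = 2 * h * d)%nat -> (1 <= h)%nat -> (1 <= a)%nat -> (1 <= b)%nat -> off_diag p g h (a, b) = true ->
  let j := Nat.gcd a b in
  (1 <= a / j)%nat /\ (1 <= b / j)%nat /\ (a / j <> b / j)%nat /\
  (((a / j) ^ (2 * d)) mod p = ((b / j) ^ (2 * d)) mod p)%nat.
Proof.
  intros Hp Hg Hd Hh Ha Hb H j.
  pose proof (off_diag_power p g h d a b Hp Hg Hd Hh H) as HE.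
  apply off_diag_spec in H. destruct H as [Hne [Hua _]].
  destruct (reduced_pair a b Ha Hb) as [J1 [Ea [Eb [A1 [B1 _]]]]]. fold j in J1, Ea, Eb, A1, B1.
  repeat split; try assumption.
  - intros E. apply Hne. rewrite Ea, Eb, E. reflexivity.
  - rewrite Ea, Eb, !Nat.pow_mul_l in HE. apply mod_mul_cancel_l in HE; [exact HE|exact Hp|].
    apply mod_pow_nonzero; [exact Hp|]. intros E. apply Hua. rewrite Ea. apply mod_mul_zero. tauto.
Qed.

(** For off-diagonal pairs the reduced index is a multiple of [h] below [2 h d]; its quotient by [h]
    numbers the [2 d] possible ratios [a / b]. *)
Definition diff_class (p g h : nat) (u : nat * nat) : nat :=
  ((dlog_diff p g (fst u) (snd u) mod (p - 1)) / h)%nat.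

Lemma diff_class_cross (p g h d : nat) (u v : nat * nat) : prime (Z.of_nat p) -> is_primitive_root p g ->
  (p - 1 = 2 * h * d)%nat -> (1 <= h)%nat -> off_diag p g h u = true -> off_diag p g h v = true ->
  diff_class p g h u = diff_class p g h v ->
  ((fst u * snd v) mod p = (fst v * snd u) mod p)%nat.
Proof.
  destruct u as [a b], v as [a' b']. intros Hp Hg Hd Hh Hu Hv HE. simpl fst; simpl snd.
  assert (Hp1 : (1 < p)%nat) by (destruct Hp; lia).
  apply off_diag_spec in Hu. destruct Hu as [_ [Ha [Hb Hx]]].
  apply off_diag_spec in Hv. destruct Hv as [_ [Ha' [Hb' Hx']]].
  unfold diff_class in HE. simpl fst in HE; simpl snd in HE.
  assert (Hdiv : forall x, (x mod h = 0)%nat -> (x mod (p - 1) = h * ((x mod (p - 1)) / h))%nat).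
  { intros x Hx0. apply Nat.div_exact; [lia|].
    transitivity (x mod h)%nat; [|exact Hx0]. apply (mod_eq_divisor h (p - 1)); [exists (2 * d)%nat; lia|]. apply Nat.Div0.mod_mod. }
  assert (E : (dlog_diff p g a b mod (p - 1) = dlog_diff p g a' b' mod (p - 1))%nat).
  { rewrite (Hdiv _ Hx), (Hdiv _ Hx'), HE. reflexivity. }
  destruct (dlog_spec p g a Hg Ha) as [La Ea]. destruct (dlog_spec p g b Hg Hb) as [Lb Eb].
  destruct (dlog_spec p g a' Hg Ha') as [La' Ea']. destruct (dlog_spec p g b' Hg Hb') as [Lb' Eb'].
  unfold dlog_diff in E.
  rewrite <- (mod_mul_eq p _ _ _ _ Ea Eb'), <- (mod_mul_eq p _ _ _ _ Ea' Eb), <- !Nat.pow_add_r.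
  apply primitive_root_pow_eq; [assumption|assumption|].
  apply mod_eq_of_Zdivide; [lia|]. apply Zdivide_of_mod_eq in E. destruct E as [c Hc]. exists c. nia.
Qed.

Lemma off_diagonal_sum (delta : R) : 0 < delta <= / 4 -> exists C1, 0 < C1 /\
  forall (p g h d W : nat) (Rr : R), prime (Z.of_nat p) -> is_primitive_root p g ->
  (p - 1 = 2 * h * d)%nat -> (1 <= h)%nat -> (1 <= W)%nat -> 1 <= Rr ->
  (forall a b, (1 <= a)%nat -> (1 <= b)%nat -> a <> b ->
     ((a ^ (2 * d)) mod p = (b ^ (2 * d)) mod p)%nat -> Rr < INR (a * b)) ->
  lsum (filter (off_diag p g h) (list_prod (seq 1 W) (seq 1 W)))
    (fun u => Rpower (INR (fst u * snd u)) (-1 + delta)) <=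
  C1 * INR d * (Rpower Rr (-1 + 2 * delta) + Rpower (INR W) (2 * delta) / INR p).
Proof.
  intros Hdelta. destruct (lattice_sum delta Hdelta) as [C1 [HC1 HL]].
  exists (2 * C1). split; [lra|].
  intros p g h d W Rr Hp Hg Hd Hh HW HR Hnon.
  replace (2 * C1 * INR d) with (C1 * INR (2 * d)) by (rewrite mult_INR; simpl; ring).
  assert (Hp1 : (1 < p)%nat) by (destruct Hp; lia).
  apply (HL p W (2 * d)%nat Rr _ (diff_class p g h)); try assumption.
  - apply NoDup_filter, NoDup_list_prod; apply seq_NoDup.
  - intros [a b] Hu. apply filter_In in Hu. destruct Hu as [Hin Ho].
    apply in_prod_iff in Hin. rewrite !in_seq in Hin. simpl fst; simpl snd.
    split; [lia|]. split; [lia|]. split; [apply off_diag_spec in Ho; tauto|]. split.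
    + unfold diff_class. apply Nat.Div0.div_lt_upper_bound.
      pose proof (Nat.mod_upper_bound (dlog_diff p g (fst (a, b)) (snd (a, b))) (p - 1) ltac:(lia)). nia.
    + destruct (off_diag_reduced p g h d a b Hp Hg Hd Hh ltac:(lia) ltac:(lia) Ho) as [A1 [B1 [N1 E1]]].
      apply Hnon; assumption.
  - intros u v Hu Hv E. apply filter_In in Hu. apply filter_In in Hv.
    apply (diff_class_cross p g h d); tauto.
Qed.

Lemma tau_weight_bound (k : nat) (delta : R) : 0 < delta <= / 4 -> exists C1, 0 < C1 /\
  (forall N n, (1 <= n)%nat -> INR (tcount k N n) <= C1 * Rpower (INR n) delta) /\
  (forall N n, (1 <= n)%nat -> 0 <= INR (tcount k N n) ^ 2 / INR n ^ 2 <= C1 * C1 * Rpower (INR n) (- (3 / 2))).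
Proof.
  intros Hd. destruct (tcount_bound k delta ltac:(lra)) as [C1 [HC1 H]].
  exists C1. split; [exact HC1|]. split; [exact H|]. intros N n Hn.
  pose proof (INR_gt0 n Hn) as Hn0. pose proof (pos_INR (tcount k N n)) as Ht. pose proof (H N n Hn) as HB.
  split.
  - apply Rmult_le_pos; [nra|]. left. apply Rinv_0_lt_compat. nra.
  - set (r := Rpower (INR n) delta) in *. assert (Hr : 0 < r) by apply Rpower_pos.
    apply (Rmult_le_reg_r (INR n ^ 2)); [nra|].
    replace (INR (tcount k N n) ^ 2 / INR n ^ 2 * INR n ^ 2) with (INR (tcount k N n) ^ 2) by (field; lra).
    apply Rle_trans with (C1 * C1 * (r * r)).
    + assert (INR (tcount k N n) * INR (tcount k N n) <= (C1 * r) * (C1 * r)) by (apply Rmult_le_compat; lra). nra.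
    + rewrite (Rmult_assoc (C1 * C1)). apply Rmult_le_compat_l; [nra|].
      rewrite <- (Rpower_pow 2) by exact Hn0. unfold r. rewrite <- !Rpower_plus.
      apply Rle_Rpower; [apply INR_ge1, Hn|]. simpl. lra.
Qed.

Lemma three_halves_tail_from (p n : nat) : (2 <= p)%nat ->
  lsum (seq p n) (fun j => Rpower (INR j) (- (3 / 2))) <= 4 * Rpower (INR p) (- / 2).
Proof.
  intros Hp. replace p with (S (p - 1)) at 1 by lia.
  eapply Rle_trans; [apply three_halves_sum_tail; lia|].
  pose proof (Rpower_pos (INR (p - 1 + n)) (- / 2)).
  assert (Rpower (INR (p - 1)) (- / 2) <= 2 * Rpower (INR p) (- / 2)); [|lra].
  pose proof (INR_gt0 (p - 1) ltac:(lia)) as H1. pose proof (INR_gt0 p ltac:(lia)) as H2.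
  apply Rle_trans with (Rpower (INR p / 4) (- / 2)).
  - apply Rpower_anti; [lra|lra|].
    assert (INR p <= 2 * INR (p - 1)) by (rewrite <- (mult_INR 2); apply le_INR; lia). lra.
  - unfold Rdiv. rewrite <- Rpower_mult_distr by lra. rewrite Rmult_comm. apply Rmult_le_compat_r; [left; apply Rpower_pos|].
    rewrite Rpower_Ropp, Rpower_sqrt by lra.
    replace (/ 4) with (/ 2 * / 2) by field. rewrite sqrt_square by lra. lra.
Qed.

(** For [a < p] the terms are exactly those of [a(k)], since then [a <= N] and [e a = 1]. From [p]
    on, both the finite sum and the series are bounded by the tail of [a^(-3/2)]; the two tails give
    8 = 4 + 4. *)
Lemma diagonal_sum (k : nat) (delta : R) : 0 < delta <= / 4 -> exists C1, 0 < C1 /\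
  forall (p N W : nat) (e : nat -> R), (2 <= p)%nat -> (p <= N)%nat -> (p <= W)%nat ->
  (forall a, Rabs (e a) <= 1) -> (forall a, (1 <= a < p)%nat -> e a = 1) ->
  Rabs (lsum (seq 1 W) (fun a => INR (tcount k N a) ^ 2 / INR a ^ 2 * e a) - a_const k)
    <= C1 * Rpower (INR p) (- / 2).
Proof.
  intros Hd. destruct (tau_weight_bound k delta Hd) as [C1 [HC1 [_ HB]]].
  exists (8 * (C1 * C1)). split; [nra|].
  intros p N W e Hp HN HW He1 He2.
  set (P := Rpower (INR p) (- / 2)).
  set (f := fun n => INR (tau k (S n)) ^ 2 / INR (S n) ^ 2).
  set (main := lsum (seq 0 (p - 1)) f).
  assert (Hf : forall n, 0 <= f n <= C1 * C1 * Rpower (INR (S n)) (- (3 / 2))).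
  { intros n. unfold f. rewrite <- (tcount_tau k (S n) (S n)) by lia. apply HB. lia. }
  assert (HT : forall n, lsum (seq p n) (fun j => C1 * C1 * Rpower (INR j) (- (3 / 2))) <= 4 * (C1 * C1) * P).
  { intros n. rewrite lsum_scal. pose proof (three_halves_tail_from p n Hp) as H. fold P in H.
    assert (0 <= C1 * C1) by nra. pose proof (Rmult_le_compat_l (C1 * C1) _ _ ltac:(assumption) H). lra. }
  assert (HS : main <= a_const k <= main + 4 * (C1 * C1) * P).
  { change (a_const k) with (Series f). apply Series_between; [intros; apply Hf|].
    intros M HM. replace M with (p - 1 + (M - (p - 1)))%nat by lia. rewrite seq_app, lsum_app. fold main.
    apply Rplus_le_compat_l. eapply Rle_trans; [|apply (HT (M - (p - 1))%nat)].
    replace (seq p (M - (p - 1))) with (map S (seq (p - 1) (M - (p - 1)))) by (rewrite seq_shift; f_equal; lia).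
    rewrite lsum_map. apply lsum_le. intros n _. apply Hf. }
  assert (HD : Rabs (lsum (seq 1 W) (fun a => INR (tcount k N a) ^ 2 / INR a ^ 2 * e a) - main) <= 4 * (C1 * C1) * P).
  { replace W with (p - 1 + (W - (p - 1)))%nat by lia. rewrite seq_app, lsum_app.
    assert (E : lsum (seq 1 (p - 1)) (fun a => INR (tcount k N a) ^ 2 / INR a ^ 2 * e a) = main).
    { unfold main. rewrite <- seq_shift, lsum_map. apply lsum_ext. intros n Hn. apply in_seq in Hn.
      rewrite He2, tcount_tau by lia. unfold f. ring. }
    rewrite E. replace (1 + (p - 1))%nat with p by lia. replace (main + _ - main) with
      (lsum (seq p (W - (p - 1))) (fun a => INR (tcount k N a) ^ 2 / INR a ^ 2 * e a)) by ring.
    eapply Rle_trans; [apply lsum_Rabs|]. eapply Rle_trans; [|apply (HT (W - (p - 1))%nat)].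
    apply lsum_le. intros a Ha. apply in_seq in Ha. pose proof (HB N a ltac:(lia)) as H.
    rewrite Rabs_mult, (Rabs_pos_eq (_ / _)) by lra. pose proof (He1 a). pose proof (Rabs_pos (e a)). nra. }
  apply Rabs_le_between in HD. apply Rabs_le_between. lra.
Qed.

(** The weight [e] will be the indicator of [a / b] in [G_m] for the full mean, and that indicator
    minus the one of [-G_m] for the odd mean. *)
Lemma weighted_double_sum (k : nat) (delta : R) : 0 < delta <= / 4 -> (1 <= k)%nat ->
  4 * INR k * delta <= / 2 -> exists C1, 0 < C1 /\
  forall (p g h d : nat) (Rr : R) (e : nat -> nat -> R), prime (Z.of_nat p) -> is_primitive_root p g ->
  (p - 1 = 2 * h * d)%nat -> (1 <= h)%nat -> 1 <= Rr ->
  (forall a b, (1 <= a)%nat -> (1 <= b)%nat -> a <> b ->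
     ((a ^ (2 * d)) mod p = (b ^ (2 * d)) mod p)%nat -> Rr < INR (a * b)) ->
  (forall a b, Rabs (e a b) <= 1) -> (forall a, (a mod p <> 0)%nat -> e a a = 1) ->
  (forall a b, a <> b -> e a b <> 0 -> off_diag p g h (a, b) = true) ->
  Rabs (lsum (seq 1 ((p ^ 2) ^ k)) (fun a => lsum (seq 1 ((p ^ 2) ^ k)) (fun b =>
      INR (tcount k (p ^ 2) a) * INR (tcount k (p ^ 2) b) / (INR a * INR b) * e a b)) - a_const k)
    <= C1 * INR d * (Rpower Rr (-1 + 2 * delta) + Rpower (INR p) (- / 2)).
Proof.
  intros Hdelta Hk Hkd.
  destruct (off_diagonal_sum delta Hdelta) as [Co [HCo HO]].
  destruct (diagonal_sum k delta Hdelta) as [Cd [HCd HDg]].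
  destruct (tau_weight_bound k delta Hdelta) as [Ct [HCt [HT _]]].
  exists (Ct * Ct * Co + Cd). split; [nra|].
  intros p g h d Rr e Hp Hg Hd Hh HR Hnon He1 He2 He3.
  assert (Hp1 : (1 < p)%nat) by (destruct Hp; lia).
  pose proof (INR_gt0 p ltac:(lia)) as Hp0.
  assert (Hd1 : (1 <= d)%nat) by nia.
  set (N := (p ^ 2)%nat). set (W := (N ^ k)%nat).
  assert (HN : (p <= N)%nat) by (unfold N; simpl; nia).
  assert (HW : (p <= W)%nat).
  { unfold W. replace k with (S (k - 1)) by lia. simpl. pose proof (Nat.pow_nonzero N (k - 1) ltac:(lia)). nia. }
  set (T := fun a => INR (tcount k N a)). fold (T : nat -> R).
  set (P := Rpower (INR p) (- / 2)). assert (HP : 0 < P) by apply Rpower_pos.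
  set (F := fun a b => T a * T b / (INR a * INR b) * e a b).
  assert (Hsplit : lsum (seq 1 W) (fun a => lsum (seq 1 W) (fun b => F a b)) =
     lsum (seq 1 W) (fun a => T a ^ 2 / INR a ^ 2 * e a a) +
     lsum (seq 1 W) (fun a => lsum (seq 1 W) (fun b => if Nat.eq_dec a b then 0 else F a b))).
  { rewrite <- lsum_plus. apply lsum_ext. intros a Ha.
    rewrite <- (lsum_single Nat.eq_dec (seq 1 W) a (T a ^ 2 / INR a ^ 2 * e a a)) by (apply seq_NoDup || assumption).
    rewrite <- lsum_plus. apply lsum_ext. intros b Hb. destruct (Nat.eq_dec a b) as [<-|]; [|ring].
    unfold F. apply in_seq in Ha. pose proof (INR_gt0 a ltac:(lia)). field. lra. }
  assert (Hdiag : Rabs (lsum (seq 1 W) (fun a => T a ^ 2 / INR a ^ 2 * e a a) - a_const k) <= Cd * P).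
  { apply (HDg p N W (fun a => e a a)); try assumption; try lia.
    - intros a; apply He1.
    - intros a Ha. apply He2. rewrite Nat.mod_small; lia. }
  assert (Hoff : Rabs (lsum (seq 1 W) (fun a => lsum (seq 1 W) (fun b => if Nat.eq_dec a b then 0 else F a b))) <=
     Ct * Ct * (Co * INR d * (Rpower Rr (-1 + 2 * delta) + P))).
  { replace (lsum _ _) with (lsum (list_prod (seq 1 W) (seq 1 W))
      (fun u => if Nat.eq_dec (fst u) (snd u) then 0 else F (fst u) (snd u))) by apply lsum_list_prod.
    eapply Rle_trans; [apply lsum_Rabs|].
    apply Rle_trans with (lsum (list_prod (seq 1 W) (seq 1 W)) (fun u => if off_diag p g h u
       then Ct * Ct * Rpower (INR (fst u * snd u)) (-1 + delta) else 0)).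
    - apply lsum_le. intros [a b] Hu. apply in_prod_iff in Hu. rewrite !in_seq in Hu. simpl fst; simpl snd.
      pose proof (INR_gt0 a ltac:(lia)) as Ha0. pose proof (INR_gt0 b ltac:(lia)) as Hb0.
      assert (Hpos : 0 <= Ct * Ct * Rpower (INR (a * b)) (-1 + delta)).
      { apply Rmult_le_pos; [nra|left; apply Rpower_pos]. }
      destruct (Nat.eq_dec a b) as [E|E].
      + rewrite Rabs_R0. destruct (off_diag p g h (a, b)); lra.
      + destruct (Req_dec (e a b) 0) as [Ez|Ez].
        * unfold F. rewrite Ez, Rmult_0_r, Rabs_R0. destruct (off_diag p g h (a, b)); lra.
        * rewrite (He3 a b E Ez).
          assert (Hab : 0 < / (INR a * INR b)) by (apply Rinv_0_lt_compat; nra).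
          assert (HTa : 0 <= T a <= Ct * Rpower (INR a) delta) by (split; [apply pos_INR|apply HT; lia]).
          assert (HTb : 0 <= T b <= Ct * Rpower (INR b) delta) by (split; [apply pos_INR|apply HT; lia]).
          assert (HTT : T a * T b <= Ct * Rpower (INR a) delta * (Ct * Rpower (INR b) delta)) by (apply Rmult_le_compat; lra).
          assert (HTT0 : 0 <= T a * T b) by (apply Rmult_le_pos; lra).
          unfold F. rewrite Rabs_mult. unfold Rdiv. rewrite (Rabs_pos_eq (T a * T b * _)) by (apply Rmult_le_pos; lra).
          apply Rle_trans with (T a * T b * / (INR a * INR b)).
          { rewrite <- (Rmult_1_r (T a * T b * / (INR a * INR b))) at 2. apply Rmult_le_compat_l; [apply Rmult_le_pos; lra|apply He1]. }
          apply Rle_trans with (Ct * Rpower (INR a) delta * (Ct * Rpower (INR b) delta) * / (INR a * INR b)).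
          { apply Rmult_le_compat_r; lra. }
          right. rewrite mult_INR, Rplus_comm, Rpower_plus, <- (Rpower_mult_distr _ _ delta) by assumption.
          replace (-1) with (Ropp 1) by ring. rewrite (Rpower_Ropp (INR a * INR b) 1), Rpower_1 by nra. ring.
    - rewrite <- (lsum_filter (off_diag p g h)), lsum_scal. apply Rmult_le_compat_l; [nra|].
      eapply Rle_trans; [apply (HO p g h d W Rr); try assumption; lia|].
      apply Rmult_le_compat_l; [apply Rmult_le_pos; [lra|apply pos_INR]|]. apply Rplus_le_compat_l.
      (* Here [W = p^(2k)], so [W^(2 delta) = p^(4 k delta) <= p^(1/2)]. *)
      apply Rle_trans with (Rpower (INR p) (/ 2) / INR p).
      + unfold Rdiv. apply Rmult_le_compat_r; [left; apply Rinv_0_lt_compat; assumption|].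
        unfold W, N. rewrite !pow_INR, <- pow_mult, <- Rpower_pow, Rpower_mult by assumption.
        apply Rle_Rpower; [apply INR_ge1; lia|]. rewrite mult_INR. simpl (INR 2). lra.
      + right. unfold P. unfold Rdiv. rewrite <- (Rpower_1 (INR p)) at 2 by assumption.
        rewrite <- Rpower_Ropp, <- Rpower_plus. f_equal. field. }
  change (Rabs (lsum (seq 1 W) (fun a => lsum (seq 1 W) (fun b => F a b)) - a_const k)
    <= (Ct * Ct * Co + Cd) * INR d * (Rpower Rr (-1 + 2 * delta) + P)).
  rewrite Hsplit. pose proof (INR_ge1 d Hd1) as Hd1R. pose proof (Rpower_pos Rr (-1 + 2 * delta)) as HRp.
  set (X := lsum (seq 1 W) (fun a => T a ^ 2 / INR a ^ 2 * e a a)) in *.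
  set (Y := lsum (seq 1 W) (fun a => lsum (seq 1 W) (fun b => if Nat.eq_dec a b then 0 else F a b))) in *.
  replace (X + Y - a_const k) with ((X - a_const k) + Y) by ring.
  eapply Rle_trans; [apply Rabs_triang|].
  assert (Cd * P <= Cd * INR d * (Rpower Rr (-1 + 2 * delta) + P)).
  { rewrite Rmult_assoc. apply Rmult_le_compat_l; [lra|]. nra. }
  lra.
Qed.

(** * From truncated sums to values of [L(1, chi)] *)

Lemma pow_diff_bound (n : nat) (x y M : R) : 0 <= x <= M -> 0 <= y <= M -> 1 <= M ->
  Rabs (x ^ n - y ^ n) <= INR n * Rabs (x - y) * M ^ n.
Proof.
  intros Hx Hy HM. induction n as [|n IH].
  - simpl. replace (1 - 1) with 0 by ring. rewrite Rabs_R0. lra.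
  - replace (x ^ S n - y ^ S n) with (x * (x ^ n - y ^ n) + (x - y) * y ^ n) by (simpl; ring).
    eapply Rle_trans; [apply Rabs_triang|]. rewrite !Rabs_mult, (Rabs_pos_eq x) by lra.
    pose proof (pow_le y n ltac:(lra)) as Hyn. rewrite (Rabs_pos_eq _ Hyn).
    pose proof (pow_incr y M n Hy) as Hi. pose proof (Rabs_pos (x - y)) as Ha.
    pose proof (pow_R1_Rle M n HM) as HMn. pose proof (Rabs_pos (x ^ n - y ^ n)) as Hb.
    rewrite S_INR. simpl.
    apply Rle_trans with (M * (INR n * Rabs (x - y) * M ^ n) + Rabs (x - y) * (M * M ^ n)).
    + apply Rplus_le_compat.
      * apply Rmult_le_compat; lra.
      * apply Rmult_le_compat_l; nra.
    + right; ring.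
Qed.

(** The base bounds both the truncated sum, at most [2 (1 + ln (p^2))], and [L(1, chi)], which
    differs from it by at most 4. The inequality [ln p <= 4 k p^(1/(4k))] makes its [2k]-th power
    [O(p^(1/2))]. *)
Lemma log_power_bound (k : nat) : (1 <= k)%nat -> exists C1, 0 < C1 /\
  forall p : nat, (2 <= p)%nat -> (6 + 4 * ln (INR p)) ^ (2 * k) <= C1 * Rpower (INR p) (/ 2).
Proof.
  intros Hk. pose proof (INR_ge1 k Hk) as Hk1.
  exists ((6 + 16 * INR k) ^ (2 * k)). split; [apply pow_lt; lra|].
  intros p Hp. pose proof (INR_ge1 p ltac:(lia)) as Hp1.
  set (eps := / (4 * INR k)). assert (He : 0 < eps) by (apply Rinv_0_lt_compat; lra).
  set (r := Rpower (INR p) eps). assert (Hr : 1 <= r) by (apply Rpower_ge1; lra).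
  assert (Hln : ln (INR p) <= 4 * INR k * r).
  { pose proof (ln_le_sub1 r ltac:(lra)) as H. unfold r at 1 in H. rewrite ln_Rpower in H.
    apply (Rmult_le_reg_l eps); [exact He|].
    replace (eps * (4 * INR k * r)) with r by (unfold eps; field; lra). lra. }
  assert (Hln0 : 0 <= ln (INR p)) by (rewrite <- ln_1; apply ln_le; lra).
  apply Rle_trans with (((6 + 16 * INR k) * r) ^ (2 * k)).
  - apply pow_incr. split; [lra|]. nra.
  - rewrite Rpow_mult_distr. right. f_equal. unfold r. rewrite <- Rpower_pow by apply Rpower_pos.
    rewrite Rpower_mult. f_equal. rewrite mult_INR. simpl (INR 2). unfold eps. field. lra.
Qed.

Lemma Cmod_partial_sum (p g m j N : nat) : (1 <= N)%nat ->
  Cmod (csum (seq 1 N) (twist (dchar p g m j))) <= 2 * (1 + ln (INR N)).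
Proof.
  intros HN. eapply Rle_trans; [apply Cmod_le_abs|]. unfold csum. simpl fst; simpl snd.
  assert (H : forall F : nat -> R, (forall n, Rabs (F n) <= 1) ->
     Rabs (lsum (seq 1 N) (fun n => F n / INR n)) <= 1 + ln (INR N)).
  { intros F HF. eapply Rle_trans; [apply lsum_Rabs|]. eapply Rle_trans; [|apply harmonic_le, HN].
    apply lsum_le. intros n Hn. apply in_seq in Hn. pose proof (INR_gt0 n ltac:(lia)) as Hn0.
    unfold Rdiv. rewrite Rabs_mult, Rabs_inv, (Rabs_pos_eq (INR n)) by lra.
    rewrite <- (Rmult_1_l (/ INR n)) at 2. apply Rmult_le_compat_r; [left; apply Rinv_0_lt_compat, Hn0|apply HF]. }
  pose proof (H (fun n => fst (dchar p g m j n)) (fun n => proj1 (dchar_le1 p g m j n))) as H1.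
  pose proof (H (fun n => snd (dchar p g m j n)) (fun n => proj2 (dchar_le1 p g m j n))) as H2.
  cbv beta in H1, H2. lra.
Qed.

Definition trunc_moment (k p g m j : nat) : R :=
  Cmod (csum (seq 1 (p ^ 2)) (twist (dchar p g m j))) ^ (2 * k).

(** The second bound multiplies the truncation error [4 / p] by [2 k] and the power [O(p^(1/2))].
    The first also covers [j = 0], the principal character, whose truncated sum has to be removed
    later. *)
Lemma trunc_moment_bounds (k : nat) : (1 <= k)%nat -> exists C1, 0 < C1 /\
  forall p g m : nat, prime (Z.of_nat p) -> is_primitive_root p g -> (1 <= m)%nat -> Nat.divide m (p - 1) ->
  (forall j, 0 <= trunc_moment k p g m j <= C1 * Rpower (INR p) (/ 2)) /\
  (forall j, (0 < j < m)%nat ->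
     Rabs (Cmod (L1 (dchar p g m j)) ^ (2 * k) - trunc_moment k p g m j) <= C1 * Rpower (INR p) (- / 2)).
Proof.
  intros Hk. destruct (log_power_bound k Hk) as [C1 [HC1 HL]]. pose proof (INR_ge1 k Hk) as Hk1.
  exists (8 * INR k * C1). split; [nra|].
  intros p g m Hp Hg Hm Hd. assert (Hp1 : (1 < p)%nat) by (destruct Hp; lia).
  pose proof (INR_ge1 p ltac:(lia)) as HpR. pose proof (HL p ltac:(lia)) as HLp.
  set (Y := 6 + 4 * ln (INR p)) in *.
  assert (Hln0 : 0 <= ln (INR p)) by (rewrite <- ln_1; apply ln_le; lra).
  assert (HS : forall j, 0 <= Cmod (csum (seq 1 (p ^ 2)) (twist (dchar p g m j))) <= Y - 4).
  { intros j. split; [apply Cmod_ge_0|].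
    eapply Rle_trans; [apply Cmod_partial_sum; pose proof (Nat.pow_nonzero p 2); lia|].
    rewrite pow_INR, ln_pow by lra. simpl (INR 2). unfold Y. lra. }
  pose proof (Rpower_pos (INR p) (/ 2)) as Hsq. split.
  - intros j. unfold trunc_moment. pose proof (HS j) as Hj. split; [apply pow_le; lra|].
    apply Rle_trans with (Y ^ (2 * k)); [apply pow_incr; lra|]. eapply Rle_trans; [exact HLp|].
    apply Rmult_le_compat_r; [lra|]. nra.
  - intros j Hj. pose proof (L1_truncation p g m j Hp Hg Hm Hd Hj) as HT. unfold trunc_moment.
    set (l := L1 (dchar p g m j)) in *. set (s := csum (seq 1 (p ^ 2)) (twist (dchar p g m j))) in *.
    pose proof (HS j) as Hs. fold s in Hs.
    assert (H4 : 4 / INR p <= 4).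
    { apply (Rmult_le_reg_r (INR p)); [lra|]. unfold Rdiv. rewrite Rmult_assoc, Rinv_l by lra. lra. }
    assert (Hls : Rabs (Cmod l - Cmod s) <= 4 / INR p).
    { apply Rabs_le_between.
      pose proof (Cmod_triangle (l - s) s) as T1. replace (l - s + s)%C with l in T1 by ring.
      pose proof (Cmod_triangle (- (l - s)) l) as T2. replace (- (l - s) + l)%C with s in T2 by ring.
      rewrite Cmod_opp in T2. lra. }
    pose proof (Cmod_ge_0 l) as Hl0.
    eapply Rle_trans; [apply (pow_diff_bound (2 * k) _ _ Y)|].
    + apply Rabs_le_between in Hls. lra.
    + lra.
    + unfold Y; lra.
    + rewrite mult_INR. simpl (INR 2). pose proof (pow_le Y (2 * k) ltac:(unfold Y; lra)) as HY.
      apply Rle_trans with (2 * INR k * (4 / INR p) * (C1 * Rpower (INR p) (/ 2))).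
      * apply Rmult_le_compat; [|exact HY| |exact HLp].
        -- apply Rmult_le_pos; [lra|apply Rabs_pos].
        -- apply Rmult_le_compat_l; lra.
      * right. replace (- / 2) with (/ 2 + - (1)) by field. rewrite Rpower_plus, Rpower_Ropp, Rpower_1 by lra.
        field. lra.
Qed.

Lemma dchar_one (p g m j : nat) : prime (Z.of_nat p) -> is_primitive_root p g ->
  (1 <= m)%nat -> Nat.divide m (p - 1) -> dchar p g m j 1 = 1%C.
Proof.
  intros Hp Hg Hm Hd. rewrite (dchar_pow p g m j 1 0) by (assumption || reflexivity).
  unfold phase. simpl (INR 0). rewrite Rmult_0_r. unfold Rdiv. rewrite Rmult_0_l. apply cis_0.
Qed.

(** * Averages over all characters and over odd characters *)

Lemma weighted_moment_expansion (k p g m : nat) (w : nat -> R) : prime (Z.of_nat p) -> is_primitive_root p g ->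
  (1 <= m)%nat -> Nat.divide m (p - 1) ->
  lsum (seq 0 m) (fun j => w j * trunc_moment k p g m j) =
  lsum (seq 1 ((p ^ 2) ^ k)) (fun a => lsum (seq 1 ((p ^ 2) ^ k)) (fun b =>
    INR (tcount k (p ^ 2) a) * INR (tcount k (p ^ 2) b) / (INR a * INR b) *
    lsum (seq 0 m) (fun j => w j * Kform (dchar p g m j) a b))).
Proof.
  intros Hp Hg Hm Hd.
  set (V := seq 1 ((p ^ 2) ^ k)).
  set (T := fun a b => INR (tcount k (p ^ 2) a) * INR (tcount k (p ^ 2) b) / (INR a * INR b)).
  transitivity (lsum (seq 0 m) (fun j => lsum V (fun a => lsum V (fun b => T a b * (w j * Kform (dchar p g m j) a b))))).
  - apply lsum_ext. intros j _. unfold trunc_moment. rewrite Cmod_csum_expansion.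
    + rewrite <- lsum_scal. apply lsum_ext. intros a _. rewrite <- lsum_scal. apply lsum_ext. intros b _.
      unfold T. ring.
    + apply dchar_one; assumption.
    + intros a b. apply dchar_mul; assumption.
  - rewrite lsum_swap. apply lsum_ext. intros a _. rewrite lsum_swap. apply lsum_ext. intros b _.
    apply lsum_scal.
Qed.

(** The indicator of [a / b] in the coset of [G_m] by [g^(-h)]. It is used at shift 0, giving [G_m],
    and at shift [m / 2], giving [-G_m] when [(p - 1) / m] is odd. *)
Definition coset_ind (p g m h a b : nat) : R :=
  if (is_unit p a && is_unit p b && Nat.eqb ((dlog_diff p g a b + h) mod m) 0)%bool then 1 else 0.

Lemma mean_moment (k p g m : nat) : prime (Z.of_nat p) -> is_primitive_root p g ->
  (1 <= m)%nat -> Nat.divide m (p - 1) ->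
  / INR m * lsum (seq 0 m) (trunc_moment k p g m) =
  lsum (seq 1 ((p ^ 2) ^ k)) (fun a => lsum (seq 1 ((p ^ 2) ^ k)) (fun b =>
    INR (tcount k (p ^ 2) a) * INR (tcount k (p ^ 2) b) / (INR a * INR b) * coset_ind p g m 0 a b)).
Proof.
  intros Hp Hg Hm Hd. pose proof (INR_gt0 m Hm) as Hm0.
  rewrite (lsum_ext _ _ (fun j => 1 * trunc_moment k p g m j)) by (intros; ring).
  rewrite weighted_moment_expansion by assumption.
  rewrite <- lsum_scal. apply lsum_ext. intros a _. rewrite <- lsum_scal. apply lsum_ext. intros b _.
  rewrite (lsum_ext _ _ (fun j => Kform (dchar p g m j) a b)) by (intros; ring).
  rewrite orthogonality by assumption. unfold coset_ind. rewrite Nat.add_0_r.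
  set (q := INR _ * INR _ / _). destruct (_ && _)%bool; field; lra.
Qed.

Lemma mean_moment_alternating (k p g m h : nat) : prime (Z.of_nat p) -> is_primitive_root p g ->
  m = (2 * h)%nat -> (1 <= m)%nat -> Nat.divide m (p - 1) ->
  / INR m * lsum (seq 0 m) (fun j => (if Nat.odd j then -1 else 1) * trunc_moment k p g m j) =
  lsum (seq 1 ((p ^ 2) ^ k)) (fun a => lsum (seq 1 ((p ^ 2) ^ k)) (fun b =>
    INR (tcount k (p ^ 2) a) * INR (tcount k (p ^ 2) b) / (INR a * INR b) * coset_ind p g m h a b)).
Proof.
  intros Hp Hg Hmh Hm Hd. pose proof (INR_gt0 m Hm) as Hm0.
  rewrite weighted_moment_expansion by assumption.
  rewrite <- lsum_scal. apply lsum_ext. intros a _. rewrite <- lsum_scal. apply lsum_ext. intros b _.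
  rewrite (orthogonality_alternating p g m h) by assumption. unfold coset_ind.
  set (q := INR _ * INR _ / _). destruct (_ && _)%bool; field; lra.
Qed.

Lemma coset_ind_range (p g m h a b : nat) : 0 <= coset_ind p g m h a b <= 1.
Proof. unfold coset_ind. destruct (_ && _)%bool; lra. Qed.

Lemma coset_ind_diag (p g m a : nat) : is_primitive_root p g -> Nat.divide m (p - 1) ->
  (a mod p <> 0)%nat -> coset_ind p g m 0 a a = 1.
Proof.
  intros Hg Hd Ha. unfold coset_ind. pose proof (dlog_spec p g a Hg Ha) as [Hlt _].
  apply is_unit_spec in Ha. rewrite Ha. unfold dlog_diff.
  replace (dlog p g a + (p - 1 - dlog p g a) + 0)%nat with (p - 1)%nat by lia.
  apply Nat.Lcm0.mod_divide in Hd. rewrite Hd. reflexivity.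
Qed.

Lemma coset_ind_diag_half (p g m h a : nat) : is_primitive_root p g -> Nat.divide m (p - 1) ->
  m = (2 * h)%nat -> (1 <= h)%nat -> (a mod p <> 0)%nat -> coset_ind p g m h a a = 0.
Proof.
  intros Hg Hd Hmh Hh Ha. unfold coset_ind. pose proof (dlog_spec p g a Hg Ha) as [Hlt _].
  unfold dlog_diff. replace (dlog p g a + (p - 1 - dlog p g a) + h)%nat with (h + p - 1)%nat by lia.
  destruct Hd as [c Hc]. replace (h + p - 1)%nat with (h + c * m)%nat by lia.
  rewrite Nat.Div0.mod_add, Nat.mod_small by lia.
  destruct (Nat.eqb_spec h 0); [lia|]. rewrite Bool.andb_false_r. reflexivity.
Qed.

(** In both cosets the index of [a / b] is a multiple of [h], even for shift 0 and odd for shift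
    [h]. *)
Lemma coset_ind_off_diag (p g m h s a b : nat) : m = (2 * h)%nat -> s = 0%nat \/ s = h -> a <> b ->
  coset_ind p g m s a b <> 0 -> off_diag p g h (a, b) = true.
Proof.
  intros Hmh Hs Hne H. unfold coset_ind in H.
  destruct (is_unit p a && is_unit p b && Nat.eqb ((dlog_diff p g a b + s) mod m) 0)%bool eqn:E; [|tauto].
  rewrite !Bool.andb_true_iff, !is_unit_spec, Nat.eqb_eq in E. destruct E as [[Ha Hb] E].
  apply off_diag_spec. repeat split; try assumption.
  apply Nat.Lcm0.mod_divide in E. apply Nat.Lcm0.mod_divide. destruct E as [c Hc].
  destruct Hs as [-> | ->]; [exists (2 * c)%nat; nia|exists (2 * c - 1)%nat; nia].
Qed.

Lemma length_filter_odd (h : nat) : length (filter Nat.odd (seq 0 (2 * h))) = h.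
Proof.
  induction h as [|h IH]; [reflexivity|]. replace (2 * S h)%nat with (S (S (2 * h))) by lia.
  rewrite !seq_S, !filter_app, !length_app, IH. simpl (0 + _)%nat.
  assert (E : Nat.odd (2 * h) = false) by (rewrite Nat.odd_mul; reflexivity).
  simpl filter. change (h + (h + 0))%nat with (2 * h)%nat.
  replace (Nat.odd (S (2 * h))) with true by (rewrite Nat.odd_succ, <- Nat.negb_odd, E; reflexivity).
  rewrite E. simpl. lia.
Qed.

Lemma sumR_charlist (P : (nat -> C) -> Prop) (F : (nat -> C) -> R) (chi : nat -> nat -> C) (js : list nat) :
  Permutation (charlist P) (map chi js) ->
  sumR (map F (charlist P)) = lsum js (fun j => F (chi j)) /\ length (charlist P) = length js.
Proof.
  intros H. split.
  - change (lsum (charlist P) F = lsum js (fun j => F (chi j))). rewrite (lsum_perm _ _ F H). apply lsum_map.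
  - rewrite (Permutation_length H), length_map. reflexivity.
Qed.

Lemma moment_estimate (k : nat) (delta : R) : 0 < delta <= / 4 -> (1 <= k)%nat ->
  4 * INR k * delta <= / 2 -> exists C1, 0 < C1 /\
  forall (p m d : nat) (Rr : R), prime (Z.of_nat p) -> (p - 1 = m * d)%nat -> Nat.Odd d -> (3 <= d)%nat -> 1 <= Rr ->
  (forall a b, (1 <= a)%nat -> (1 <= b)%nat -> a <> b ->
     ((a ^ (2 * d)) mod p = (b ^ (2 * d)) mod p)%nat -> Rr < INR (a * b)) ->
  Rabs (Mnu (2 * k) p m - a_const k)
    <= C1 * INR d * (Rpower Rr (-1 + 2 * delta) + Rpower (INR p) (- / 2)) /\
  Rabs (Mnu_minus (2 * k) p m - a_const k)
    <= C1 * INR d * (Rpower Rr (-1 + 2 * delta) + Rpower (INR p) (- / 2)).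
Proof.
  intros Hdelta Hk Hkd.
  destruct (weighted_double_sum k delta Hdelta Hk Hkd) as [Cw [HCw HW]].
  destruct (trunc_moment_bounds k Hk) as [Ct [HCt HT]].
  exists (Cw + 3 * Ct). split; [lra|].
  intros p m d Rr Hp Hmd Hodd Hd3 HR Hnon.
  destruct (primitive_root p Hp) as [g Hg]. change (is_primitive_root p g) in Hg.
  assert (Hp1 : (1 < p)%nat) by (destruct Hp; lia).
  assert (Hm : (1 <= m)%nat) by nia.
  assert (Hdv : Nat.divide m (p - 1)) by (exists d; lia).
  assert (Hp3 : (3 <= p)%nat) by nia.
  (* With [d = 2 c + 1] and [H] the index of [-1], the relation [2 H = m d] gives
     [m = 2 (H - c m)]. *)
  assert (exists h, m = (2 * h)%nat) as [h Hmh].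
  { pose proof (dlog_minus_one p g Hp Hg Hp3) as H2. destruct Hodd as [c Hc].
    exists (dlog p g (p - 1) - c * m)%nat. nia. }
  assert (Hh : (1 <= h)%nat) by lia.
  assert (Hd2 : (p - 1 = 2 * h * d)%nat) by (rewrite Hmd, Hmh; reflexivity).
  destruct (HT p g m Hp Hg Hm Hdv) as [HB HA]. clear HT.
  set (A := fun j => Cmod (L1 (dchar p g m j)) ^ (2 * k)).
  set (B := trunc_moment k p g m) in *.
  change (forall j, (0 < j < m)%nat -> Rabs (A j - B j) <= Ct * Rpower (INR p) (- / 2)) in HA.
  set (P := Rpower (INR p) (- / 2)) in *. assert (HP : 0 < P) by apply Rpower_pos.
  set (Rd := Rpower Rr (-1 + 2 * delta)). assert (HRd : 0 < Rd) by apply Rpower_pos.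
  pose proof (INR_gt0 m Hm) as Hm0. pose proof (INR_gt0 h Hh) as Hh0.
  assert (Hd1 : 1 <= INR d) by (apply INR_ge1; lia).
  assert (HPd : P <= INR d * (Rd + P)) by nra.
  split.
  - set (V := / INR m * lsum (seq 0 m) B).
    assert (HV : Rabs (V - a_const k) <= Cw * INR d * (Rd + P)).
    { unfold V, B. rewrite mean_moment by assumption. apply (HW p g h d); try assumption.
      - intros a b. pose proof (coset_ind_range p g m 0 a b). apply Rabs_le. lra.
      - intros a Ha. apply coset_ind_diag; assumption.
      - intros a b Hne Hnz. apply (coset_ind_off_diag p g m h 0); auto. }
    assert (HM : Mnu (2 * k) p m = / INR m * lsum (seq 1 (m - 1)) A).
    { unfold Mnu. f_equal. apply (sumR_charlist _ (fun chi => Cmod (L1 chi) ^ (2 * k)) (dchar p g m)).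
      apply charlist_nonprincipal; assumption. }
    assert (HAB : Rabs (lsum (seq 1 (m - 1)) A - lsum (seq 1 (m - 1)) B) <= INR m * (Ct * P)).
    { rewrite <- lsum_minus. eapply Rle_trans; [apply lsum_Rabs|].
      apply Rle_trans with (lsum (seq 1 (m - 1)) (fun _ => Ct * P)).
      - apply lsum_le. intros j Hj. apply in_seq in Hj. apply (HA j). lia.
      - rewrite lsum_const, length_seq. apply Rmult_le_compat_r; [nra|]. apply le_INR. lia. }
    (* The principal character: its truncated moment is [O(p^(1/2))], and dividing by [m], with
       [p <= 2 m d], leaves [O(d p^(-1/2))]. *)
    assert (HB0 : / INR m * B 0%nat <= 2 * Ct * (INR d * P)).
    { apply Rle_trans with (/ INR m * (Ct * Rpower (INR p) (/ 2))).
      - apply Rmult_le_compat_l; [left; apply Rinv_0_lt_compat; assumption|]. apply HB.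
      - assert (HpR : INR p <= 2 * (INR m * INR d)).
        { rewrite <- !mult_INR, <- Hmd, <- (mult_INR 2). apply le_INR. lia. }
        pose proof (INR_gt0 p ltac:(lia)) as Hp0.
        assert (Esq : Rpower (INR p) (/ 2) = INR p * P).
        { unfold P. rewrite <- (Rpower_1 (INR p)) at 2 by assumption. rewrite <- Rpower_plus. f_equal. field. }
        rewrite Esq. apply (Rmult_le_reg_l (INR m)); [assumption|].
        rewrite <- Rmult_assoc, Rinv_r, Rmult_1_l by lra.
        apply Rle_trans with (Ct * P * (2 * (INR m * INR d))); [|right; ring].
        replace (Ct * (INR p * P)) with (Ct * P * INR p) by ring. apply Rmult_le_compat_l; nra. }
    assert (HBs : lsum (seq 0 m) B = B 0%nat + lsum (seq 1 (m - 1)) B).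
    { replace m with (S (m - 1)) at 1 by lia. reflexivity. }
    assert (E : Mnu (2 * k) p m - a_const k =
      / INR m * (lsum (seq 1 (m - 1)) A - lsum (seq 1 (m - 1)) B) - / INR m * B 0%nat + (V - a_const k)).
    { unfold V. rewrite HM, HBs. ring. }
    assert (H1 : Rabs (/ INR m * (lsum (seq 1 (m - 1)) A - lsum (seq 1 (m - 1)) B)) <= Ct * P).
    { rewrite Rabs_mult, Rabs_inv, (Rabs_pos_eq (INR m)) by lra. apply (Rmult_le_reg_l (INR m)); [assumption|].
      rewrite <- Rmult_assoc, Rinv_r, Rmult_1_l by lra. exact HAB. }
    assert (H0 : 0 <= / INR m * B 0%nat).
    { apply Rmult_le_pos; [left; apply Rinv_0_lt_compat; assumption|]. apply HB. }
    rewrite E. apply Rabs_le_between in H1. apply Rabs_le_between in HV. apply Rabs_le_between.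
    assert (INR d * P <= INR d * (Rd + P)) by nra.
    assert (Ct * P <= Ct * (INR d * (Rd + P))) by (apply Rmult_le_compat_l; lra).
    assert (2 * Ct * (INR d * P) <= 2 * Ct * (INR d * (Rd + P))) by (apply Rmult_le_compat_l; lra).
    lra.
  - set (os := filter Nat.odd (seq 0 m)).
    assert (Hlen : length os = h) by (unfold os; rewrite Hmh; apply length_filter_odd).
    destruct (sumR_charlist (fun chi => in_X p m chi /\ odd_char p chi)
      (fun chi => Cmod (L1 chi) ^ (2 * k)) (dchar p g m) os) as [HS HL].
    { apply (charlist_odd p g m d); assumption. }
    assert (HM : Mnu_minus (2 * k) p m = / INR h * lsum os A).
    { unfold Mnu_minus. rewrite HL, HS, Hlen. reflexivity. }
    set (V := / INR h * lsum os B).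
    (* The factor [1 - (-1)^j] is 2 at odd [j] and 0 at even [j], and [2 / m = 1 / h]. *)
    assert (HVe : V = / INR m * lsum (seq 0 m) B -
      / INR m * lsum (seq 0 m) (fun j => (if Nat.odd j then -1 else 1) * B j)).
    { rewrite <- Rmult_minus_distr_l, <- lsum_minus. unfold V, os. rewrite lsum_filter.
      rewrite (lsum_ext _ (fun j => B j - _) (fun j => 2 * (if Nat.odd j then B j else 0))).
      - rewrite lsum_scal. rewrite Hmh at 2. rewrite mult_INR. simpl (INR 2). field. lra.
      - intros j _. destruct (Nat.odd j); ring. }
    assert (HV : Rabs (V - a_const k) <= Cw * INR d * (Rd + P)).
    { rewrite HVe. unfold B. rewrite mean_moment, (mean_moment_alternating k p g m h) by assumption.
      rewrite <- lsum_minus.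
      rewrite (lsum_ext _ _ (fun a => lsum (seq 1 ((p ^ 2) ^ k)) (fun b =>
         INR (tcount k (p ^ 2) a) * INR (tcount k (p ^ 2) b) / (INR a * INR b) *
         (coset_ind p g m 0 a b - coset_ind p g m h a b)))).
      2: { intros a _. rewrite <- lsum_minus. apply lsum_ext. intros b _. ring. }
      apply (HW p g h d Rr (fun a b => coset_ind p g m 0 a b - coset_ind p g m h a b)); try assumption.
      - intros a b. pose proof (coset_ind_range p g m 0 a b). pose proof (coset_ind_range p g m h a b). apply Rabs_le. lra.
      - intros a Ha. rewrite coset_ind_diag, coset_ind_diag_half by assumption. ring.
      - intros a b Hne Hnz. destruct (Req_dec (coset_ind p g m 0 a b) 0) as [E0|E0].
        + apply (coset_ind_off_diag p g m h h); auto. intros E1. apply Hnz. rewrite E0, E1. ring.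
        + apply (coset_ind_off_diag p g m h 0); auto. }
    assert (HAB : Rabs (lsum os A - lsum os B) <= INR h * (Ct * P)).
    { rewrite <- lsum_minus. eapply Rle_trans; [apply lsum_Rabs|].
      apply Rle_trans with (lsum os (fun _ => Ct * P)).
      (* An odd [j] is nonzero, so there is no principal term to remove here. *)
      - apply lsum_le. intros j Hj. apply filter_In in Hj. destruct Hj as [Hj Hjo]. apply in_seq in Hj.
        apply (HA j). split; [|lia]. destruct j; [discriminate|lia].
      - rewrite lsum_const, Hlen. lra. }
    assert (H1 : Rabs (/ INR h * (lsum os A - lsum os B)) <= Ct * P).
    { rewrite Rabs_mult, Rabs_inv, (Rabs_pos_eq (INR h)) by lra. apply (Rmult_le_reg_l (INR h)); [assumption|].
      rewrite <- Rmult_assoc, Rinv_r, Rmult_1_l by lra. exact HAB. }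
    assert (E : Mnu_minus (2 * k) p m - a_const k = / INR h * (lsum os A - lsum os B) + (V - a_const k)).
    { unfold V. rewrite HM. ring. }
    rewrite E. apply Rabs_le_between in H1. apply Rabs_le_between in HV. apply Rabs_le_between.
    assert (Ct * P <= Ct * (INR d * (Rd + P))) by (apply Rmult_le_compat_l; lra).
    assert (0 <= Ct * (INR d * (Rd + P))) by nra. lra.
Qed.

Theorem theorem2p5 :
  forall (kappa : R) (k : nat), kappa < 1 -> (1 <= k)%nat ->
  exists (C0 : R) (eps : nat -> R),
    0 < C0 /\ is_lim_seq eps 0 /\
    forall D Q Rr : R, 2 <= D -> 2 <= Q -> 2 <= Rr ->
    exists E : list nat,
      INR (length E) <= C0 * (D ^ 2 * Rr * (ln Rr) ^ 2 / ln D) /\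
      forall p : nat,
        prime (Z.of_nat p) -> Q <= INR p -> INR p <= 2 * Q -> ~ In p E ->
        forall m : nat,
          Nat.divide m (p - 1) ->
          let d := ((p - 1) / m)%nat in
          Nat.Odd d -> (3 <= d)%nat -> INR d <= D ->
          Rabs (Mnu (2 * k) p m - a_const k)
            <= C0 * (D * Rpower Rr (- kappa)
                     + D * Rpower (INR p) (- / 2 + eps p)) /\
          Rabs (Mnu_minus (2 * k) p m - a_const k)
            <= C0 * (D * Rpower Rr (- kappa)
                     + D * Rpower (INR p) (- / 2 + eps p)).
Proof.
  intros kappa k Hkappa Hk. pose proof (INR_ge1 k Hk) as Hk1.
  (* The three bounds make, in turn, the sum over gcds converge, [p^(4 k delta)] at most [p^(1/2)],
     and [Rr^(-1 + 2 delta)] at most [Rr^(-kappa)]. *)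
  set (delta := Rmin (/ 4) (Rmin (/ (8 * INR k)) ((1 - kappa) / 2))).
  assert (Hd1 : delta <= / 4) by apply Rmin_l.
  assert (Hd2 : delta <= / (8 * INR k)) by (eapply Rle_trans; [apply Rmin_r|apply Rmin_l]).
  assert (Hd3 : delta <= (1 - kappa) / 2) by (eapply Rle_trans; [apply Rmin_r|apply Rmin_r]).
  assert (Hd0 : 0 < delta).
  { unfold delta. repeat apply Rmin_glb_lt; [lra|apply Rinv_0_lt_compat; lra|lra]. }
  assert (Hkd : 4 * INR k * delta <= / 2).
  { apply Rle_trans with (4 * INR k * / (8 * INR k)); [apply Rmult_le_compat_l; lra|]. right. field. lra. }
  destruct exceptional_set as [Ce [HCe HE]].
  destruct (moment_estimate k delta (conj Hd0 Hd1) Hk Hkd) as [Cm [HCm HM]].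
  exists (Ce + Cm), (fun _ => 0). split; [lra|]. split; [apply is_lim_seq_const|].
  intros D Q Rr HD _ HR. destruct (HE D Rr HD HR) as [E [HEl HEp]]. exists E. split.
  - eapply Rle_trans; [exact HEl|]. apply Rmult_le_compat_r; [|lra].
    pose proof ln_lt_2. assert (ln 2 <= ln D) by (apply ln_le; lra).
    apply Rmult_le_pos; [|left; apply Rinv_0_lt_compat; lra].
    apply Rmult_le_pos; [apply Rmult_le_pos; [nra|lra]|apply pow2_ge_0].
  - intros p Hp _ _ HpE m Hdv d Hodd Hd3' HdD.
    assert (Hp1 : (1 < p)%nat) by (destruct Hp; lia).
    assert (Hmd : (p - 1 = m * d)%nat).
    { unfold d. apply Nat.div_exact; [|apply Nat.Lcm0.mod_divide, Hdv].
      intros ->. destruct Hdv as [c Hc]. lia. }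
    destruct (HM p m d Rr Hp Hmd Hodd Hd3' ltac:(lra)) as [M1 M2].
    (* A pair with [a b <= Rr] would put [p] in [E]; the required [d <= p] follows from
       [p - 1 = m d]. *)
    { intros a b Ha Hb Hne Heq. apply Rnot_le_lt. intros Hle.
      apply (HEp p d a b); try assumption. assert (1 <= m)%nat by nia. nia. }
    rewrite Rplus_0_r.
    assert (HF : Cm * INR d * (Rpower Rr (-1 + 2 * delta) + Rpower (INR p) (- / 2)) <=
      (Ce + Cm) * (D * Rpower Rr (- kappa) + D * Rpower (INR p) (- / 2))).
    { rewrite <- Rmult_plus_distr_l, <- Rmult_assoc. pose proof (pos_INR d).
      pose proof (Rpower_pos Rr (-1 + 2 * delta)). pose proof (Rpower_pos (INR p) (- / 2)).
      apply Rmult_le_compat; [nra|lra|apply Rmult_le_compat; lra|].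
      apply Rplus_le_compat_r, Rle_Rpower; lra. }
    split; eapply Rle_trans; eassumption.
Qed.
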